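(* Let $n\ge 1$, let $D\subset\mathbb R^n$ be a bounded domain and let $I\subset\mathbb R$ be an open interval. Let $c\in[n\pi/2,(n+1)\pi/2)$ and let $u\in\mathcal F_c(I\times D)$. Then the function $$v(x):=\inf_{t\in I}u(t,x),\qquad x\in D,$$ belongs to $F_{c-\pi/2}(D)$.
   Context: **Subequations.** $\mathrm{Sym}^2(\mathbb R^m)$ denotes the set of real symmetric $m\times m$ matrices and $\mathcal P$ the subset of nonnegative (positive semidefinite) ones. A subequation is a proper nonempty closed subset $F\subset\mathrm{Sym}^2(\mathbb R^m)$ with $F+\mathcal P\subset F$. Its dual is $\widetilde F:=(-\mathrm{int}\,F)^c$ (complement in $\mathrm{Sym}^2(\mathbb R^m)$). For an open set $U\subset\mathbb R^m$, $\mathrm{USC}(U)$ is the set of upper semicontinuous functions $U\to[-\infty,\infty)$. A function $u\in\mathrm{USC}(U)$ is subaffine, $u\in\mathrm{SA}(U)$, if for every affine function $a$ and every compact $K\subset U$, $u\le a$ on $\partial K$ implies $u\le a$ on $K$. A function $u\in\mathrm{USC}(U)$ is of type $F$, written $u\in F(U)$, if $u+v\in\mathrm{SA}(U)$ for all $v\in C^2(U)$ with $\nabla^2v(x)\in\widetilde F$ for all $x\in U$. (The constant function $-\infty$ belongs to $F(U)$; a $C^2$ function $u$ is in $F(U)$ iff $\nabla^2u(x)\in F$ for all $x\in U$.) **The special Lagrangian subequation.** For $A\in\mathrm{Sym}^2(\mathbb R^n)$ put $\widetilde\theta(A):=\mathrm{tr}\tan^{-1}(A)=\sum_j\tan^{-1}(\lambda_j(A))$,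 where $\lambda_j(A)$ are the eigenvalues of $A$ with multiplicity and $\tan^{-1}$ has values in $(-\pi/2,\pi/2)$. For $-n\pi/2<c<n\pi/2$ let $F_c:=\{A\in\mathrm{Sym}^2(\mathbb R^n):\widetilde\theta(A)\ge c\}$, which is a subequation with $\widetilde F_c=F_{-c}$. **The degenerate special Lagrangian subequation.** Let $I_n:=\mathrm{diag}(0,1,\dots,1)\in\mathrm{Sym}^2(\mathbb R^{n+1})$ and $\mathcal S:=\{A\in\mathrm{Sym}^2(\mathbb R^{n+1}):\det(I_n+\sqrt{-1}A)=0\}$, which equals the set of matrices $\mathrm{diag}(0,A^+)$ with $A^+\in\mathrm{Sym}^2(\mathbb R^n)$. Let $\arg$ be the principal argument with values in $(-\pi,\pi]$. For $A\in\mathrm{Sym}^2(\mathbb R^{n+1})$ define $$\widetilde\Theta(A):=\begin{cases}\sum_{\lambda\in\mathrm{spec}(I_n+\sqrt{-1}A)}m(\lambda)\arg(\lambda),&A\notin\mathcal S,\\ \frac{\pi}{2}+\sum_{0\ne\lambda\in\mathrm{spec}(I_n+\sqrt{-1}A)}m(\lambda)\arg(\lambda),&A\in\mathcal S,\end{cases}$$ where $m(\lambda)$ is the multiplicity of the eigenvalue $\lambda$. For $c\in(-(n+1)\pi/2,(n+1)\pi/2)$ let $\mathcal F_c:=\{A\in\mathrm{Sym}^2(\mathbb R^{n+1}):\widetilde\Theta(A)\ge c\}$, which is a subequation with $\widetilde{\mathcal F}_c=\mathcal F_{-c}$. Coordinates on $\mathbb R\times\mathbb R^n=\mathbb R^{n+1}$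 are $(t,x)$, with $t$ the zeroth coordinate. *)

(* Defs.v *)
From HB Require Import structures.
From mathcomp Require Import all_boot all_order all_algebra.
From mathcomp Require Import all_classical all_reals all_analysis.
From mathcomp Require Import complex.
Set Implicit Arguments.
Unset Strict Implicit.
Unset Printing Implicit Defensive.
Import Order.TTheory GRing.Theory Num.Theory.
Import numFieldNormedType.Exports.

Local Open Scope classical_set_scope.
Local Open Scope ring_scope.

(* Points of R^m are row vectors 'rV[R]_m.  A function on an open set U is
   represented by a total function; the predicates below only depend on its
   values on U. *)

Section Subequations.
Variables (R : realType) (m : nat).
Implicit Types (U K : set 'rV[R]_m) (F : set 'M[R]_m).

Definition Sym2 : set 'M[R]_m := [set A | A^T = A].

(* Interior relative to Sym^2: as a subset of all matrices, F has in general
   empty interior. *)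
Definition Sym2_interior F : set 'M[R]_m :=
  [set A | Sym2 A /\ within Sym2 (nbhs A) F].

Definition dual_subeq F : set 'M[R]_m :=
  [set A | Sym2 A /\ ~ Sym2_interior F (- A)].

Definition USC U (u : 'rV[R]_m -> \bar R) : Prop :=
  forall x, U x -> (u x < +oo)%E /\
    forall a : R, (u x < a%:E)%E ->
      \forall y \near within U (nbhs x), (u y < a%:E)%E.

Definition topo_boundary K : set 'rV[R]_m := closure K `\` interior K.

Definition affine_fun (a : 'rV[R]_m -> R) : Prop :=
  exists (b : R) (p : 'rV[R]_m), forall x, a x = b + \sum_(i < m) p 0 i * x 0 i.

Definition subaffine U (u : 'rV[R]_m -> \bar R) : Prop :=
  USC U u /\
  forall (a : 'rV[R]_m -> R) K, affine_fun a -> compact K -> K `<=` U ->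
    (forall x, topo_boundary K x -> (u x <= (a x)%:E)%E) ->
    forall x, K x -> (u x <= (a x)%:E)%E.

Definition partial (i : 'I_m) (f : 'rV[R]_m -> R) : 'rV[R]_m -> R :=
  fun x => 'D_(delta_mx 0 i : 'rV[R]_m) f x.

Definition C1_on U (f : 'rV[R]_m -> R) : Prop :=
  forall x, U x -> {for x, continuous f} /\
    forall i : 'I_m, derivable f x (delta_mx 0 i : 'rV[R]_m) /\
                     {for x, continuous (partial i f)}.

Definition C2_on U (f : 'rV[R]_m -> R) : Prop :=
  C1_on U f /\ forall i : 'I_m, C1_on U (partial i f).

Definition hessian (f : 'rV[R]_m -> R) (x : 'rV[R]_m) : 'M[R]_m :=
  \matrix_(i, j) partial i (partial j f) x.

Definition of_type F U (u : 'rV[R]_m -> \bar R) : Prop :=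
  USC U u /\
  forall v : 'rV[R]_m -> R, C2_on U v ->
    (forall x, U x -> dual_subeq F (hessian v x)) ->
    subaffine U (fun x => (u x + (v x)%:E)%E).

End Subequations.

Section SpecialLagrangian.
Variable R : realType.

(* The multiplicity of an eigenvalue is the algebraic one, that is, its
   multiplicity as a root of the characteristic polynomial.  The sums over
   spectra below have finite support. *)

Definition theta_SL n (A : 'M[R]_n) : R :=
  \sum_(l \in [set l : R | eigenvalue A l]) atan l *+ mup l (char_poly A).

Definition SL_subeq n (c : R) : set 'M[R]_n :=
  [set A | Sym2 A /\ c <= theta_SL A].

(* Principal argument, with values in (-pi, pi]; the value at 0 is junk. *)
Definition carg (z : R[i]) : R :=
  let: Complex a b := z in
  let t := acos (a / Num.sqrt (a ^+ 2 + b ^+ 2)) in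
  if 0 <= b then t else - t.

Definition degI n : 'M[R]_(1 + n) := block_mx 0 0 0 1%:M.

Definition degI_plus_iA n (A : 'M[R]_(1 + n)) : 'M[R[i]]_(1 + n) :=
  \matrix_(i, j) Complex (degI n i j) (A i j).

Definition degenerate_locus n : set 'M[R]_(1 + n) :=
  [set A | Sym2 A /\ \det (degI_plus_iA A) = 0].

Definition Theta_DSL n (A : 'M[R]_(1 + n)) : R :=
  let M := degI_plus_iA A in
  if A \in @degenerate_locus n then
    pi / 2 + \sum_(l \in [set l : R[i] | eigenvalue M l /\ l != 0])
               carg l *+ mup l (char_poly M)
  else
    \sum_(l \in [set l : R[i] | eigenvalue M l]) carg l *+ mup l (char_poly M).

Definition DSL_subeq n (c : R) : set 'M[R]_(1 + n) :=
  [set A | Sym2 A /\ c <= Theta_DSL A].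

(* The coordinates (t, x) of R x R^n. *)
Definition coord_tx n (t : R) (x : 'rV[R]_n) : 'rV[R]_(1 + n) := row_mx t%:M x.

Definition cylinder n (J : set R) (D : set 'rV[R]_n) : set 'rV[R]_(1 + n) :=
  [set coord_tx t x | t in J & x in D].

Definition bounded_domain n (D : set 'rV[R]_n) : Prop :=
  [/\ open D, connected D, D !=set0 & bounded_set D].

Definition open_interval (J : set R) : Prop :=
  [/\ open J, is_interval J & J !=set0].

End SpecialLagrangian.

(* Main.v *)
(** Write [A] in block form with corner entry [a > 0] and off-diagonal block
    [- a p]; then [Theta A = pi / 2 + theta S], where [S] is the Schur complement.
    Hence for [c >= n pi / 2] a test function whose Hessian has a Schur
    complement outside [F_(c - pi/2)] is admissible for [u], whatever the slope [p].
    Matrices in [F_(c - pi/2)] are nonnegative, and [theta] is concave there, so a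
    matrix outside this set is separated from it by a trace form [tr (G . G^T)],
    i.e. by a constant coefficient operator [L = sum_k D_(g_k)^2].

    If [v = inf_t u] failed the viscosity inequality at [x1], some quadratic
    polynomial [phi], with Hessian outside [F_(c - pi/2)], would dominate [v] on a
    small sphere around [x1] but not at [x1].  As [u] is quasiconvex in [t], the
    sets [{t | u (t, x) < phi x}] are open intervals, and a polynomial [tau] can be
    selected in them over the sphere.  Extend it to an [L]-harmonic polynomial in
    the ball.  Then [phi + N (t - tau)^2] is an admissible test function, since
    [L] of its Schur complement equals [L phi].  For large [N] it dominates [u] on
    the boundary of a tube around the graph of [tau], hence at [(tau x1, x1)],
    which gives [v x1 <= phi x1]. *)

Require Import Defs.
From mathcomp Require Import all_boot all_order all_algebra.
From mathcomp Require Import all_classical all_reals all_analysis.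
From mathcomp Require Import complex spectral sesquilinear ring lra.
Set Implicit Arguments.
Unset Strict Implicit.
Unset Printing Implicit Defensive.
Import Order.TTheory GRing.Theory Num.Theory.
Import numFieldNormedType.Exports.
Local Open Scope classical_set_scope.
Local Open Scope ring_scope.

(** * Sums of arguments of eigenvalues *)

Section Argument.
Variable R : realType.
Implicit Types (z w : R[i]) (s : seq R[i]).

Local Notation normc := ComplexField.Normc.normc.

(** The formula for [Theta] is delicate because clearing the off-diagonal block is a congruence, not
    a similarity: it preserves the determinant but moves the eigenvalues, and the determinant gives
    the sum of their arguments only modulo [2 pi]. A homotopy that shrinks the block to zero removes
    the ambiguity; it is run through determinants, so that no eigenvalue is followed individually.

    Harmonicity of [tau] is forced by the size of [N]. Off the graph the Schur complement contains
    [- 2 N (t - tau)] times the Hessian of [tau], a large term of either sign; an operator that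
    annihilates this Hessian keeps the test function admissible all the same. The Hessian of [phi]
    is constant so that one operator serves at every point.

    Working with polynomials makes both analytic ingredients finite: the Dirichlet problem on a
    Euclidean ball becomes linear algebra in bounded degree, and a selection becomes a Bernstein
    polynomial. The values selected first may jump from point to point, since quasiconvexity fills
    in whatever lies between two good values. *)

Definition cis (t : R) : R[i] := Complex (cos t) (sin t).

Lemma cisD a b : cis (a + b) = cis a * cis b.
Proof. by rewrite /cis cosD sinD; simpc; congr Complex; ring. Qed.

Lemma cis0 : cis 0 = 1.
Proof. by rewrite /cis cos0 sin0. Qed.

Lemma normc_gt0 z : z != 0 -> 0 < normc z.
Proof.
move=> z0; rewrite lt_def; apply/andP; split.
  by apply: contraNneq z0 => /ComplexField.Normc.eq0_normc ->.
by case: z {z0} => a b /=; exact: sqrtr_ge0.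
Qed.

Lemma carg_polar z : z != 0 -> z = (normc z)%:C%C * cis (carg z).
Proof.
move=> z0; have := normc_gt0 z0; move: z0; case: z => a b z0.
set r := normc _ => r0.
have rE : r ^+ 2 = a ^+ 2 + b ^+ 2.
  by rewrite /r /= sqr_sqrtr// addr_ge0 ?sqr_ge0.
have ar : -1 <= a / r <= 1.
  rewrite -ler_norml normrM normfV (gtr0_norm r0) ler_pdivrMr// mul1r.
  rewrite -(@ler_pXn2r _ 2)// ?nnegrE ?(ltW r0)// real_normK ?num_real// rE.
  by rewrite lerDl sqr_ge0.
have sE : r * sin (acos (a / r)) = `|b|.
  rewrite sin_acos// -[X in X * _](gtr0_norm r0) -sqrtr_sqr -sqrtrM ?sqr_ge0//.
  rewrite -sqrtr_sqr; congr Num.sqrt; rewrite mulrBr mulr1 expr_div_n.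
  by rewrite mulrC divfK ?sqrf_eq0 ?gt_eqF// rE addrC addKr.
rewrite /cis /carg -/r /=.
have cE : r * cos (acos (a / r)) = a.
  by rewrite acosK ?in_itv//= mulrC divfK ?gt_eqF.
case: (leP 0 b) => b0.
  by simpc; congr Complex; rewrite -?[LHS]cE// -[LHS](ger0_norm b0) sE.
simpc; rewrite cosN sinN mulrN; congr Complex; first by rewrite cE.
by rewrite sE ltr0_norm// opprK.
Qed.

Lemma carg_bound z : 0 <= complex.Re z -> z != 0 ->
  - (pi / 2) <= carg z <= pi / 2.
Proof.
move=> Rez z0; have := normc_gt0 z0; move: Rez z0; case: z => a b /= a0 z0 r0.
set r := Num.sqrt _ in r0 *.
have ar : 0 <= a / r <= 1.
  rewrite divr_ge0 ?(ltW r0)//= ler_pdivrMr// mul1r.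
  rewrite -(@ler_pXn2r _ 2)// ?nnegrE ?(ltW r0)//.
  by rewrite sqr_sqrtr ?addr_ge0 ?sqr_ge0// lerDl sqr_ge0.
have ar' : -1 <= a / r <= 1 by move/andP: ar => [h ->]; rewrite (le_trans _ h)// lerN10.
have : 0 <= acos (a / r) <= pi / 2.
  rewrite acos_ge0//= leNgt; apply/negP => h.
  have := @ltr_cos R (pi / 2) (acos (a / r)).
  rewrite !in_itv/= acos_ge0// acos_lepi// divr_ge0 ?pi_ge0//=.
  rewrite ler_pdivrMr// ler_peMr ?pi_ge0 ?ler1n// => /(_ isT isT) /=.
  rewrite h acosK ?in_itv//= cos_pihalf.
  by move/andP: ar => [+ _]; rewrite leNgt => /negP.
by case: ifP => _; lra.
Qed.

(** The half-angle formula. Unlike the case split in [carg], it is visibly continuous on the closed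
    right half-plane without 0, where the denominator is positive. *)
Definition half_arg z : R :=
  atan (complex.Im z / (normc z + complex.Re z)) *+ 2.

Lemma cargE z : 0 <= complex.Re z -> z != 0 -> carg z = half_arg z.
Proof.
move=> Rez z0; have r0 := normc_gt0 z0.
have := carg_bound Rez z0; have := carg_polar z0.
move: (carg z) => t zE tb.
rewrite /half_arg; move: z0 Rez r0 zE; case: z => a b z0 /= a0.
set r := Num.sqrt _ => r0 [aE bE].
have rE : r ^+ 2 = a ^+ 2 + b ^+ 2.
  by rewrite /r /= sqr_sqrtr// addr_ge0 ?sqr_ge0.
have ra : 0 < r + a by lra.
set q := b / (r + a).
have q1 : `|q| <= 1.
  rewrite normrM normfV (gtr0_norm ra) ler_pdivrMr// mul1r.
  rewrite -(@ler_pXn2r _ 2)// ?nnegrE ?(ltW ra)// real_normK ?num_real//.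
  by rewrite sqrrD rE; nra.
have qb : - (pi / 2) <= atan q *+ 2 <= pi / 2.
  have : - atan 1 <= atan q <= atan 1.
    by move: q1; rewrite ler_norml -atanN => /andP[h1 h2]; rewrite !le_atan.
  by rewrite atan1 -mulr_natr; lra.
have c0 : cos (atan q) != 0.
  by rewrite gt_eqF// cos_gt0_pihalf// atan_gtNpi2 atan_ltpi2.
apply: (@sin_inj R); rewrite ?in_itv/= ?tb ?qb//.
rewrite sin_mulr2n.
have sE : sin (atan q) = q * cos (atan q).
  by rewrite -[X in _ = X * _]atanK /tan divfK.
rewrite sE mulrCA -expr2 cos_atan exprVn sqr_sqrtr ?addr_ge0 ?sqr_ge0//.
have -> : sin t = b / r by rewrite bE mul0r addr0 mulrC mulKf ?gt_eqF.
have q2 : 1 + q ^+ 2 = r *+ 2 / (r + a).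
  rewrite /q; have -> : r *+ 2 / (r + a) = r *+ 2 * (r + a) / (r + a) ^+ 2.
    by field; rewrite gt_eqF.
  have b2 : b ^+ 2 = r ^+ 2 - a ^+ 2 by rewrite rE; ring.
  by rewrite exprMn b2; field; rewrite gt_eqF.
by rewrite q2 /q; field; rewrite !gt_eqF.
Qed.

Lemma prod_polar s : all (predC1 0) s ->
  \prod_(z <- s) z = (\prod_(z <- s) normc z)%:C%C * cis (\sum_(z <- s) carg z).
Proof.
elim: s => [|z s IH] /=; first by rewrite !big_nil cis0 mulr1.
case/andP=> z0 /IH sE; rewrite !big_cons sE cisD {1}(carg_polar z0).
by rewrite rmorphM/=; ring.
Qed.

End Argument.

Section ArgumentSum.
Variable R : realType.
Implicit Types (z w : R[i]) (s : seq R[i]).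

Local Notation normc := ComplexField.Normc.normc.

Definition to1 (y : R) z : R[i] := (1 - y)%:C%C * z + y%:C%C.

(** The eigenvalues met below live here. The set is star-shaped about 1, so the segments [to1] never
    meet 0. *)
Definition rhalf : pred R[i] := [pred z | (0 <= complex.Re z) && (z != 0)].

Lemma to1_0 z : to1 0 z = z.
Proof. by rewrite /to1 subr0 mul1r addr0. Qed.

Lemma to1_1 z : to1 1 z = 1.
Proof. by rewrite /to1 subrr mul0r add0r. Qed.

Lemma to1_rhalf y z : 0 <= y <= 1 -> rhalf z -> rhalf (to1 y z).
Proof.
case: z => a b /andP[y0 y1] /andP[/= a0 z0]; rewrite /rhalf /to1 /=; simpc.
have h : 0 <= (1 - y) * a by rewrite mulr_ge0 ?subr_ge0.
rewrite addr_ge0//=; move: y0; rewrite le_eqVlt => /predU1P[<-|y0].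
  by rewrite !subr0 !mul1r !addr0.
by apply/negP; rewrite eq_complex/= => /andP[/eqP h1 _]; lra.
Qed.

Lemma continuous_half_arg_to1 z y : 0 <= y <= 1 -> rhalf z ->
  {for y, continuous (fun y => half_arg (to1 y z))}.
Proof.
case: z => a b y01 hz; have /andP[h0 h1] := to1_rhalf y01 hz.
have := normc_gt0 h1; move: h0 {h1}; rewrite /to1; simpc => /= h0 h1.
have -> : (fun y : R => half_arg (to1 y (a +i* b)%C)) =
  (fun y : R => atan ((1 - y) * b /
     (Num.sqrt (((1 - y) * a + y) ^+ 2 + ((1 - y) * b) ^+ 2)
       + ((1 - y) * a + y))) *+ 2).
  by apply/funext => t; rewrite /half_arg /to1; simpc.
have cim : {for y, continuous (fun y : R => (1 - y) * b)}.
  by apply: cvgM; [apply: cvgB; [exact: cvg_cst|exact: cvg_id]|exact: cvg_cst].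
have cre : {for y, continuous (fun y : R => (1 - y) * a + y)}.
  apply: cvgD; last exact: cvg_id.
  by apply: cvgM; [apply: cvgB; [exact: cvg_cst|exact: cvg_id]|exact: cvg_cst].
apply: cvgMn; apply: continuous_cvg; first exact: continuous_atan.
apply: cvgM; first exact: cim.
apply: cvgV; first by rewrite gt_eqF//; lra.
apply: cvgD; last exact: cre.
apply: continuous_cvg; first exact: sqrt_continuous.
apply: cvgD; rewrite ?expr2; apply: cvgM; assumption.
Qed.

Lemma continuous_argsum s : all rhalf s ->
  {in `[0, 1], continuous (fun y => \sum_(z <- s) half_arg (to1 y z))}.
Proof.
move=> + y; rewrite in_itv/=; elim: s => [|z s IH] /=.
  by move=> _ _; under eq_fun do rewrite big_nil; exact: cvg_cst.
case/andP=> hz /IH{}IH y01; under eq_fun do rewrite big_cons.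
by apply: cvgD; [exact: continuous_half_arg_to1|exact: IH].
Qed.

(** The real inner product of the plane; for nonzero numbers its sign is that of the cosine of the
    angle between them. *)
Definition RePr (z w : R[i]) : R := complex.Re (z * w^*%C).

Lemma RePr_polar (r1 r2 a b : R) :
  RePr (r1%:C%C * cis a) (r2%:C%C * cis b) = r1 * r2 * cos (a - b).
Proof. by rewrite /RePr /cis cosB; simpc => /=; ring. Qed.

Lemma normc_prod_gt0 s : all (predC1 0) s -> 0 < \prod_(z <- s) normc z.
Proof.
elim: s => [|z s IH] /=; first by rewrite big_nil.
by case/andP=> z0 /IH sE; rewrite big_cons mulr_gt0// normc_gt0.
Qed.

(* The difference of the two argument sums along the segments to 1 is
   continuous, vanishes at the end, and never hits [+-pi/2]. *)
Lemma argsum_eq s t : all rhalf s -> all rhalf t ->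
  (forall y, 0 <= y <= 1 ->
    0 < RePr (\prod_(z <- s) to1 y z) (\prod_(z <- t) to1 y z)) ->
  \prod_(z <- s) z = \prod_(z <- t) z ->
  \sum_(z <- s) carg z = \sum_(z <- t) carg z.
Proof.
move=> hs ht pos pE.
have rh0 l : all rhalf l -> all (predC1 0) l.
  by apply: sub_all => z /andP[].
have mapE (F : R[i] -> R) y l : \sum_(z <- l) F (to1 y z) =
    \sum_(z <- map (to1 y) l) F z by rewrite big_map.
have rhm l y : 0 <= y <= 1 -> all rhalf l -> all rhalf (map (to1 y) l).
  move=> y01 /allP hl; apply/allP => _ /mapP[z zl ->].
  exact/to1_rhalf/hl.
have hcE l : all rhalf l -> \sum_(z <- l) half_arg z = \sum_(z <- l) carg z.
  elim: l => [|z l IH]; first by rewrite !big_nil.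
  by move=> /= /andP[/andP[h1 h2] /IH{}IH]; rewrite !big_cons IH cargE.
pose d y := \sum_(z <- s) half_arg (to1 y z) - \sum_(z <- t) half_arg (to1 y z).
have dcos y : 0 <= y <= 1 -> 0 < cos (d y).
  move=> y01; have := pos y y01.
  rewrite -(big_map (to1 y) xpredT id) -(big_map (to1 y) xpredT id)/=.
  rewrite !prod_polar ?rh0 ?rhm// RePr_polar pmulr_rgt0.
    by rewrite /d !mapE !hcE ?rhm.
  by rewrite mulr_gt0// normc_prod_gt0// rh0// rhm.
have dc : {within `[0, 1], continuous d}.
  apply: continuous_in_subspaceT => y /set_mem /= yi.
  by apply: cvgB; apply: continuous_argsum.
have d1 : d 1 = 0.
  rewrite /d !mapE !hcE ?rhm ?ler01 ?lexx//.
  have c1 : carg (1 : R[i]) = 0.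
    by rewrite /carg /= lexx expr1n expr0n addr0 sqrtr1 divr1 acos1.
  have z1 l : \sum_(z <- map (to1 1) l) carg z = 0.
    by rewrite big_map big1// => z _; rewrite to1_1 c1.
  by rewrite !z1 subrr.
have d0 : - (pi / 2) < d 0 < pi / 2.
  apply/andP; split; rewrite ltNge; apply/negP => h.
    have [] := IVT (@ler01 R) dc (v := - (pi / 2)).
      by rewrite d1 ge_min le_max h/= oppr_le0 divr_ge0 ?pi_ge0// orbT.
    move=> y; rewrite in_itv/= => /dcos + dy.
    by rewrite dy cosN cos_pihalf ltxx.
  have [] := IVT (@ler01 R) dc (v := pi / 2).
    by rewrite d1 ge_min le_max h/= divr_ge0 ?pi_ge0// orbT.
  move=> y; rewrite in_itv/= => /dcos + dy.
  by rewrite dy cos_pihalf ltxx.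
(* Equal products have arguments that agree modulo [pi]; inside [(- pi / 2, pi / 2)] this leaves
   only [d 0 = 0]. *)
have : sin (d 0) = 0.
  have d0E : d 0 = \sum_(z <- s) carg z - \sum_(z <- t) carg z.
    rewrite /d !mapE !hcE ?rhm ?ler01 ?lexx//.
    by rewrite !big_map; congr (_ - _); apply: eq_bigr => z _; rewrite to1_0.
  move: pE; rewrite !prod_polar ?rh0// d0E.
  set A := \sum_(z <- s) _; set B := \sum_(z <- t) _.
  have := normc_prod_gt0 (rh0 _ hs); have := normc_prod_gt0 (rh0 _ ht).
  set P := \prod_(z <- s) _; set Q := \prod_(z <- t) _ => Q0 P0.
  rewrite /cis; simpc => -[e1 e2]; rewrite sinB.
  have e1' : P * cos A = Q * cos B by lra.
  have e2' : P * sin A = Q * sin B by lra.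
  have : P * (sin A * cos B - cos A * sin B) = 0.
    have -> : P * (sin A * cos B - cos A * sin B) =
      (P * sin A) * cos B - (P * cos A) * sin B by ring.
    by rewrite e1' e2'; ring.
  by move=> /eqP; rewrite mulf_eq0 gt_eqF//= => /eqP.
move=> sd.
have : d 0 = 0.
  apply: (@sin_inj R); rewrite ?in_itv/=.
  - by move/andP: d0 => [h1 h2]; rewrite !ltW.
  - by rewrite oppr_le0 divr_ge0 ?pi_ge0.
  - by rewrite sd sin0.
rewrite /d !mapE !hcE ?rhm ?ler01 ?lexx//.
rewrite !big_map => /eqP; rewrite subr_eq0 => /eqP.
by under eq_bigr do rewrite to1_0; move=> ->; apply: eq_bigr => z _; rewrite to1_0.
Qed.

End ArgumentSum.

Arguments rhalf {R}.

(** * Spectra as lists of roots of the characteristic polynomial *)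

Section Spectrum.

Lemma mup_prod_XsubC (F : fieldType) (s : seq F) (x : F) :
  mup x (\prod_(z <- s) ('X - z%:P)) = count_mem x s.
Proof.
rewrite (bigID (pred1 x))/= mupMl; last first.
  rewrite -big_filter root_prod_XsubC mem_filter negb_and.
  by rewrite /= eqxx.
rewrite (eq_bigr (fun=> 'X - x%:P)); last by move=> z /eqP ->.
by rewrite big_const_seq iter_mulr_1 mup_XsubCX eqxx.
Qed.

Lemma sum_spectrum (F : fieldType) (V : nmodType) n (M : 'M[F]_n) (s : seq F)
    (f : F -> V) : char_poly M = \prod_(z <- s) ('X - z%:P) ->
  \sum_(l \in [set l : F | eigenvalue M l]) f l *+ mup l (char_poly M) =
  \sum_(z <- s) f z.
Proof.
move=> sE; have -> : [set l : F | eigenvalue M l] = [set` undup s].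
  apply/seteqP; split => l /=.
    by rewrite eigenvalue_root_char sE root_prod_XsubC mem_undup.
  by rewrite mem_undup eigenvalue_root_char sE root_prod_XsubC.
rewrite -fsbig_seq ?undup_uniq//= -[RHS]big_undup_iterop_count.
apply: (eq_bigr (fun z => iterop (count_mem z s) +%R (f z) 0)) => z _.
by rewrite sE mup_prod_XsubC.
Qed.

(** The characteristic polynomial is evaluated at [- b / a]. With [a = 1 - y] and [b = y] this turns
    the product of the [to1 y z] over a spectrum into a determinant, which is polynomial in the
    matrix entries. *)
Lemma det_linear_pencil (F : fieldType) n (M : 'M[F]_n) (s : seq F) (a b : F) :
  char_poly M = \prod_(z <- s) ('X - z%:P) ->
  \det (a *: M + b%:M) = \prod_(z <- s) (a * z + b).
Proof.
move=> sE.
have sz : size s = n.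
  have := size_char_poly M; rewrite sE size_prod_XsubC => -[].
  by [].
have [->|a0] := eqVneq a 0.
  rewrite scale0r add0r det_scalar; under eq_bigr do rewrite mul0r add0r.
  by rewrite big_const_seq count_predT sz iter_mulr_1.
have -> : a *: M + b%:M = (- a) *: ((- (b / a))%:M - M).
  rewrite scalerBr scale_scalar_mx scaleNr opprK addrC mulrNN.
  by rewrite mulrC divfK.
rewrite detZ.
have -> : \det ((- (b / a))%:M - M) = (char_poly M).[- (b / a)].
  rewrite -[RHS]/(horner_eval _ _) /char_poly -det_map_mx; congr (\det _).
  apply/matrixP => i j; rewrite !mxE rmorphB/= /horner_eval !hornerE.
  by rewrite hornerMn hornerX.
have -> : (- a) ^+ n = \prod_(z <- s) (- a).
  by rewrite big_const_seq count_predT sz iter_mulr_1.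
rewrite sE horner_prod -big_split/=.
apply: eq_bigr => z _; rewrite !hornerE mulrDr mulrNN mulrC divfK//.
by rewrite mulrNN addrC.
Qed.

End Spectrum.

(** * Homotopy invariance of the argument sum *)

Section ArgumentHomotopy.
Variable R : realType.
Local Notation normc := ComplexField.Normc.normc.
Implicit Types (z w : R[i]) (s : seq R[i]).

(** Lipschitz in the homotopy parameter [r], uniformly in [y]. The bound on [f] itself is carried
    along to make the class closed under products, hence under determinants. *)
Definition uniform_lip (f : R -> R -> R[i]) : Prop :=
  exists2 B : R, 0 <= B & forall r r' y : R,
    0 <= r <= 1 -> 0 <= r' <= 1 -> 0 <= y <= 1 ->
    normc (f r y) <= B /\ normc (f r y - f r' y) <= B * `|r - r'|.

Lemma normc_real (x : R) : normc x%:C%C = `|x|.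
Proof. by rewrite /= expr0n addr0 sqrtr_sqr. Qed.

Lemma uniform_lip_cst z : uniform_lip (fun _ _ => z).
Proof.
have n0 : 0 <= normc z by case: z => a b; exact: sqrtr_ge0.
exists (normc z) => // r r' y _ _ _; split=> //.
by rewrite subrr normc_real normr0 mulr_ge0.
Qed.

Lemma uniform_lip_r : uniform_lip (fun r _ => r%:C%C).
Proof.
exists 1 => // r r' y r01 _ _; rewrite -rmorphB !normc_real mul1r; split=> //.
by rewrite ger0_norm; case/andP: r01.
Qed.

Lemma uniform_lip_y : uniform_lip (fun _ y => y%:C%C).
Proof.
exists 1 => // r r' y _ _ y01; rewrite -rmorphB subrr !normc_real mul1r normr0.
by split=> //; rewrite ger0_norm; case/andP: y01.
Qed.

Lemma uniform_lipD f g : uniform_lip f -> uniform_lip g ->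
  uniform_lip (fun r y => f r y + g r y).
Proof.
move=> [B B0 fB] [C C0 gC]; exists (B + C); first exact: addr_ge0.
move=> r r' y r0 r0' y0; have [f1 f2] := fB _ _ _ r0 r0' y0.
have [g1 g2] := gC _ _ _ r0 r0' y0; split.
  by rewrite (le_trans (le_normcD _ _))// lerD.
by rewrite opprD addrACA (le_trans (le_normcD _ _))// mulrDl lerD.
Qed.

Lemma uniform_lipM f g : uniform_lip f -> uniform_lip g ->
  uniform_lip (fun r y => f r y * g r y).
Proof.
have n0 z : 0 <= normc z by case: z => a b; exact: sqrtr_ge0.
move=> [B B0 fB] [C C0 gC].
exists (B * C + B * C); first by rewrite addr_ge0 ?mulr_ge0.
move=> r r' y r0 r0' y0; have [f1 f2] := fB _ _ _ r0 r0' y0.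
have [g1 g2] := gC _ _ _ r0 r0' y0; have [g1' _] := gC _ _ _ r0' r0 y0; split.
  rewrite ComplexField.Normc.normcM (@le_trans _ _ (B * C))//.
    by rewrite ler_pM.
  by rewrite lerDl mulr_ge0.
have -> : f r y * g r y - f r' y * g r' y =
  f r y * (g r y - g r' y) + (f r y - f r' y) * g r' y by ring.
rewrite (le_trans (le_normcD _ _))// !ComplexField.Normc.normcM mulrDl lerD//.
  by rewrite -mulrA ler_pM.
by rewrite mulrAC ler_pM.
Qed.

Lemma uniform_lip_sum (I : finType) (F : I -> R -> R -> R[i]) :
  (forall i, uniform_lip (F i)) -> uniform_lip (fun r y => \sum_i F i r y).
Proof.
move=> FL; elim: index_enum => [|i l IH].
  have [B B0 h] := uniform_lip_cst 0; exists B => // r r' y *.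
  by rewrite !big_nil; exact: (h r r' y).
have [B B0 h] := uniform_lipD (FL i) IH; exists B => // r r' y *.
by rewrite !big_cons; exact: (h r r' y).
Qed.

Lemma uniform_lip_prod (I : finType) (F : I -> R -> R -> R[i]) :
  (forall i, uniform_lip (F i)) -> uniform_lip (fun r y => \prod_i F i r y).
Proof.
move=> FL; elim: index_enum => [|i l IH].
  have [B B0 h] := uniform_lip_cst 1; exists B => // r r' y *.
  by rewrite !big_nil; exact: (h r r' y).
have [B B0 h] := uniform_lipM (FL i) IH; exists B => // r r' y *.
by rewrite !big_cons; exact: (h r r' y).
Qed.

Lemma uniform_lip_det n (M : R -> R -> 'M[R[i]]_n) :
  (forall i j, uniform_lip (fun r y => M r y i j)) ->
  uniform_lip (fun r y => \det (M r y)).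
Proof.
move=> ML; rewrite /determinant; apply: uniform_lip_sum => s.
apply: uniform_lipM; first exact: uniform_lip_cst.
by apply: uniform_lip_prod => i; exact: ML.
Qed.

(** For [y <= 1/2] both coordinates keep half of their size up to sign, and beyond that the real
    part is at least 1/2. *)
Lemma normc_to1_ge y z : 0 <= y <= 1 -> rhalf z ->
  (if y <= 2^-1 then 2^-1 * normc z else 2^-1) <= normc (to1 y z).
Proof.
case: z => a b /andP[y0 y1] /andP[/= a0 _]; rewrite /to1; simpc => /=.
case: (leP y 2^-1) => hy.
  rewrite -[X in X * _]ger0_norm// -sqrtr_sqr -sqrtrM ?sqr_ge0// ler_wsqrtr//.
  have h1 : 2^-1 * a <= (1 - y) * a + y by nra.
  have h2 : (2^-1 * a) ^+ 2 <= ((1 - y) * a + y) ^+ 2.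
    by rewrite ler_pXn2r// nnegrE ?mulr_ge0// addr_ge0// mulr_ge0// subr_ge0.
  have h3 : 2^-1 ^+ 2 * b ^+ 2 <= ((1 - y) * b) ^+ 2.
    rewrite exprMn ler_wpM2r ?sqr_ge0// ler_pXn2r ?nnegrE ?subr_ge0//.
    by lra.
  by move: h2; rewrite exprMn mulrDr; lra.
rewrite -[leLHS]ger0_norm// -sqrtr_sqr ler_wsqrtr//.
have h1 : 2^-1 <= (1 - y) * a + y by nra.
have h2 : 2^-1 ^+ 2 <= ((1 - y) * a + y) ^+ 2.
  by rewrite ler_pXn2r// nnegrE// addr_ge0// mulr_ge0// subr_ge0.
by rewrite (le_trans h2)// lerDl sqr_ge0.
Qed.

Lemma normc_prod s : normc (\prod_(z <- s) z) = \prod_(z <- s) normc z.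
Proof.
elim: s => [|z s IH]; first by rewrite !big_nil ComplexField.Normc.normc1.
by rewrite !big_cons ComplexField.Normc.normcM IH.
Qed.

(** The bound sees the list only through its length and its product. For a spectrum these are the
    size and the determinant, so the bound is constant along a homotopy of constant determinant. *)
Lemma normc_prod_to1_ge y s : 0 <= y <= 1 -> all rhalf s ->
  2^-1 ^+ size s * Num.min 1 (normc (\prod_(z <- s) z)) <=
  normc (\prod_(z <- s) to1 y z).
Proof.
move=> y01 hs.
have n0 z : 0 <= normc z by case: z => a b; exact: sqrtr_ge0.
have -> : \prod_(z <- s) to1 y z = \prod_(z <- map (to1 y) s) z.
  by rewrite big_map.
rewrite !normc_prod big_map.
have := @normc_to1_ge y; case: (y <= 2^-1) => h.
  apply: (@le_trans _ _ (\prod_(z <- s) (2^-1 * normc z))).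
    rewrite big_split/= big_const_seq count_predT iter_mulr_1.
    by rewrite ler_pM2l ?exprn_gt0 ?invr_gt0// ge_min lexx orbT.
  rewrite big_seq [leRHS]big_seq; apply: ler_prod => z zs.
  by rewrite mulr_ge0//= h//; apply: (allP hs).
apply: (@le_trans _ _ (\prod_(z <- s) 2^-1)).
  rewrite big_const_seq count_predT iter_mulr_1 ler_piMr ?exprn_ge0//.
  by rewrite ge_min lexx.
rewrite big_seq [leRHS]big_seq; apply: ler_prod => z zs.
by rewrite invr_ge0 ler0n h//; apply: (allP hs).
Qed.

Lemma RePr_gt0 z w : normc (z - w) < normc w -> 0 < RePr z w.
Proof.
case: z => a b; case: w => c d; rewrite /RePr; simpc => /=.
rewrite -(@ltr_pXn2r _ 2)// ?nnegrE ?sqrtr_ge0//.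
by rewrite !sqr_sqrtr ?addr_ge0 ?sqr_ge0//; nra.
Qed.

(** For nearby parameters the determinants of the two pencils [(1 - y) M + y] differ by less than
    [m], a lower bound for their moduli, so [argsum_eq] applies. Finitely many steps of length
    [1 / k] with [B / k < m] cross [[0, 1]]. *)
Lemma argsum_homotopy n (M : R -> 'M[R[i]]_n) (d : R[i]) :
  (forall i j, uniform_lip (fun r _ => M r i j)) ->
  d != 0 -> (forall r, 0 <= r <= 1 -> \det (M r) = d) ->
  (forall r s, 0 <= r <= 1 -> char_poly (M r) = \prod_(z <- s) ('X - z%:P) ->
    all rhalf s) ->
  forall s t, char_poly (M 0) = \prod_(z <- s) ('X - z%:P) ->
    char_poly (M 1) = \prod_(z <- t) ('X - z%:P) ->
  \sum_(z <- s) carg z = \sum_(z <- t) carg z.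
Proof.
move=> ML d0 dE Mh.
pose f r y := \det ((1 - y)%:C%C *: M r + (y%:C%C)%:M).
have [B B0 fB] : uniform_lip f.
  apply: uniform_lip_det => i j.
  have [B B0 h] : uniform_lip (fun r y => (1 + (- 1) * y%:C%C) * M r i j + y%:C%C *+ (i == j)).
    apply: uniform_lipD.
      apply: uniform_lipM => //; apply: uniform_lipD; first exact: uniform_lip_cst.
      by apply: uniform_lipM; [exact: uniform_lip_cst|exact: uniform_lip_y].
    case: (i == j); first exact: uniform_lip_y.
    exact: uniform_lip_cst.
  exists B => // r r' y *; rewrite !mxE rmorphB rmorph1 -mulN1r; exact: (h r r' y).
have fE r s y : char_poly (M r) = \prod_(z <- s) ('X - z%:P) ->
    f r y = \prod_(z <- s) to1 y z.
  by move=> sE; rewrite /f (det_linear_pencil _ _ sE).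
have dsE r s : 0 <= r <= 1 -> char_poly (M r) = \prod_(z <- s) ('X - z%:P) ->
    \prod_(z <- s) z = d.
  move=> r01 sE; rewrite -(dE r r01).
  have -> : M r = 1 *: M r + 0%:M by rewrite scale1r raddf0 addr0.
  by rewrite (det_linear_pencil _ _ sE); apply: eq_bigr => z _; rewrite mul1r addr0.
pose m := 2^-1 ^+ n * Num.min 1 (normc d).
have m0 : 0 < m by rewrite mulr_gt0 ?exprn_gt0 ?invr_gt0// lt_min ltr01 normc_gt0.
have step r r' s t : 0 <= r <= 1 -> 0 <= r' <= 1 -> B * `|r - r'| < m ->
    char_poly (M r) = \prod_(z <- s) ('X - z%:P) ->
    char_poly (M r') = \prod_(z <- t) ('X - z%:P) ->
    \sum_(z <- s) carg z = \sum_(z <- t) carg z.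
  move=> r01 r01' rr' sE tE; apply: argsum_eq.
  - exact: Mh sE.
  - exact: Mh tE.
  - move=> y y01; rewrite -(fE _ _ _ sE) -(fE _ _ _ tE); apply: RePr_gt0.
    rewrite (le_lt_trans (fB r r' y r01 r01' y01).2)// (lt_le_trans rr')//.
    rewrite (fE _ _ _ tE) /m -(dsE _ _ r01' tE).
    have <- : size t = n.
      by have := size_char_poly (M r'); rewrite tE size_prod_XsubC => -[].
    by apply: normc_prod_to1_ge => //; exact: Mh tE.
  - by rewrite (dsE _ _ r01 sE) (dsE _ _ r01' tE).
have rootsE r : exists s, char_poly (M r) = \prod_(z <- s) ('X - z%:P).
  have [s sE] := closed_field_poly_normal (char_poly (M r)).
  by exists s; rewrite {1}sE (monicP (char_poly_monic _)) scale1r.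
move=> s t sE tE.
pose k := (Num.truncn (B / m)).+1.
have k0 : 0 < k%:R :> R by rewrite ltr0n.
have kB : B / k%:R < m.
  have := truncnS_gt (B / m).
  by rewrite -/k ltr_pdivrMr// ltr_pdivrMr// mulrC.
have chain j : (j <= k)%N -> forall l,
    char_poly (M (j%:R / k%:R)) = \prod_(z <- l) ('X - z%:P) ->
    \sum_(z <- s) carg z = \sum_(z <- l) carg z.
  elim: j => [_ l|j IH jk l lE].
    rewrite mul0r => lE; apply: (step 0 0) => //; rewrite ?lexx ?ler01//.
    by rewrite subrr normr0 mulr0.
  have [l' l'E] := rootsE (j%:R / k%:R).
  rewrite (IH (ltnW jk) l' l'E); apply: (step (j%:R / k%:R) (j.+1%:R / k%:R)) => //.
  - by rewrite divr_ge0//= ler_pdivrMr// mul1r ler_nat ltnW.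
  - by rewrite divr_ge0//= ler_pdivrMr// mul1r ler_nat.
  - rewrite -mulrBl -opprB -natrB// subSnn mulN1r normrN normfV gtr0_norm//.
apply: (chain k (leqnn k)).
by rewrite divff// gt_eqF.
Qed.

End ArgumentHomotopy.

(** * Unitary diagonalization and the Schur complement formula *)

Section Spectral.
Variable R : realType.

Definition cmx m n (A : 'M[R]_(m, n)) : 'M[R[i]]_(m, n) := map_mx (real_complex R) A.

Definition adj m n (U : 'M[R[i]]_(m, n)) : 'M[R[i]]_(n, m) := map_mx (@conjc R) U^T.

Lemma adj_cmx m n (A : 'M[R]_(m, n)) : adj (cmx A) = cmx A^T.
Proof. by apply/matrixP => i j; rewrite !mxE /= oppr0. Qed.

Lemma adjM m n p (A : 'M[R[i]]_(m, n)) (B : 'M[R[i]]_(n, p)) :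
  adj (A *m B) = adj B *m adj A.
Proof. by rewrite /adj trmx_mul map_mxM. Qed.

Lemma adjK m n (A : 'M[R[i]]_(m, n)) : adj (adj A) = A.
Proof. by apply/matrixP => i j; rewrite !mxE conjcK. Qed.

(** Comes from the spectral theorem for Hermitian matrices, so [U] is complex although [B] and its
    eigenvalues are real. *)
Lemma sym_spectral n (B : 'M[R]_n) : B^T = B ->
  exists (U : 'M[R[i]]_n) (s : 'rV[R]_n),
    [/\ U *m adj U = 1%:M, adj U *m U = 1%:M &
        cmx B = adj U *m diag_mx (cmx s) *m U].
Proof.
move=> Bs.
have Bh : cmx B \is hermsymmx.
  apply/is_hermitianmxP; rewrite expr0 scale1r; apply/matrixP => i j.
  by rewrite !mxE -[in LHS]Bs !mxE /=; congr Complex; rewrite oppr0.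
have /orthomx_spectralP BE := hermitian_normalmx Bh.
have Uu := spectral_unitarymx (cmx B).
have sR := hermitian_spectral_diag_real Bh.
move: (spectralmx _) (spectral_diag _) BE Uu sR => U d BE Uu sR.
have UE : U *m adj U = 1%:M by apply/eqP; move: Uu; rewrite qualifE.
have UE' := mulmx1C UE.
have iU : invmx U = adj U.
  by rewrite -[LHS]mulmx1 -UE mulmxA mulVmx ?mul1mx// (unitarymx_unit Uu).
rewrite iU in BE.
exists U, (\row_j complex.Re (d 0 j)); split; [exact: UE|exact: UE'|].
rewrite BE; congr (_ *m diag_mx _ *m _).
apply/rowP => j; rewrite !mxE; have /mxOverP/(_ 0 j) := sR.
by case: (d 0 j) => a b; rewrite complex_real => /eqP ->.
Qed.

Lemma char_poly_diagonalized n (V U : 'M[R[i]]_n) (d : 'rV[R[i]]_n) :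
  V *m U = 1%:M ->
  char_poly (V *m diag_mx d *m U) = \prod_i ('X - (d 0 i)%:P).
Proof.
move=> VU; rewrite /char_poly.
have -> : char_poly_mx (V *m diag_mx d *m U) =
    map_mx polyC V *m char_poly_mx (diag_mx d) *m map_mx polyC U.
  rewrite /char_poly_mx mulmxBr mulmxBl -!map_mxM/=; congr (_ - _).
  by rewrite mul_mx_scalar -scalemxAl -map_mxM/= VU map_mx1 scalemx1.
rewrite !det_mulmx mulrAC -det_mulmx -map_mxM/= VU map_mx1 det1 mul1r.
rewrite -/(char_poly _) char_poly_trig; last exact: diag_mx_is_trig.
by apply: eq_bigr => i _; rewrite !mxE eqxx mulr1n.
Qed.

Lemma theta_SL_spectrum n (B : 'M[R]_n) (V U : 'M[R[i]]_n) (s : 'rV[R]_n) :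
  V *m U = 1%:M -> cmx B = V *m diag_mx (cmx s) *m U ->
  theta_SL B = \sum_i atan (s 0 i).
Proof.
move=> VU BE; rewrite /theta_SL.
rewrite (@sum_spectrum _ _ _ _ (map (s 0) (enum 'I_n))); last first.
  apply: (@map_poly_inj _ _ (real_complex R)).
  rewrite map_char_poly -/(cmx B) BE char_poly_diagonalized// big_map.
  rewrite rmorph_prod/= big_enum/=; apply: eq_bigr => i _.
  by rewrite rmorphB/= map_polyX map_polyC !mxE.
by rewrite big_map big_enum.
Qed.

(** The general symmetric matrix with corner [a != 0], when [S], its Schur complement, is symmetric.
    The sign of [p] is such that the Hessian of [phi + (a / 2) (t - tau)^2] has [p = grad tau]. *)
Definition sheared n (a : R) (p : 'rV[R]_n) (S : 'M[R]_n) : 'M[R]_(1 + n) :=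
  block_mx a%:M (- a *: p) (- a *: p^T) (S + a *: (p^T *m p)).

Lemma degI_plus_iAE n (A : 'M[R]_(1 + n)) :
  degI_plus_iA A = cmx (degI R n) + Complex 0 1 *: cmx A.
Proof. by apply/matrixP => i j; rewrite !mxE; simpc. Qed.

Lemma char_poly_plus_i n (S : 'M[R]_n) (V U : 'M[R[i]]_n) (s : 'rV[R]_n) :
  V *m U = 1%:M -> cmx S = V *m diag_mx (cmx s) *m U ->
  1%:M + Complex 0 1 *: cmx S =
  V *m diag_mx (\row_i Complex 1 (s 0 i)) *m U.
Proof.
move=> VU ->.
have -> : \row_i Complex 1 (s 0 i) = const_mx 1 + Complex 0 1 *: cmx s.
  by apply/rowP => i; rewrite !mxE; simpc.
rewrite raddfD/= diag_const_mx mulmxDr mulmxDl mulmx1 VU; congr (_ + _).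
by rewrite linearZ/= -scalemxAr -scalemxAl.
Qed.

(** The shear fixes [degI], whose corner is 0, so it block-diagonalizes real and imaginary parts at
    once. The outer factors are transposes of each other, not inverses. *)
Lemma block_plus_i n (a : R) (p : 'rV[R]_n) (S : 'M[R]_n) :
  degI_plus_iA (sheared a p S) =
  block_mx 1%:M 0 (- cmx p^T) 1%:M
  *m block_mx (Complex 0 a)%:M 0 0 (1%:M + Complex 0 1 *: cmx S)
  *m block_mx 1%:M (- cmx p) 0 1%:M.
Proof.
rewrite degI_plus_iAE /cmx /degI /sheared !map_block_mx !mulmx_block.
rewrite !(mul1mx, mulmx1, mul0mx, mulmx0, addr0, add0r).
rewrite !map_mx0 map_mx1 scale_block_mx add_block_mx !add0r.
rewrite !map_mxD !map_mxZ !map_mxM/=.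
have ia : Complex 0 1 * a%:C%C = Complex 0 a :> R[i] by simpc.
congr block_mx.
- by rewrite map_scalar_mx/= scale_scalar_mx ia.
- by rewrite rmorphN scaleNr scalerN scalerA ia mulmxN mul_scalar_mx.
- by rewrite rmorphN scaleNr scalerN scalerA ia mulNmx mul_mx_scalar.
- rewrite scalerDr scalerA ia addrA addrC; congr (_ + _).
  by rewrite mulNmx mulmxN mulNmx opprK mul_mx_scalar -scalemxAl.
Qed.

Lemma det_sheared_plus_i n (a : R) (p : 'rV[R]_n) (S : 'M[R]_n) :
  \det (degI_plus_iA (sheared a p S)) =
  Complex 0 a * \det (1%:M + Complex 0 1 *: cmx S).
Proof.
rewrite block_plus_i !det_mulmx det_lblock det_ublock det_ublock !det1 !mul1r mulr1.
by rewrite det_scalar1.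
Qed.

(** Pairing an eigenvector [v] with itself writes [z |v|^2] as a nonnegative number, from the
    projection [degI], plus an imaginary one, from [i A]. The determinant excludes [z = 0]. *)
Lemma rhalf_degI_plus_iA n (A : 'M[R]_(1 + n)) (s : seq R[i]) :
  A^T = A -> \det (degI_plus_iA A) != 0 ->
  char_poly (degI_plus_iA A) = \prod_(z <- s) ('X - z%:P) -> all rhalf s.
Proof.
move=> As d0 sE; set M := degI_plus_iA A in d0 sE *.
apply/allP => z zs; apply/andP; split; last first.
  apply: contra d0 => /eqP z0; rewrite z0 in zs.
  have -> : M = 1 *: M + 0%:M by rewrite scale1r raddf0 addr0.
  rewrite (det_linear_pencil _ _ sE) prodf_seq_eq0; apply/hasP; exists 0 => //=.
  by rewrite mulr0 addr0.
have : eigenvalue M z by rewrite eigenvalue_root_char sE root_prod_XsubC.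
move=> /eigenvalueP[v vM v0].
have D00 (X Y : 'M[R[i]]_1) : (X + Y) 0 0 = X 0 0 + Y 0 0 by rewrite mxE.
have Z00 c (X : 'M[R[i]]_1) : (c *: X) 0 0 = c * X 0 0 by rewrite mxE.
have E : z * (v *m adj v) 0 0 = ((v *m cmx (degI R n)) *m adj (v *m cmx (degI R n))) 0 0
    + Complex 0 1 * (v *m cmx A *m adj v) 0 0.
  have dE : cmx (degI R n) *m adj (cmx (degI R n)) = cmx (degI R n).
    have -> : adj (cmx (degI R n)) = cmx (degI R n).
      by rewrite adj_cmx /degI (@tr_block_mx _ 1 n 1 n) !trmx0 trmx1.
    rewrite /cmx -map_mxM/= /degI mulmx_block.
    by rewrite !(mul1mx, mulmx1, mul0mx, mulmx0, addr0, add0r).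
  rewrite adjM mulmxA -(mulmxA v) dE -Z00 scalemxAl -vM /M degI_plus_iAE.
  by rewrite mulmxDr mulmxDl -scalemxAr -scalemxAl D00 Z00.
have pos m (w : 'rV[R[i]]_m) : 0 <= (w *m adj w) 0 0.
  by rewrite mxE; apply: sumr_ge0 => k _; rewrite !mxE mulcJ_ge0.
have real : complex.Im ((v *m cmx A *m adj v) 0 0) = 0.
  set h := (_ *m _ *m _) 0 0.
  have : (h^*)%C = h.
    have -> : (h^*)%C = adj (v *m cmx A *m adj v) 0 0.
      by rewrite /adj [RHS]mxE; congr conjc; rewrite [RHS]mxE.
    by rewrite /h !adjM adjK adj_cmx As mulmxA.
  by case: h => a b [] /=; lra.
have v2 : 0 < (v *m adj v) 0 0.
  rewrite lt_def pos andbT; apply: contra v0 => /eqP; rewrite mxE => /eqP.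
  rewrite psumr_eq0; last by move=> k _; rewrite !mxE mulcJ_ge0.
  move=> /allP h; apply/eqP/rowP => k; apply/eqP; move: (h k (mem_index_enum _)).
  by rewrite !mxE/= mulf_eq0 conjc_eq0 orbb.
move: E v2 (pos _ (v *m cmx (degI R n))) real.
move: ((v *m adj v) 0 0) ((v *m cmx A *m adj v) 0 0) ((_ *m adj (_ *m _)) 0 0).
move=> [n1 n2] [h1 h2] [p1 p2]; case: (z) => a b.
rewrite !lecE !ltcE/=; simpc => -[e1 e2] /andP[/eqP n20 n10] /andP[/eqP p20 p10] h20.
move: e1; rewrite n20 h20 mulr0 !subr0 => e1.
by rewrite -(pmulr_lge0 _ n10) e1.
Qed.

Lemma carg_imag (a : R) : a != 0 -> carg (Complex 0 a) = Num.sg a * (pi / 2).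
Proof.
move=> a0; rewrite /carg mul0r acos0.
case: (leP 0 a) => h; last by rewrite ltr0_sg// mulN1r.
by rewrite gtr0_sg ?mul1r// lt_def a0.
Qed.

Lemma carg_1i (a : R) : carg (Complex 1 a) = atan a.
Proof.
rewrite /carg expr1n div1r -cos_atan.
have := atan_gtNpi2 a; have := atan_ltpi2 a; have := @pi_gt0 R.
case: ifP => a0 p0 h1 h2.
  rewrite cosK// in_itv/= -[X in X <= _]atan0 le_atan//=; lra.
have : atan a <= atan 0 by rewrite le_atan// ltW// ltNge a0.
rewrite atan0 => h3; rewrite cosKN ?opprK// h3 andbT; lra.
Qed.

Lemma uniform_lip_sheared n (a : R) (p : 'rV[R]_n) (S : 'M[R]_n) i j :
  uniform_lip (fun r _ => degI_plus_iA (sheared a ((1 - r) *: p) S) i j).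
Proof.
have lin (c : R[i]) : uniform_lip (fun r _ => c * (1 + (- 1) * r%:C%C)).
  apply: uniform_lipM; first exact: uniform_lip_cst.
  apply: uniform_lipD; first exact: uniform_lip_cst.
  by apply: uniform_lipM; [exact: uniform_lip_cst|exact: uniform_lip_r].
have eqlip (f g : R -> R -> R[i]) : (forall r y, f r y = g r y) ->
    uniform_lip f -> uniform_lip g.
  by move=> fg [B B0 h]; exists B => // r r' y; rewrite -!fg; exact: h.
rewrite -(splitK i) -(splitK j); case: (fintype.split i) => i';
  case: (fintype.split j) => j'.
- apply: eqlip (uniform_lip_cst (Complex 0 a)) => r y.
  by rewrite /= degI_plus_iAE /degI /sheared !(block_mxEul, mxE) !ord1 eqxx; simpc.
- apply: eqlip (lin (Complex 0 (- a * p 0 j'))) => r y.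
  rewrite /= degI_plus_iAE /degI /sheared !(block_mxEur, mxE) !ord1; simpc.
  by congr Complex; ring.
- apply: eqlip (lin (Complex 0 (- a * p 0 i'))) => r y.
  rewrite /= degI_plus_iAE /degI /sheared !(block_mxEdl, mxE) !ord1; simpc.
  by congr Complex; ring.
- apply: (@eqlip (fun r y => Complex (i' == j')%:R (S i' j') +
    Complex 0 (a * (p 0 i' * p 0 j')) * (1 + (- 1) * r%:C%C) * (1 * (1 + (- 1) * r%:C%C)))) => [r y|].
    rewrite /= degI_plus_iAE /degI /sheared !(block_mxEdr, mxE) big_ord1 !mxE; simpc.
    by congr Complex; ring.
  by apply: uniform_lipD; [exact: uniform_lip_cst|apply: uniform_lipM; exact: lin].
Qed.

(* Shearing away [p] does not change the determinant, so by homotopy it does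
   not change the sum of the arguments either. *)
Lemma Theta_sheared n (a : R) (p : 'rV[R]_n) (S : 'M[R]_n) :
  a != 0 -> S^T = S ->
  Theta_DSL (sheared a p S) = Num.sg a * (pi / 2) + theta_SL S.
Proof.
move=> a0 Ss; have [U [s [UV VU SE]]] := sym_spectral Ss.
have ES := char_poly_plus_i VU SE.
have dS : \det (1%:M + Complex 0 1 *: cmx S) != 0.
  rewrite ES !det_mulmx mulrAC -det_mulmx VU det1 mul1r det_diag.
  apply/prodf_neq0 => i _; rewrite mxE; apply/eqP => -[] /eqP.
  by rewrite oner_eq0.
have d0 q : \det (degI_plus_iA (sheared a q S)) != 0.
  rewrite det_sheared_plus_i mulf_neq0//; apply/eqP => -[] /eqP.
  by rewrite (negbTE a0).
have sym q : (sheared a q S)^T = sheared a q S.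
  rewrite /sheared tr_block_mx tr_scalar_mx !linearZ/= trmxK; congr block_mx.
  by rewrite linearD/= linearZ/= trmx_mul trmxK Ss.
rewrite /Theta_DSL memNset; last by case=> _ /eqP; rewrite (negbTE (d0 p)).
have [l lE] := closed_field_poly_normal (char_poly (degI_plus_iA (sheared a p S))).
rewrite (monicP (char_poly_monic _)) scale1r in lE.
rewrite (sum_spectrum _ lE).
(* The spectrum at the end of the homotopy, where the matrix is block diagonal: [i a] has argument
   [pi / 2] up to sign, and [1 + i s] has argument [atan s]. *)
pose t := Complex 0 a :: [seq Complex 1 (s 0 i) | i <- enum 'I_n].
have tE : char_poly (degI_plus_iA (sheared a 0 S)) = \prod_(z <- t) ('X - z%:P).
  rewrite block_plus_i trmx0 /cmx !map_mx0 !oppr0 -/(cmx S) -!scalar_mx_block mul1mx mulmx1.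
  have -> : block_mx (Complex 0 a)%:M 0 0 (1%:M + Complex 0 1 *: cmx S) =
      block_mx 1%:M 0 0 (adj U) *m diag_mx (row_mx (Complex 0 a)%:M (\row_i Complex 1 (s 0 i)))
      *m block_mx 1%:M 0 0 U.
    rewrite diag_mx_row !mulmx_block !(mul1mx, mulmx1, mul0mx, mulmx0, addr0, add0r) -ES.
    by congr block_mx; apply/matrixP => i j; rewrite !mxE !ord1 eqxx.
  rewrite char_poly_diagonalized; last first.
    rewrite mulmx_block !(mul1mx, mulmx1, mul0mx, mulmx0, addr0, add0r) VU.
    by rewrite -scalar_mx_block.
  rewrite big_split_ord/= big_ord1 row_mxEl mxE eqxx /t big_cons; congr (_ * _).
  by rewrite big_map big_enum/=; apply: eq_bigr => i _; rewrite row_mxEr mxE.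
rewrite (@argsum_homotopy _ _ (fun r => degI_plus_iA (sheared a ((1 - r) *: p) S))
  (\det (degI_plus_iA (sheared a p S))) _ _ _ _ l t).
- rewrite /t big_cons carg_imag// big_map big_enum/= (theta_SL_spectrum VU SE).
  by congr (_ + _); apply: eq_bigr => i _; exact: carg_1i.
- exact: uniform_lip_sheared.
- exact: d0.
- by move=> r _; rewrite !det_sheared_plus_i.
- by move=> r u _ uE; apply: rhalf_degI_plus_iA uE.
- by rewrite subr0 scale1r.
- by rewrite subrr scale0r.
Qed.

End Spectral.

(** * Supporting trace forms of the special Lagrangian subequation *)

Section Separation.
Variable R : realType.

(** [atan] is concave only on the nonnegative axis, and its tangent at a point [x < 0] may fail to
    lie above it. The Lipschitz constant 1 replaces the derivative there, which is enough against
    points [s >= 0]. *)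
Definition slope (x : R) : R := if 0 <= x then (1 + x ^+ 2)^-1 else 1.

Lemma slope_gt0 x : 0 < slope x.
Proof. by rewrite /slope; case: ifP => // _; rewrite invr_gt0 ltr_wpDr ?sqr_ge0. Qed.

Lemma atan_tangent (s m : R) : 0 <= s -> atan s - atan m <= slope m * (s - m).
Proof.
move=> s0; pose df (x : R) := (1 + x ^+ 2)^-1.
have mvt (a b : R) : a < b ->
    exists2 x, a < x < b & atan b - atan a = df x * (b - a).
  move=> ab; have dE x : x \in `]a, b[ -> is_derive x 1 (@atan R) (df x).
    by move=> _; exact: is_derive1_atan.
  have [|x xab xE] := MVT ab dE.
    by apply: continuous_subspaceT => x; exact: continuous_atan.
  by exists x => //; move: xab; rewrite in_itv.
have dfle (x y : R) : 0 <= x -> x <= y -> df y <= df x.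
  move=> x0 xy; rewrite lef_pV2 ?posrE ?ltr_wpDr ?sqr_ge0// lerD2l.
  by rewrite ler_pXn2r// nnegrE// (le_trans x0).
rewrite /slope; case: (leP 0 m) => m0.
  have [sm|ms|->] := ltgtP s m; last by rewrite !subrr mulr0.
    have [x /andP[sx xm] xE] := mvt _ _ sm.
    rewrite -lerN2 -mulrN !opprB xE ler_wpM2r ?subr_ge0 ?(ltW sm)//.
    by rewrite dfle ?(ltW xm)// (le_trans s0) ?ltW.
  have [x /andP[mx xs] ->] := mvt _ _ ms.
  by rewrite ler_wpM2r ?subr_ge0 ?(ltW ms)// dfle ?(ltW mx).
have ms : m < s by exact: lt_le_trans m0 s0.
have [x _ ->] := mvt _ _ ms.
rewrite ler_wpM2r ?subr_ge0 ?(ltW ms)// invf_le1 ?ltr_wpDr ?sqr_ge0//.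
by rewrite lerDl sqr_ge0.
Qed.

(* The second order operator [sum_k D_(g_k)^2], for [g_k] the rows of [G],
   as a linear form on Hessians. *)
Definition trform m n (G : 'M[R]_(m, n)) (B : 'M[R]_n) : R := \tr (G *m B *m G^T).

(** One negative summand would leave the total below [(n - 1) pi / 2], which bounds the sum of the
    others. *)
Lemma spectrum_ge0 n (s : 'I_n -> R) :
  n%:R * pi / 2 - pi / 2 <= \sum_i atan (s i) -> forall i, 0 <= s i.
Proof.
move=> h i; rewrite leNgt; apply/negP => si; move: h; apply/negP; rewrite -ltNge.
rewrite (bigD1 i)//=.
have h1 : atan (s i) < 0 by rewrite -[X in _ < X]atan0 lt_atan.
have h2 : \sum_(j | j != i) atan (s j) <= \sum_(j | j != i) (pi / 2).
  by apply: ler_sum => j _; apply: ltW; exact: atan_ltpi2.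
have h3 : \sum_(j < n | j != i) (pi / 2 : R) = n%:R * pi / 2 - pi / 2.
  have : \sum_(j < n) (pi / 2 : R) = n%:R * pi / 2.
    by rewrite sumr_const card_ord -[LHS]mulr_natl mulrA.
  by rewrite (bigD1 i)//= => <-; ring.
by rewrite h3 in h2; rewrite -[ltRHS]add0r ltr_leD.
Qed.

Definition Remx m n (U : 'M[R[i]]_(m, n)) : 'M[R]_(m, n) := map_mx (@complex.Re R) U.
Definition Immx m n (U : 'M[R[i]]_(m, n)) : 'M[R]_(m, n) := map_mx (@complex.Im R) U.

Lemma Re_conj_form m n (U : 'M[R[i]]_(m, n)) (B : 'M[R]_n) i :
  complex.Re ((U *m cmx B *m adj U) i i) =
  (Remx U *m B *m (Remx U)^T) i i + (Immx U *m B *m (Immx U)^T) i i.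
Proof.
have Re_sum (I : finType) (F : I -> R[i]) :
    complex.Re (\sum_k F k) = \sum_k complex.Re (F k).
  by elim/big_rec2: _ => // k x y _ <-; case: (F k) => ? ?; case: (y).
have Im_sum (I : finType) (F : I -> R[i]) :
    complex.Im (\sum_k F k) = \sum_k complex.Im (F k).
  by elim/big_rec2: _ => // k x y _ <-; case: (F k) => ? ?; case: (y).
rewrite !mxE Re_sum -big_split/=; apply: eq_bigr => k _; rewrite !mxE.
have mulE (x y : R[i]) : complex.Re (x * (y^*)%C) =
    complex.Re x * complex.Re y + complex.Im x * complex.Im y.
  by case: x => x1 x2; case: y => y1 y2; simpc.
rewrite mulE Re_sum Im_sum; congr (_ * _ + _ * _); apply: eq_bigr => j _;
  by rewrite !mxE; case: (U i j) => x y; simpc.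
Qed.

(** A complex row acts on a real matrix as its real and imaginary parts together, hence [n + n] real
    rows. The weights enter through square roots because [trform] is quadratic in [G]. *)
Definition weighted_rows n (U : 'M[R[i]]_n) (l : 'rV[R]_n) : 'M[R]_(n + n, n) :=
  let d := diag_mx (\row_i Num.sqrt (l 0 i)) in
  col_mx (d *m Remx U) (d *m Immx U).

Lemma trform_weighted n (U : 'M[R[i]]_n) (l : 'rV[R]_n) (B : 'M[R]_n) :
  (forall i, 0 <= l 0 i) ->
  trform (weighted_rows U l) B =
  \sum_i l 0 i * complex.Re ((U *m cmx B *m adj U) i i).
Proof.
move=> l0; rewrite /trform /weighted_rows.
rewrite mul_col_mx tr_col_mx mul_col_row mxtrace_block.
set d := diag_mx _.
have trE (X : 'M[R]_n) : \tr (d *m X *m B *m (d *m X)^T) =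
    \sum_i l 0 i * (X *m B *m X^T) i i.
  rewrite trmx_mul tr_diag_mx; apply: eq_bigr => i _.
  have -> : d *m X *m B *m (X^T *m d) = d *m (X *m B *m X^T) *m d by rewrite !mulmxA.
  move: (X *m B *m X^T) => Y; rewrite mul_mx_diag mul_diag_mx !mxE.
  by rewrite mulrAC -expr2 sqr_sqrtr.
rewrite !trE -big_split/=; apply: eq_bigr => i _.
by rewrite -mulrDr Re_conj_form.
Qed.

(* [theta_SL] is concave on nonnegative matrices, and
   [c >= (n - 1) pi / 2] forces nonnegativity. *)
Lemma separation n (B1 : 'M[R]_n) (c : R) :
  (0 < n)%N -> n%:R * pi / 2 - pi / 2 <= c -> B1^T = B1 -> theta_SL B1 < c ->
  exists (G : 'M[R]_(n + n, n)) (k : R),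
    [/\ 0 < trform G 1%:M, trform G B1 < k &
        forall B, SL_subeq c B -> k <= trform G B].
Proof.
move=> n0 cn B1s B1c; have [U [m [UV VU BE]]] := sym_spectral B1s.
(* Weighting the eigendirections of [B1] by these slopes gives [theta B - theta B1 <= trform G B -
   trform G B1] for nonnegative [B], which dictates the value of [k]. *)
pose l : 'rV[R]_n := \row_i slope (m 0 i).
have l0 i : 0 < l 0 i by rewrite mxE slope_gt0.
have l0' i : 0 <= l 0 i by exact: ltW.
pose G := weighted_rows U l.
have GE := trform_weighted U _ l0'.
exists G, (c - theta_SL B1 + trform G B1); split.
- rewrite GE (eq_bigr (fun i => l 0 i)) => [|i _].
    by rewrite (bigD1 (Ordinal n0))//= ltr_wpDr ?sumr_ge0.
  by rewrite /cmx map_mx1 mulmx1 UV [X in complex.Re X]mxE eqxx mulr1.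
- by rewrite -subr_gt0 addrK subr_gt0.
move=> B [Bs Bc]; have [V [s [VV' V'V sE]]] := sym_spectral Bs.
have s0 : forall i, 0 <= s 0 i.
  apply: spectrum_ge0; rewrite (le_trans cn)//.
  by rewrite -(theta_SL_spectrum V'V sE).
have [W defW] : exists W, W = U *m adj V by exists (U *m adj V).
have WW : W *m adj W = 1%:M.
  by rewrite defW adjM adjK mulmxA -(mulmxA U) V'V mulmx1 UV.
have WW' : adj W *m W = 1%:M by exact: mulmx1C.
(* [w] is doubly stochastic because [W] is unitary, and the diagonal of [B] in the eigenbasis of
   [B1] consists of [w]-averages of the eigenvalues of [B]. The scalar bound [atan_tangent] can then
   be summed against [w]. *)
pose w i k := complex.Re (W i k * (W i k)^*%C).
have wE i k : W i k * (W i k)^*%C = (w i k)%:C%C.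
  by rewrite /w; case: (W i k) => a b; simpc; congr Complex => /=; ring.
have w0 i k : 0 <= w i k by rewrite -lecR -wE mulcJ_ge0.
have wr i : \sum_k w i k = 1.
  apply: complexI; rewrite rmorph_sum/=; have /matrixP/(_ i i) := WW.
  rewrite !mxE eqxx => WE; apply: etrans WE.
  by apply: eq_bigr => k _; rewrite -wE !mxE.
have wc k : \sum_i w i k = 1.
  apply: complexI; rewrite rmorph_sum/=; have /matrixP/(_ k k) := WW'.
  rewrite !mxE eqxx => WE; apply: etrans WE.
  by apply: eq_bigr => i _; rewrite -wE !mxE mulrC.
have diagE i : complex.Re ((U *m cmx B *m adj U) i i) = \sum_k w i k * s 0 k.
  have -> : U *m cmx B *m adj U = W *m diag_mx (cmx s) *m adj W.
    by rewrite sE defW adjM adjK !mulmxA.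
  have -> : (W *m diag_mx (cmx s) *m adj W) i i = (\sum_k w i k * s 0 k)%:C%C.
    rewrite mxE rmorph_sum/=; apply: eq_bigr => k _.
    by rewrite mul_mx_diag !mxE rmorphM/= -wE mulrAC.
  by [].
have diag1 i : complex.Re ((U *m cmx B1 *m adj U) i i) = m 0 i.
  by rewrite BE !mulmxA UV mul1mx -mulmxA UV mulmx1 !mxE eqxx mulr1n.
rewrite !GE -lerBrDr -sumrB.
rewrite (theta_SL_spectrum VU BE).
rewrite (@le_trans _ _ (\sum_k atan (s 0 k) - \sum_i atan (m 0 i)))//.
  by rewrite lerD2r -(theta_SL_spectrum V'V sE).
have -> : \sum_k atan (s 0 k) = \sum_i \sum_k w i k * atan (s 0 k).
  by rewrite exchange_big/=; apply: eq_bigr => k _; rewrite -mulr_suml wc mul1r.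
rewrite -sumrB; apply: ler_sum => i _; rewrite diagE diag1 -mulrBr.
have -> : atan (m 0 i) = \sum_k w i k * atan (m 0 i) by rewrite -mulr_suml wr mul1r.
have -> : m 0 i = \sum_k w i k * m 0 i by rewrite -mulr_suml wr mul1r.
rewrite -!sumrB mulr_sumr; apply: ler_sum => k _.
rewrite -!mulrBr mulrCA ler_wpM2l// mxE.
have <- : m 0 i = \sum_k w i k * m 0 i by rewrite -mulr_suml wr mul1r.
exact: atan_tangent.
Qed.

End Separation.

(** * Polynomial functions and harmonic extension *)

Section PolynomialFunctions.
Variable R : realType.

Section Calculus.
Variable n : nat.
Implicit Types (f g : 'rV[R]_n -> R) (x v : 'rV[R]_n).

Lemma derive_coord v x i : 'D_v (fun y : 'rV[R]_n => y 0 i : R) x = v 0 i.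
Proof.
rewrite deriveE; last exact: differentiable_coord.
have @f : {linear 'rV[R]_n -> R}.
  by exists (fun N : 'rV[R]_n => N 0 i); do 2![eexists]; do ?[constructor];
     rewrite ?mxE// => ? *; rewrite ?mxE//; move=> ?; rewrite !mxE.
by rewrite (_ : (fun _ => _) = f)// diff_lin//; exact: coord_continuous.
Qed.

Lemma derive_add f g v x : differentiable f x -> differentiable g x ->
  'D_v (fun y => f y + g y) x = 'D_v f x + 'D_v g x.
Proof. by move=> df dg; apply: deriveD; apply: diff_derivable. Qed.

Lemma derive_mul f g v x : differentiable f x -> differentiable g x ->
  'D_v (fun y => f y * g y) x = f x * 'D_v g x + g x * 'D_v f x.
Proof. by move=> df dg; apply: deriveM; apply: diff_derivable. Qed.

Lemma differentiable_add f g x : differentiable f x -> differentiable g x ->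
  differentiable (fun y => f y + g y) x.
Proof. exact: differentiableD. Qed.

Lemma differentiable_mul f g x : differentiable f x -> differentiable g x ->
  differentiable (fun y => f y * g y) x.
Proof. exact: differentiableM. Qed.

Lemma differentiable_fsum (I : finType) (F : I -> 'rV[R]_n -> R) x :
  (forall i, differentiable (F i) x) -> differentiable (fun y => \sum_i F i y) x.
Proof.
move=> dF; elim: index_enum => [|i l IH].
  by under eq_fun do rewrite big_nil; exact: differentiable_cst.
by under eq_fun do rewrite big_cons; exact: differentiable_add.
Qed.

Lemma derive_fsum (I : finType) (F : I -> 'rV[R]_n -> R) v x :
  (forall i, differentiable (F i) x) ->
  'D_v (fun y => \sum_i F i y) x = \sum_i 'D_v (F i) x.
Proof.
move=> dF.
suff [] : differentiable (fun y => \sum_i F i y) x /\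
  'D_v (fun y => \sum_i F i y) x = \sum_i 'D_v (F i) x by [].
elim: index_enum => [|i l [IH1 IH2]].
  split; first by under eq_fun do rewrite big_nil; exact: differentiable_cst.
  under eq_fun do rewrite big_nil.
  by rewrite big_nil; exact: derive_cst.
split; first by under eq_fun do rewrite big_cons; exact: differentiable_add.
under eq_fun do rewrite big_cons.
by rewrite big_cons derive_add// IH2.
Qed.

Lemma derive_sum_partial f v x : differentiable f x ->
  'D_v f x = \sum_i v 0 i * partial i f x.
Proof.
move=> df; rewrite deriveE// [in LHS](row_sum_delta v) linear_sum/=.
by apply: eq_bigr => i _; rewrite linearZ/= /partial -deriveE.
Qed.

(** Polynomial functions of degree at most [k], in a Horner form that need not be unique. Products,
    derivatives and restrictions to lines all follow by induction on [k]. *)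
Fixpoint poly_le (k : nat) (f : 'rV[R]_n -> R) : Prop :=
  match k with
  | 0 => exists c, f = fun=> c
  | k'.+1 => exists c (g : 'I_n -> 'rV[R]_n -> R),
      (forall i, poly_le k' (g i)) /\ f = fun x => c + \sum_i x 0 i * g i x
  end.

Lemma poly_le_cst k c : poly_le k (fun=> c).
Proof.
elim: k c => [|k IH] c; first by exists c.
exists c, (fun _ _ => 0); split=> //; apply/funext => x.
by rewrite big1 ?addr0// => i _; rewrite mulr0.
Qed.

Lemma poly_leS k f : poly_le k f -> poly_le k.+1 f.
Proof.
elim: k f => [|k IH] f.
  by move=> [c ->]; exact: poly_le_cst.
move=> [c [g [gP ->]]]; exists c, g; split; last by [].
by move=> i; exact: IH (gP i).
Qed.

Lemma poly_leW k l f : (k <= l)%N -> poly_le k f -> poly_le l f.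
Proof.
move=> /subnKC <-; elim: (l - k)%N => [|j IH]; first by rewrite addn0.
by move=> h; rewrite addnS; apply: poly_leS; exact: IH.
Qed.

Lemma poly_le_add k f g : poly_le k f -> poly_le k g ->
  poly_le k (fun x => f x + g x).
Proof.
elim: k f g => [|k IH] f g.
  by move=> [c ->] [d ->]; exists (c + d).
move=> [c [F [FP ->]]] [d [G [GP ->]]].
exists (c + d), (fun i x => F i x + G i x); split=> [i|].
  exact: IH (FP i) (GP i).
apply/funext => x; rewrite addrACA -big_split/=; congr (_ + _).
by apply: eq_bigr => i _; rewrite mulrDr.
Qed.

Lemma poly_le_scale k a f : poly_le k f -> poly_le k (fun x => a * f x).
Proof.
elim: k f => [|k IH] f.
  by move=> [c ->]; exists (a * c).
move=> [c [F [FP ->]]].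
exists (a * c), (fun i x => a * F i x); split=> [i|]; first exact: IH (FP i).
apply/funext => x; rewrite mulrDr mulr_sumr; congr (_ + _).
by apply: eq_bigr => i _; rewrite mulrCA.
Qed.

Lemma poly_le_sum k (I : finType) (F : I -> 'rV[R]_n -> R) :
  (forall i, poly_le k (F i)) -> poly_le k (fun x => \sum_i F i x).
Proof.
move=> dF; elim: index_enum => [|i l IH].
  by under eq_fun do rewrite big_nil; exact: poly_le_cst.
by under eq_fun do rewrite big_cons; exact: (poly_le_add (dF i) IH).
Qed.

Lemma poly_le_coordM k i f : poly_le k f -> poly_le k.+1 (fun x => x 0 i * f x).
Proof.
move=> fP; exists 0, (fun j x => (j == i)%:R * f x); split=> [j|].
  exact: poly_le_scale.
apply/funext => x; rewrite add0r (bigD1 i)//= eqxx mul1r big1 ?addr0//.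
by move=> j /negbTE ->; rewrite mul0r mulr0.
Qed.

Lemma poly_le_coord i : poly_le 1 (fun x => x 0 i).
Proof.
have := @poly_le_coordM 0 i _ (poly_le_cst 0 1).
by under eq_fun do rewrite mulr1.
Qed.

Lemma poly_le_mul k l f g : poly_le k f -> poly_le l g ->
  poly_le (k + l) (fun x => f x * g x).
Proof.
move=> + gP; elim: k f => [|k IH] f.
  by move=> [c ->]; rewrite add0n; exact: poly_le_scale.
move=> [c [F [FP ->]]]; rewrite addSn.
have -> : (fun x => (c + \sum_i x 0 i * F i x) * g x) =
  (fun x => c * g x + \sum_i x 0 i * (F i x * g x)).
  apply/funext => x; rewrite mulrDl mulr_suml; congr (_ + _).
  by apply: eq_bigr => i _; rewrite mulrA.
apply: poly_le_add; first by apply/poly_le_scale/(poly_leW _ gP)/leqW/leq_addl.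
by apply: poly_le_sum => i; apply: poly_le_coordM; exact: IH (FP i).
Qed.

Lemma poly_le_differentiable k f x : poly_le k f -> differentiable f x.
Proof.
elim: k f => [|k IH] f.
  by move=> [c ->]; exact: differentiable_cst.
move=> [c [F [FP ->]]]; apply: differentiable_add; first exact: differentiable_cst.
apply: differentiable_fsum => i; apply: differentiable_mul; last exact: IH (FP i).
exact: differentiable_coord.
Qed.

Lemma derive_poly_le k f v : poly_le k.+1 f -> poly_le k ('D_v f).
Proof.
elim: k f => [|k IH] f [c [F [FP ->]]].
  have dF i x : differentiable (F i) x by exact: (@poly_le_differentiable 0 _ _ (FP i)).
  exists ('D_v (fun x => c + \sum_i x 0 i * F i x) 0); apply/funext => x.
  have E y : 'D_v (fun x => c + \sum_i x 0 i * F i x) y = \sum_i F i y * v 0 i.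
    rewrite derive_add; [|exact: differentiable_cst|]; last first.
      by apply: differentiable_fsum => i; apply: differentiable_mul => //;
        exact: differentiable_coord.
    rewrite (_ : 'D_v (fun=> c) y = 0) ?add0r; last exact: derive_cst.
    rewrite derive_fsum => [|i]; last first.
      by apply: differentiable_mul => //; exact: differentiable_coord.
    apply: eq_bigr => i _; rewrite derive_mul//; last exact: differentiable_coord.
    rewrite derive_coord; have [d ->] := FP i.
    by rewrite (_ : 'D_v (fun=> d) y = 0) ?mulr0 ?add0r//; exact: derive_cst.
  by rewrite !E; apply: eq_bigr => i _; have [d ->] := FP i.
have dF i x : differentiable (F i) x by exact: (@poly_le_differentiable k.+1 _ _ (FP i)).
have -> : 'D_v (fun x => c + \sum_i x 0 i * F i x) =
    fun x => \sum_i (x 0 i * 'D_v (F i) x + v 0 i * F i x).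
  apply/funext => x.
  rewrite derive_add; [|exact: differentiable_cst|]; last first.
    by apply: differentiable_fsum => i; apply: differentiable_mul => //;
      exact: differentiable_coord.
  rewrite (_ : 'D_v (fun=> c) x = 0) ?add0r; last exact: derive_cst.
  rewrite derive_fsum => [|i]; last first.
    by apply: differentiable_mul => //; exact: differentiable_coord.
  apply: eq_bigr => i _; rewrite derive_mul//; last exact: differentiable_coord.
  by rewrite derive_coord (mulrC (F i x)).
apply: poly_le_sum => i; apply: poly_le_add; last exact: poly_le_scale.
by apply: poly_le_coordM; exact: IH (FP i).
Qed.

Definition polyfun f := exists k, poly_le k f.

Lemma polyfun_add f g : polyfun f -> polyfun g -> polyfun (fun x => f x + g x).
Proof.
move=> [k fk] [l gl]; exists (maxn k l).
by apply: poly_le_add; [exact: poly_leW (leq_maxl _ _) fk|exact: poly_leW (leq_maxr _ _) gl].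
Qed.

Lemma polyfun_mul f g : polyfun f -> polyfun g -> polyfun (fun x => f x * g x).
Proof. by move=> [k fk] [l gl]; exists (k + l)%N; exact: poly_le_mul. Qed.

Lemma polyfun_cst c : polyfun (fun=> c).
Proof. by exists 0%N; exact: poly_le_cst. Qed.

Lemma polyfun_coord i : polyfun (fun x => x 0 i).
Proof. by exists 1%N; exact: poly_le_coord. Qed.

Lemma polyfun_opp f : polyfun f -> polyfun (fun x => - f x).
Proof.
move=> fP; have := polyfun_mul (polyfun_cst (- 1)) fP.
by under eq_fun do rewrite mulN1r.
Qed.

Lemma polyfun_sum (I : finType) (F : I -> 'rV[R]_n -> R) :
  (forall i, polyfun (F i)) -> polyfun (fun x => \sum_i F i x).
Proof.
move=> dF; elim: index_enum => [|i l IH].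
  by under eq_fun do rewrite big_nil; exact: polyfun_cst.
by under eq_fun do rewrite big_cons; exact: (polyfun_add (dF i) IH).
Qed.

Lemma polyfun_differentiable f x : polyfun f -> differentiable f x.
Proof. by case=> k; exact: poly_le_differentiable. Qed.

Lemma polyfun_derive f v : polyfun f -> polyfun ('D_v f).
Proof. by case=> k fk; exists k; apply/derive_poly_le/poly_leS. Qed.

Lemma polyfun_continuous f : polyfun f -> continuous f.
Proof. by move=> fP x; exact/differentiable_continuous/polyfun_differentiable. Qed.

Lemma polyfun_C2 f U : polyfun f -> C2_on U f.
Proof.
have C1 g : polyfun g -> C1_on U g.
  move=> gP x _; split; first exact: polyfun_continuous.
  move=> i; split; first exact/diff_derivable/polyfun_differentiable.
  exact/polyfun_continuous/polyfun_derive.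
by move=> fP; split=> [|i]; apply: C1 => //; exact: polyfun_derive.
Qed.

Lemma partial_cst c (i : 'I_n) : partial i (fun _ : 'rV[R]_n => c) = fun=> 0.
Proof. by apply/funext => x; exact: derive_cst. Qed.

Lemma partial_coord (i j : 'I_n) :
  partial i (fun x : 'rV[R]_n => x 0 j) = fun=> (i == j)%:R.
Proof. by apply/funext => x; rewrite /partial derive_coord mxE eqxx eq_sym. Qed.

Lemma partial_add f g i : polyfun f -> polyfun g ->
  partial i (fun x => f x + g x) = fun x => partial i f x + partial i g x.
Proof.
by move=> fP gP; apply/funext => x; apply: derive_add; exact: polyfun_differentiable.
Qed.

Lemma partial_mul f g i : polyfun f -> polyfun g ->
  partial i (fun x => f x * g x) = fun x => f x * partial i g x + g x * partial i f x.
Proof.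
by move=> fP gP; apply/funext => x; apply: derive_mul; exact: polyfun_differentiable.
Qed.

Lemma partial_scale a f i : polyfun f ->
  partial i (fun x => a * f x) = fun x => a * partial i f x.
Proof.
move=> fP; rewrite partial_mul//; last exact: polyfun_cst.
by apply/funext => x; rewrite partial_cst mulr0 addr0.
Qed.

Lemma partial_sum (I : finType) (F : I -> 'rV[R]_n -> R) j :
  (forall i, polyfun (F i)) ->
  partial j (fun x => \sum_i F i x) = fun x => \sum_i partial j (F i) x.
Proof.
by move=> FP; apply/funext => x; apply: derive_fsum => i; exact: polyfun_differentiable.
Qed.

Lemma polyfun_partial f i : polyfun f -> polyfun (partial i f).
Proof. exact: polyfun_derive. Qed.

Lemma mx_addE m p (A B : 'M[R]_(m, p)) i j : (A + B) i j = A i j + B i j.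
Proof. by rewrite mxE. Qed.

Lemma mx_scaleE m p a (A : 'M[R]_(m, p)) i j : (a *: A) i j = a * A i j.
Proof. by rewrite mxE. Qed.

Lemma hessianE f x i j : hessian f x i j = partial i (partial j f) x.
Proof. by rewrite mxE. Qed.

Lemma hessian_add f g x : polyfun f -> polyfun g ->
  hessian (fun x => f x + g x) x = hessian f x + hessian g x.
Proof.
move=> fP gP; apply/matrixP => i j.
rewrite mx_addE; apply: etrans (hessianE _ _ _ _) _.
rewrite (partial_add j fP gP) (partial_add i (polyfun_partial j fP) (polyfun_partial j gP)).
by congr (_ + _); exact: esym (hessianE _ _ _ _).
Qed.

Lemma hessian_scale a f x : polyfun f ->
  hessian (fun x => a * f x) x = a *: hessian f x.
Proof.
move=> fP; apply/matrixP => i j.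
rewrite mx_scaleE; apply: etrans (hessianE _ _ _ _) _.
rewrite (partial_scale a j fP) (partial_scale a i (polyfun_partial j fP)).
by congr (_ * _); exact: esym (hessianE _ _ _ _).
Qed.

End Calculus.

Lemma derive_lift n (f : 'rV[R]_n -> R) (v x : 'rV[R]_(1 + n)) :
  'D_v (fun y : 'rV[R]_(1 + n) => f (rsubmx y)) x = 'D_(rsubmx v) f (rsubmx x).
Proof.
rewrite /derive (_ : (fun h : R => h^-1 *:
    (((fun y : 'rV[R]_(1 + n) => f (rsubmx y)) \o shift x) (h *: v) - f (rsubmx x))) =
  (fun h : R => h^-1 *: ((f \o shift (rsubmx x)) (h *: rsubmx v) - f (rsubmx x))))//.
by apply/funext => h /=; congr (_ *: (f _ - _)); rewrite linearD/= linearZ.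
Qed.

Lemma polyfun_lift n (f : 'rV[R]_n -> R) :
  polyfun f -> polyfun (fun y : 'rV[R]_(1 + n) => f (rsubmx y)).
Proof.
case=> k; elim: k f => [|k IH] f /=.
  by move=> [c ->]; exact: polyfun_cst.
move=> [c [F [FP ->]]]; apply: polyfun_add; first exact: polyfun_cst.
apply: polyfun_sum => i; apply: polyfun_mul; last exact: IH (FP i).
have -> : (fun x : 'rV[R]_(1 + n) => rsubmx x 0 i) = (fun x => x 0 (rshift 1 i)).
  by apply/funext => x; rewrite mxE.
exact: polyfun_coord.
Qed.

Lemma partial_liftr n (f : 'rV[R]_n -> R) i :
  partial (rshift 1 i) (fun y : 'rV[R]_(1 + n) => f (rsubmx y)) =
  fun y => partial i f (rsubmx y).
Proof.
apply/funext => x; rewrite /partial derive_lift; congr ('D_ _ _ _).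
by apply/rowP => j; rewrite !mxE eq_rshift.
Qed.

Lemma partial_liftl n (f : 'rV[R]_n -> R) i :
  partial (lshift n i) (fun y : 'rV[R]_(1 + n) => f (rsubmx y)) = fun=> 0.
Proof.
apply/funext => x; rewrite /partial derive_lift.
rewrite (_ : rsubmx (delta_mx 0 (lshift n i)) = 0) ?derive0//.
by apply/rowP => j; rewrite !mxE eq_rlshift andbF.
Qed.

End PolynomialFunctions.

(** * Restriction to lines, second derivative test, Euclidean balls *)

Section Lines.
Variables (R : realType) (n : nat).
Implicit Types (f g : 'rV[R]_n -> R) (x v : 'rV[R]_n) (p : {poly R}).

Lemma polyfun_line f x v : polyfun f -> exists p, forall s, f (x + s *: v) = p.[s].
Proof.
case=> k; elim: k f => [|k IH] f /=.
  by move=> [c ->]; exists c%:P => s; rewrite hornerC.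
move=> [c [g [gP ->]]].
have /choice[p pE] : forall i, exists p, forall s, g i (x + s *: v) = p.[s].
  by move=> i; exact: IH (gP i).
exists (c%:P + \sum_i ((x 0 i)%:P + (v 0 i) *: 'X) * p i) => s.
rewrite hornerD hornerC horner_sum; congr (_ + _); apply: eq_bigr => i _.
by rewrite hornerM hornerD hornerC hornerZ hornerX -pE !mxE (mulrC s).
Qed.

Lemma deriv_line f x v p : (forall s, f (x + s *: v) = p.[s]) ->
  forall s, 'D_v f (x + s *: v) = p^`().[s].
Proof.
move=> pE s; have -> : p^`().[s] = (horner p)^`()%classic s by rewrite -derivE.
rewrite derive1E /derive.
rewrite (_ : (fun h : R => h^-1 *: ((f \o shift (x + s *: v)) (h *: v) - f (x + s *: v))) =
  (fun h : R => h^-1 *: ((horner p \o shift s) (h *: 1) - p.[s])))//.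
apply/funext => h /=; rewrite -!pE; congr (_ *: (f _ - _)).
by rewrite [h%:A]mulr1 scalerDl addrCA.
Qed.

(** At a local maximum [p - p(0)] is divisible by [X^2], with a quotient [t] that is nonpositive at
    0; the second derivative there is [2 t(0)]. *)
Lemma poly_local_max_deriv2 p (r : R) : 0 < r ->
  (forall s, `|s| < r -> p.[s] <= p.[0]) -> p^`()^`().[0] <= 0.
Proof.
move=> r0 pmax.
have /factor_theorem[q qE] : root (p - (p.[0])%:P) 0 by rewrite rootE !hornerE subrr.
have qs s : `|s| < r -> q.[s] * s <= 0.
  move=> /pmax h; have := congr1 (horner^~ s) qE.
  by rewrite /= !hornerE subr0 => <-; rewrite subr_le0.
have near_gt0 (g : {poly R}) : 0 < g.[0] -> exists2 e, 0 < e & forall s, `|s| < e -> 0 < g.[s].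
  move=> g0; have /cvgr_gt/(_ 0 g0) := @continuous_horner R g 0.
  move=> /nbhs_ballP[e /= e0 he]; exists e => // s se; apply: he.
  by rewrite /ball/= sub0r normrN.
have q0 : q.[0] = 0.
  apply/eqP; rewrite eq_le; apply/andP; split; rewrite leNgt; apply/negP => q0.
    have [e e0 he] := near_gt0 _ q0.
    pose s := Num.min e r / 2.
    have m0 : 0 < Num.min e r by rewrite lt_min e0.
    have s0 : 0 < s by rewrite divr_gt0.
    have sm : s < Num.min e r by rewrite ltr_pdivrMr// mulr2n mulrDr mulr1 ltrDl.
    have := qs s; rewrite gtr0_norm// (lt_le_trans sm) ?ge_min ?lexx ?orbT//.
    move=> /(_ isT); rewrite leNgt mulr_gt0// he// gtr0_norm//.
    by rewrite (lt_le_trans sm) ?ge_min ?lexx.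
  have [e e0 he] := near_gt0 (- q) ltac:(by rewrite hornerN oppr_gt0).
  pose s := Num.min e r / 2.
  have m0 : 0 < Num.min e r by rewrite lt_min e0.
  have s0 : 0 < s by rewrite divr_gt0.
  have sm : s < Num.min e r by rewrite ltr_pdivrMr// mulr2n mulrDr mulr1 ltrDl.
  have := qs (- s); rewrite normrN gtr0_norm// (lt_le_trans sm) ?ge_min ?lexx ?orbT//.
  move=> /(_ isT); rewrite mulrN -mulNr -hornerN leNgt mulr_gt0// he//.
  by rewrite normrN gtr0_norm// (lt_le_trans sm) ?ge_min ?lexx.
have /factor_theorem[t tE] : root q 0 by rewrite rootE q0.
have t0 : t.[0] <= 0.
  rewrite leNgt; apply/negP => t0; have [e e0 he] := near_gt0 _ t0.
  pose s := Num.min e r / 2.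
  have m0 : 0 < Num.min e r by rewrite lt_min e0.
  have s0 : 0 < s by rewrite divr_gt0.
  have sm : s < Num.min e r by rewrite ltr_pdivrMr// mulr2n mulrDr mulr1 ltrDl.
  have := qs s; rewrite gtr0_norm// (lt_le_trans sm) ?ge_min ?lexx ?orbT//.
  move=> /(_ isT); rewrite tE !hornerE subr0 leNgt !mulr_gt0// he// gtr0_norm//.
  by rewrite (lt_le_trans sm) ?ge_min ?lexx.
have -> : p = (p.[0])%:P + t * 'X * 'X.
  by have := qE; rewrite tE subr0 => <-; rewrite addrC subrK.
rewrite !(derivD, derivC, derivM, derivX); move: t0; by rewrite !hornerE /= => t0; lra.
Qed.

Lemma derive2_hessian f x v : polyfun f ->
  'D_v ('D_v f) x = (v *m hessian f x *m v^T) 0 0.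
Proof.
move=> fP; have -> : 'D_v f = fun y => \sum_i v 0 i * partial i f y.
  by apply/funext => y; rewrite derive_sum_partial//; exact: polyfun_differentiable.
have pP i : polyfun (fun y => v 0 i * partial i f y).
  by apply: polyfun_mul; [exact: polyfun_cst|exact: polyfun_partial].
rewrite derive_fsum => [|i]; last exact: polyfun_differentiable.
rewrite mxE; apply: eq_bigr => i _; rewrite !mxE mulr_suml.
rewrite derive_sum_partial; last exact: polyfun_differentiable.
apply: eq_bigr => j _.
rewrite (partial_scale (v 0 i) j (polyfun_partial i fP)) hessianE; ring.
Qed.

Lemma local_max_hessian f x v (r : R) : polyfun f -> 0 < r ->
  (forall s, `|s| < r -> f (x + s *: v) <= f x) ->
  (v *m hessian f x *m v^T) 0 0 <= 0.
Proof.
move=> fP r0 fmax; have [p pE] := polyfun_line x v fP.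
have := @deriv_line ('D_v f) x v _ (@deriv_line f x v p pE) 0; rewrite scale0r addr0 derive2_hessian// => ->.
apply: (poly_local_max_deriv2 r0) => s sr; rewrite -!pE scale0r addr0.
exact: fmax.
Qed.

(** The norm of row vectors is the maximum norm. Euclidean balls are used because the sphere is the
    zero set of the quadratic polynomial [r^2 - sqn (x - x1)]. *)
Definition sqn x := \sum_i x 0 i ^+ 2.

Lemma sqn_ge0 x : 0 <= sqn x.
Proof. by apply: sumr_ge0 => i _; exact: sqr_ge0. Qed.

Lemma sqnZ a x : sqn (a *: x) = a ^+ 2 * sqn x.
Proof. by rewrite mulr_sumr; apply: eq_bigr => i _; rewrite mxE exprMn. Qed.

Lemma sqn_coord x i : x 0 i ^+ 2 <= sqn x.
Proof.
rewrite /sqn (bigD1 i)//= lerDl; apply: sumr_ge0 => j _; exact: sqr_ge0.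
Qed.

Lemma sqn_norm x (r : R) : 0 <= r -> sqn x <= r ^+ 2 -> `|x| <= r.
Proof.
move=> r0 xr; rewrite /Num.norm/= mx_normrE; apply/bigmax_leP; split=> // -[i j] _ /=.
rewrite ord1 -(@ler_pXn2r _ 2)// ?nnegrE// real_normK ?num_real//.
by rewrite (le_trans (sqn_coord x j)).
Qed.

Lemma polyfun_sqn x1 : polyfun (fun x => sqn (x - x1)).
Proof.
apply: polyfun_sum => i.
have -> : (fun x => (x - x1) 0 i ^+ 2) = (fun x => (x 0 i + - x1 0 i) * (x 0 i + - x1 0 i)).
  by apply/funext => x; rewrite !mxE expr2.
by apply: polyfun_mul; apply: polyfun_add; (exact: polyfun_coord || exact: polyfun_cst).
Qed.

Definition rball x1 (r : R) : set 'rV[R]_n := [set x | sqn (x - x1) <= r ^+ 2].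
Definition rsphere x1 (r : R) : set 'rV[R]_n := [set x | sqn (x - x1) = r ^+ 2].

Lemma compact_sublevel (A : set 'rV[R]_n) x1 (r : R) : closed A -> 0 <= r ->
  A `<=` rball x1 r -> compact A.
Proof.
move=> cA r0 Ar; apply: bounded_closed_compact => //.
exists (`|x1| + r); split; first exact: num_real.
move=> M hM x /Ar xr; apply: le_trans (ltW hM).
rewrite -[x](subrK x1) addrC (le_trans (ler_normD _ _))// lerD2l.
exact: sqn_norm.
Qed.

Lemma compact_rball x1 r : 0 <= r -> compact (rball x1 r).
Proof.
move=> r0; apply: (@compact_sublevel _ x1 r) => //.
have -> : rball x1 r = (fun x => sqn (x - x1)) @^-1` [set t | t <= r ^+ 2] by [].
apply: closed_comp; last exact: closed_le.
by move=> x _; exact/polyfun_continuous/polyfun_sqn.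
Qed.

Lemma compact_rsphere x1 r : 0 <= r -> compact (rsphere x1 r).
Proof.
move=> r0; apply: (@compact_sublevel _ x1 r) => //; last by move=> x; rewrite /rsphere/rball/= => ->.
have -> : rsphere x1 r = (fun x => sqn (x - x1)) @^-1` [set t | t = r ^+ 2] by [].
apply: closed_comp; last exact: closed_eq.
by move=> x _; exact/polyfun_continuous/polyfun_sqn.
Qed.

(** On the line from [x1] to [x] the polynomial has the distinct roots [d / (m + 2)], as many as it
    has coefficients. *)
Lemma polyfun_eq0 f x1 r : polyfun f -> 0 < r ->
  (forall x, sqn (x - x1) < r ^+ 2 -> f x = 0) -> forall x, f x = 0.
Proof.
move=> fP r0 f0 x; have [p pE] := polyfun_line x1 (x - x1) fP.
suff p0 : p = 0.
  by have := pE 1; rewrite scale1r addrC subrK p0 horner0.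
pose N := sqn (x - x1) + 1.
have N0 : 0 < N by rewrite ltr_wpDl// sqn_ge0.
pose d := Num.min 1 (r ^+ 2 / N).
have d0 : 0 < d by rewrite lt_min ltr01 divr_gt0// exprn_gt0.
have proot s : 0 < s -> s < d -> root p s.
  move=> s0; rewrite lt_min => /andP[s1 sN]; rewrite rootE -pE f0//.
  rewrite addrC addKr sqnZ; rewrite ltr_pdivlMr// in sN.
  apply: le_lt_trans sN; rewrite expr2 -mulrA ler_wpM2l ?(ltW s0)//.
  rewrite /N; have := sqn_ge0 (x - x1); nra.
apply: (@roots_geq_poly_eq0 _ p [seq d / m.+2%:R | m <- iota 0 (size p)]).
- apply/allP => _ /mapP[m _ ->]; apply: proot; first by rewrite divr_gt0.
  by rewrite ltr_pdivrMr// ltr_pMr// ltr1n.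
- rewrite map_inj_uniq ?iota_uniq// => a b /(mulfI (lt0r_neq0 d0)) /invr_inj /eqP.
  by rewrite eqr_nat !eqSS => /eqP.
- by rewrite size_map size_iota.
Qed.

End Lines.

(** * Constant coefficient operators and their maximum principle *)

Section Harmonic.
Variables (R : realType) (n m : nat) (G : 'M[R]_(m, n)).
Implicit Types (f g : 'rV[R]_n -> R) (x v : 'rV[R]_n).

Definition Lap f x : R := trform G (hessian f x).

Lemma trformE (B : 'M[R]_n) :
  trform G B = \sum_k (row k G *m B *m (row k G)^T) 0 0.
Proof.
by apply: eq_bigr => k _; rewrite -row_mul !mxE; apply: eq_bigr => j _; rewrite !mxE.
Qed.

Lemma trformD (A B : 'M[R]_n) : trform G (A + B) = trform G A + trform G B.
Proof. by rewrite /trform mulmxDr mulmxDl mxtraceD. Qed.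

Lemma trformZ a (B : 'M[R]_n) : trform G (a *: B) = a * trform G B.
Proof. by rewrite /trform -scalemxAr -scalemxAl mxtraceZ. Qed.

Lemma Lap_add f g x : polyfun f -> polyfun g ->
  Lap (fun y => f y + g y) x = Lap f x + Lap g x.
Proof. by move=> fP gP; rewrite /Lap hessian_add// trformD. Qed.

Lemma Lap_scale a f x : polyfun f -> Lap (fun y => a * f y) x = a * Lap f x.
Proof. by move=> fP; rewrite /Lap hessian_scale// trformZ. Qed.

Lemma Lap_sum (I : finType) (F : I -> 'rV[R]_n -> R) (c : I -> R) x :
  (forall i, polyfun (F i)) ->
  Lap (fun y => \sum_i c i * F i y) x = \sum_i c i * Lap (F i) x.
Proof.
move=> FP.
suff [] : polyfun (fun y => \sum_i c i * F i y) /\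
  Lap (fun y => \sum_i c i * F i y) x = \sum_i c i * Lap (F i) x by [].
elim: index_enum => [|i l [IH1 IH2]].
  have -> : (fun y => \sum_(i <- [::]) c i * F i y) = fun=> 0.
    by apply/funext => y; rewrite big_nil.
  split; first exact: polyfun_cst.
  rewrite big_nil -[RHS](mul0r (Lap (fun=> 0) x)) -Lap_scale; last exact: polyfun_cst.
  by congr (Lap _ x); apply/funext => y; rewrite mulr0.
have -> : (fun y => \sum_(j <- i :: l) c j * F j y) =
    fun y => c i * F i y + \sum_(j <- l) c j * F j y.
  by apply/funext => y; rewrite big_cons.
have iP : polyfun (fun y => c i * F i y) by apply: polyfun_mul => //; exact: polyfun_cst.
split; first exact: polyfun_add.
by rewrite Lap_add// IH2 Lap_scale// big_cons.
Qed.

Lemma poly_le_Lap k f : poly_le k.+2 f -> poly_le k (Lap f).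
Proof.
move=> fk; have -> : Lap f = fun x => \sum_k \sum_j \sum_i
    (G k i * G k j) * partial i (partial j f) x.
  apply/funext => x; rewrite /Lap trformE; apply: eq_bigr => l _.
  rewrite mxE; apply: eq_bigr => j _; rewrite !mxE mulr_suml; apply: eq_bigr => i _.
  by rewrite !mxE mulrAC.
apply: poly_le_sum => l; apply: poly_le_sum => j; apply: poly_le_sum => i.
by apply: poly_le_scale; apply: derive_poly_le; apply: derive_poly_le.
Qed.

Lemma hessian_sqn x1 x : hessian (fun y => sqn (y - x1)) x = (2 : R)%:M.
Proof.
apply/matrixP => i j; rewrite hessianE [RHS]mxE.
have cP k : polyfun (fun y : 'rV[R]_n => y 0 k + - x1 0 k).
  by apply: polyfun_add; [exact: polyfun_coord|exact: polyfun_cst].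
have -> : (fun y => sqn (y - x1)) =
    fun y => \sum_k (y 0 k + - x1 0 k) * (y 0 k + - x1 0 k).
  by apply/funext => y; apply: eq_bigr => k _; rewrite !mxE expr2.
have pE k l : partial l (fun y : 'rV[R]_n => y 0 k + - x1 0 k) = fun=> (l == k)%:R.
  rewrite partial_add; [|exact: polyfun_coord|exact: polyfun_cst].
  by rewrite partial_cst partial_coord; apply/funext => y; rewrite addr0.
have -> : partial j (fun y => \sum_k (y 0 k + - x1 0 k) * (y 0 k + - x1 0 k)) =
    fun y => 2 * (y 0 j + - x1 0 j).
  rewrite partial_sum => [|k]; last exact: polyfun_mul.
  apply/funext => y; rewrite (bigD1 j)//= big1 => [|k kj].
    by rewrite (partial_mul j (cP j) (cP j)) pE eqxx addr0 !mulr1 mulr_natl mulr2n.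
  by rewrite (partial_mul j (cP k) (cP k)) pE eq_sym (negbTE kj) mulr0 addr0.
rewrite (partial_scale _ i (cP j)) pE.
by case: (i == j); rewrite ?mulr1 ?mulr0.
Qed.

Lemma polyfun_within (A : set 'rV[R]_n) f : polyfun f -> {within A, continuous f}.
Proof. by move=> fP; apply: continuous_subspaceT; exact: polyfun_continuous. Qed.

Lemma rsphere_neq0 x1 (r : R) : (0 < n)%N -> rsphere x1 r !=set0.
Proof.
move=> n0; exists (x1 + r *: delta_mx 0 (Ordinal n0)).
rewrite /rsphere/= addrC addKr sqnZ.
rewrite /sqn (bigD1 (Ordinal n0))//= big1 => [|i /negbTE i0].
  by rewrite mxE !eqxx expr1n addr0 mulr1.
by rewrite mxE i0 andbF expr0n.
Qed.

(** Adding [e |z - x1|^2] makes [Lap] strictly positive, whereas at an interior maximum all second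
    derivatives along the rows of [G] are nonpositive. The constant [e] keeps the gain [e r^2] on
    the sphere below the gap [f x - f y]. *)
Lemma max_principle f x1 (r : R) : (0 < n)%N -> 0 < r -> 0 < trform G 1%:M ->
  polyfun f -> (forall x, 0 <= Lap f x) ->
  forall x, rball x1 r x -> exists2 y, rsphere x1 r y & f x <= f y.
Proof.
move=> n0 r0 G0 fP Lf x xr; apply: contrapT => nex.
have [y /set_mem yS ymax] := EVT_max_rV (rsphere_neq0 x1 r n0)
  (@compact_rsphere _ _ x1 r (ltW r0)) (polyfun_within (A := rsphere x1 r) fP).
have fxy : f y < f x.
  by rewrite ltNge; apply/negP => h; apply: nex; exists y.
pose e := (f x - f y) / (2 * r ^+ 2).
have e0 : 0 < e by rewrite divr_gt0 ?subr_gt0// mulr_gt0// exprn_gt0.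
have er : e * r ^+ 2 < f x - f y.
  have -> : e * r ^+ 2 = (f x - f y) / 2.
    by rewrite /e; field; rewrite gt_eqF.
  by rewrite ltr_pdivrMr// mulr2n mulrDr mulr1 ltrDl subr_gt0.
pose g z := f z + e * sqn (z - x1).
have sP : polyfun (fun z => sqn (z - x1)) by exact: polyfun_sqn.
have esP : polyfun (fun z => e * sqn (z - x1)).
  by apply: polyfun_mul => //; exact: polyfun_cst.
have gP : polyfun g by exact: polyfun_add.
have ball0 : rball x1 r !=set0 by exists x.
have [z /set_mem zB zmax] := EVT_max_rV ball0 (@compact_rball _ _ x1 r (ltW r0))
  (polyfun_within (A := rball x1 r) gP).
have gxz : g x <= g z by apply: zmax; rewrite inE.
have zin : sqn (z - x1) < r ^+ 2.
  rewrite lt_neqAle zB andbT; apply/eqP => zS.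
  have := ymax z; rewrite inE => /(_ zS) fzy.
  move: gxz; rewrite /g zS; have : 0 <= e * sqn (x - x1) by rewrite mulr_ge0 ?sqn_ge0 ?ltW.
  by lra.
have : Lap g z <= 0.
  rewrite /Lap trformE; apply: sumr_le0 => k _.
  set v := row k G.
  have qP : polyfun (fun y : 'rV[R]_n => sqn (y - x1)) := sP.
  have [p pE] := polyfun_line z v qP.
  have p0 : p.[0] < r ^+ 2 by rewrite -pE scale0r addr0.
  have /cvgr_lt/(_ _ p0) := @continuous_horner R p 0.
  move=> /nbhs_ballP[d /= d0 hd].
  apply: (@local_max_hessian _ _ g z v d) => // s sd.
  apply: zmax; rewrite inE /rball/= pE ltW//; apply: hd.
  by rewrite /ball/= sub0r normrN.
rewrite /g Lap_add// Lap_scale// {2}/Lap hessian_sqn.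
have -> : (2 : R)%:M = 2 *: (1%:M : 'M[R]_n) by rewrite scale_scalar_mx mulr1.
rewrite trformZ; apply/negP; rewrite -ltNge ltr_wpDl//.
by rewrite mulr_gt0// mulr_gt0.
Qed.

End Harmonic.

(** * The Dirichlet problem with polynomial data *)

Section PolynomialSpaces.
Variable R : realType.

Lemma poly_le_span n k : exists (I : finType) (e : I -> 'rV[R]_n -> R),
  (forall i, poly_le k (e i)) /\
  forall f, poly_le k f -> exists c : I -> R, f = fun x => \sum_i c i * e i x.
Proof.
elim: k => [|k [I [e [eP eS]]]].
  exists unit, (fun _ _ => 1); split=> [_|f [c ->]]; first exact: poly_le_cst.
  by exists (fun=> c); apply/funext => x; rewrite big_const card_unit /= mulr1 addr0.
exists (unit + 'I_n * I)%type, (fun o (x : 'rV[R]_n) =>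
  if o is inr (i, a) then x 0 i * e a x else 1).
split=> [[_|[i a]]|f [c [g [gP ->]]]].
- exact: poly_le_cst.
- exact: poly_le_coordM.
have /choice[d dE] : forall i, exists d : I -> R, g i = fun x => \sum_a d a * e a x.
  by move=> i; exact: eS (gP i).
exists (fun o => if o is inr (i, a) then d i a else c).
apply/funext => x.
rewrite big_sumType/= big_const card_unit/= mulr1 addr0; congr (_ + _).
rewrite [RHS](eq_bigr (fun p => d p.1 p.2 * (x 0 p.1 * e p.2 x))) => [|[i a] _ //].
rewrite -(pair_bigA _ (fun i a => d i a * (x 0 i * e a x)))/=; apply: eq_bigr => i _.
by rewrite dE mulr_sumr; apply: eq_bigr => a _; rewrite mulrCA.
Qed.

(** Dependent members are discarded one at a time. A basis is what will turn an injective linear map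
    into an invertible square matrix. *)
Lemma free_span (X : Type) (P : (X -> R) -> Prop) (I : finType) (e : I -> X -> R) :
  (forall i, P (e i)) ->
  (forall f, P f -> exists c : I -> R, f = fun x => \sum_i c i * e i x) ->
  exists N (b : 'I_N -> X -> R), [/\ forall l, P (b l),
    forall f, P f -> exists c : 'I_N -> R, f = fun x => \sum_l c l * b l x &
    forall c : 'I_N -> R, (forall x, \sum_l c l * b l x = 0) -> forall l, c l = 0].
Proof.
move=> eP eS.
have [N [b [bP bS]]] : exists N (b : 'I_N -> X -> R), (forall l, P (b l)) /\
    forall f, P f -> exists c : 'I_N -> R, f = fun x => \sum_l c l * b l x.
  exists #|I|, (fun l => e (enum_val l)); split=> [l|f /eS[c ->]]; first exact: eP.
  exists (fun l => c (enum_val l)); apply/funext => x.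
  by rewrite (reindex_onto enum_val enum_rank) => [|i _]; rewrite ?enum_rankK//;
    apply: eq_bigl => l; rewrite enum_valK eqxx.
elim: N b bP bS => [|N IH] b bP bS.
  by exists 0%N, b; split=> // c _ [].
have [fr|] := pselect (forall c : 'I_N.+1 -> R,
    (forall x, \sum_l c l * b l x = 0) -> forall l, c l = 0).
  by exists N.+1, b; split.
move=> /existsNP[c /not_implyP[c0 /existsNP[l0 /eqP cl0]]].
apply: (IH (fun j => b (lift l0 j))) => [l|f /bS[d ->]]; first exact: bP.
exists (fun j => d (lift l0 j) - d l0 * c (lift l0 j) / c l0); apply/funext => x.
have E := c0 x; rewrite (bigD1_ord l0)//= in E.
rewrite (bigD1_ord l0)//=.
have -> : b l0 x = - (\sum_(i < N) c (lift l0 i) * b (lift l0 i) x) / c l0.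
  by apply: (mulfI cl0); rewrite mulrCA mulfV// mulr1; apply/eqP; rewrite -addr_eq0 E.
rewrite mulNr mulrN mulrA mulr_sumr mulr_suml -sumrN -big_split/=.
apply: eq_bigr => i _; rewrite mulrBl addrC; congr (_ - _).
by ring.
Qed.

(** A solution [P + q p] is sought, where the quadratic [q] vanishes on the sphere. The map
    [p -> Lap (q p)] does not raise the degree and is injective by the maximum principle, hence onto
    in bounded degree. *)
Lemma harmonic_extension n m (G : 'M[R]_(m, n)) x1 (r : R) (P : 'rV[R]_n -> R) :
  (0 < n)%N -> 0 < r -> 0 < trform G 1%:M -> polyfun P ->
  exists tau : 'rV[R]_n -> R, [/\ polyfun tau, forall x, Lap G tau x = 0 &
    forall x, rsphere x1 r x -> tau x = P x].
Proof.
move=> n0 r0 G0 [k Pk].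
pose q x := r ^+ 2 + - 1 * sqn (x - x1).
have qP : poly_le 2 q.
  apply: poly_le_add; first exact: poly_le_cst.
  apply: poly_le_scale; apply: poly_le_sum => i.
  have -> : (fun x => (x - x1) 0 i ^+ 2) = (fun x => (x 0 i + - x1 0 i) * (x 0 i + - x1 0 i)).
    by apply/funext => x; rewrite !mxE expr2.
  apply: (@poly_le_mul _ _ 1 1); (apply: poly_le_add;
    [exact: poly_le_coord|exact: poly_le_cst]).
have [I [e [eP eS]]] := poly_le_span n k.
have [N [b [bP bS bfree]]] := free_span eP eS.
have qbP p : poly_le k p -> poly_le k.+2 (fun x => q x * p x).
  by move=> pk; exact: (poly_le_mul qP pk).
pose T p := Lap G (fun x => q x * p x).
have TP p : poly_le k p -> poly_le k (T p).
  by move=> pk; apply: poly_le_Lap; exact: qbP.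
have Tsum (c : 'I_N -> R) x :
    T (fun x => \sum_l c l * b l x) x = \sum_l c l * T (b l) x.
  have -> : T (fun x => \sum_l c l * b l x) =
      Lap G (fun x => \sum_l c l * (q x * b l x)).
    rewrite /T (_ : (fun x => q x * _) = (fun x => \sum_l c l * (q x * b l x)))//.
    by apply/funext => y; rewrite mulr_sumr; apply: eq_bigr => l _; rewrite mulrCA.
  by apply: Lap_sum => l; exists k.+2; exact: qbP.
(* [q p] is harmonic and vanishes on the sphere, so the maximum principle for it and its negative
   makes it 0 in the ball, where [q > 0]. *)
have Tinj p : poly_le k p -> (forall x, T p x = 0) -> forall x, p x = 0.
  move=> pk T0; have WP : polyfun (fun x => q x * p x) by exists k.+2; exact: qbP.
  have NP : polyfun (fun x => -1 * (q x * p x)).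
    by apply: polyfun_mul => //; exact: polyfun_cst.
  have qS y : rsphere x1 r y -> q y = 0.
    by rewrite /rsphere /q /= => ->; rewrite mulN1r subrr.
  apply: (@polyfun_eq0 _ _ p x1 r); [by exists k|by []|move=> x xr].
  have xB : rball x1 r x by exact: ltW.
  have q0 : 0 < q x by rewrite /q mulN1r subr_gt0.
  have [|y /qS yS] := @max_principle _ _ _ G _ x1 r n0 r0 G0 WP _ x xB.
    by move=> z; rewrite -/(T p z) T0.
  rewrite yS mul0r => h1.
  have [|y' /qS yS'] := @max_principle _ _ _ G _ x1 r n0 r0 G0 NP _ x xB.
    by move=> z; rewrite Lap_scale// -/(T p z) T0 mulr0.
  rewrite yS' mul0r mulr0 mulN1r oppr_le0 => h2.
  have : q x * p x == 0 by rewrite eq_le h1.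
  by rewrite mulf_eq0 gt_eqF//= => /eqP.
have /choice[M ME] : forall l, exists a : 'I_N -> R, T (b l) = fun x => \sum_j a j * b j x.
  by move=> l; apply: bS; apply: TP.
pose A : 'M[R]_N := \matrix_(l, j) M l j.
have TcE (c : 'rV[R]_N) x : T (fun x => \sum_l c 0 l * b l x) x =
    \sum_j (c *m A) 0 j * b j x.
  rewrite Tsum; under eq_bigr do rewrite ME mulr_sumr.
  rewrite exchange_big/=; apply: eq_bigr => j _; rewrite mxE mulr_suml.
  by apply: eq_bigr => l _; rewrite mxE mulrA.
have Aunit : A \in unitmx.
  rewrite -row_free_unit; apply: inj_row_free => c cA; apply/rowP => l.
  rewrite mxE; apply: (bfree (c 0)); apply: Tinj.
    by apply: poly_le_sum => j; exact: poly_le_scale.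
  by move=> x; rewrite TcE cA big1// => j _; rewrite mxE mul0r.
have [d dE] : exists d : 'I_N -> R, Lap G P = fun x => \sum_l d l * b l x.
  by apply: bS; apply: poly_le_Lap; exact/poly_leS/poly_leS.
pose c := (\row_l - d l) *m invmx A.
pose p x := \sum_l c 0 l * b l x.
have pk : poly_le k p by apply: poly_le_sum => l; exact: poly_le_scale.
have qpP : polyfun (fun x => q x * p x) by exists k.+2; exact: qbP.
exists (fun x => P x + q x * p x); split.
- by apply: polyfun_add => //; exists k.
- move=> x; rewrite Lap_add//; last by exists k.
  rewrite -/(T p x) TcE mulmxKV// dE -big_split/= big1// => l _.
  by rewrite mxE mulNr subrr.
- by move=> x; rewrite /rsphere/q/= => ->; rewrite mulN1r subrr mul0r addr0.
Qed.

End PolynomialSpaces.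

(** * Polynomial selections *)

Section RandomWalk.
Variables (R : realType) (n : nat).
Implicit Types (g : 'rV[R]_n -> R) (y z : 'rV[R]_n) (p : 'I_n -> R) (l : seq 'I_n).

(* Expectation of [g] at the end of a walk from [y] whose steps are
   [h e_i] with probability [p i], and none otherwise, for [i] in [l]: with
   [k] rounds over all coordinates and [h = 1/k], a Bernstein polynomial in
   [p]. *)
Fixpoint walk (h : R) l g y p : R :=
  if l is i :: l' then
    p i * walk h l' g (y + h *: delta_mx 0 i) p + (1 - p i) * walk h l' g y p
  else g y.

Lemma walk_le h l g1 g2 y p : (forall i, 0 <= p i <= 1) ->
  (forall z, g1 z <= g2 z) -> walk h l g1 y p <= walk h l g2 y p.
Proof.
move=> p01 g12; elim: l y => [|i l IH] y //=.
have /andP[p0 p1] := p01 i.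
by rewrite lerD// ler_wpM2l// subr_ge0.
Qed.

Lemma walk_affine h l g y p a b :
  walk h l (fun z => a + b * g z) y p = a + b * walk h l g y p.
Proof. by elim: l y => [|i l IH] y //=; rewrite !IH; ring. Qed.

Lemma sqn_add_delta y i a : sqn (y + a *: delta_mx 0 i) = sqn y + 2 * a * y 0 i + a ^+ 2.
Proof.
rewrite /sqn (bigD1 i)//= [in RHS](bigD1 i)//= !mxE !eqxx mulr1.
rewrite (eq_bigr (fun j => y 0 j ^+ 2)) => [|j /negbTE ji]; first by ring.
by rewrite !mxE ji mulr0 addr0.
Qed.

(** Bias and variance: the squared distance from the mean position to [z], plus the variances
    [h^2 p (1 - p)] of the independent steps. *)
Lemma walk_sqn h l y p z :
  walk h l (fun w => sqn (w - z)) y p =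
  sqn (y + h *: (\row_i ((count_mem i l)%:R * p i)) - z) +
  h ^+ 2 * \sum_(i <- l) p i * (1 - p i).
Proof.
elim: l y => [|i l IH] y /=.
  rewrite big_nil mulr0 addr0; congr (sqn (_ - _)).
  by rewrite (_ : \row__ _ = 0) ?scaler0 ?addr0//; apply/rowP => j; rewrite !mxE mul0r.
rewrite !IH big_cons.
set r := \row_j _; set r' := \row_j _.
have -> : r' = r + p i *: delta_mx 0 i.
  apply/rowP => j; rewrite !mxE eqxx natrD mulrDl addrC eq_sym /=.
  by case: eqVneq => [->|_]; rewrite ?mulr1 ?mul1r ?mulr0 ?mul0r.
have -> : y + h *: delta_mx 0 i + h *: r - z = (y + h *: r - z) + h *: delta_mx 0 i.
  by rewrite (addrAC y) [LHS]addrAC.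
have -> : y + h *: (r + p i *: delta_mx 0 i) - z =
    (y + h *: r - z) + (h * p i) *: delta_mx 0 i.
  by rewrite scalerDr scalerA !addrA [LHS]addrAC.
rewrite !sqn_add_delta; ring.
Qed.

Lemma polyfun_walk h l g y (p : 'rV[R]_n -> 'I_n -> R) :
  (forall i, polyfun (fun x => p x i)) -> polyfun (fun x => walk h l g y (p x)).
Proof.
move=> pP; elim: l y => [|i l IH] y /=; first exact: polyfun_cst.
apply: polyfun_add; apply: polyfun_mul => //.
by apply: polyfun_add; [exact: polyfun_cst|exact: polyfun_opp].
Qed.

Lemma walk_rounds_sqn k p : (forall i, 0 <= p i <= 1) ->
  walk k.+1%:R^-1 (flatten (nseq k.+1 (enum 'I_n))) (fun w => sqn (w - \row_i p i)) 0 p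
  <= n%:R / k.+1%:R.
Proof.
move=> p01; set l := flatten _.
have cl i : count_mem i l = k.+1.
  rewrite /l count_flatten map_nseq sumn_nseq.
  by rewrite count_uniq_mem ?enum_uniq// mem_enum mul1n.
rewrite walk_sqn.
have -> : 0 + k.+1%:R^-1 *: (\row_i ((count_mem i l)%:R * p i)) - \row_i p i = 0.
  apply/rowP => i; rewrite !mxE cl mulKf ?pnatr_eq0// add0r subrr//.
have -> : sqn (0 : 'rV[R]_n) = 0.
  by rewrite /sqn big1// => i _; rewrite mxE expr0n.
rewrite add0r /l big_flatten big_nseq iter_addr addr0.
rewrite big_enum/=; set S := \sum_i _.
have -> : k.+1%:R^-1 ^+ 2 * (S *+ k.+1) = S / k.+1%:R.
  have : (k.+1%:R : R) != 0 by rewrite pnatr_eq0.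
  by rewrite -(mulr_natr S); move: (k.+1%:R : R) => K K0; field.
rewrite ler_pM2r ?invr_gt0//.
apply: (@le_trans _ _ (\sum_(i < n) 1)); last by rewrite sumr_const card_ord.
apply: ler_sum => i _; have /andP[p0 p1] := p01 i; nra.
Qed.

(** Chebyshev's argument for Bernstein polynomials: values of [t] within [r] of [x] obey the local
    bound, and the remaining ones are outweighed by a multiple of the variance. As [t] may be
    discontinuous, [tau] is compared with local bounds of [t] and not with its values. *)
Lemma polynomial_selection (x1 : 'rV[R]_n) (rho r eta M : R) (t : 'rV[R]_n -> R) :
  0 < rho -> 0 < r -> 0 < eta -> (forall y, `|t y| <= M) ->
  exists2 tau : 'rV[R]_n -> R, polyfun tau & forall x, rball x1 rho x ->
    (forall a, (forall y, sqn (y - x) < r ^+ 2 -> t y <= a) -> tau x <= a + eta) /\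
    (forall a, (forall y, sqn (y - x) < r ^+ 2 -> a <= t y) -> a - eta <= tau x).
Proof.
move=> rho0 r0 eta0 tM.
(* [psi] maps the unit cube onto the cube of half-side [rho] about [x1], which contains the ball;
   [p x] is the preimage of [x], read as a vector of probabilities. *)
pose psi (y : 'rV[R]_n) := x1 + (2 * rho) *: (y - const_mx 2^-1).
pose p (x : 'rV[R]_n) i := (2 * rho)^-1 * (x 0 i + - x1 0 i) + 2^-1.
have rho2 : 2 * rho != 0 by rewrite mulf_neq0// gt_eqF.
have M0 : 0 <= M by exact: le_trans (tM 0).
have psiE y x : sqn (psi y - x) = (2 * rho) ^+ 2 * sqn (y - \row_i p x i).
  rewrite -sqnZ; congr sqn; apply/rowP => i; rewrite !mxE /p.
  by field; exact: lt0r_neq0.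
(* A walk that ends at distance at least [r] from [x] is charged the full oscillation [2 M]; then
   [k] brings the expected charge, at most [C n / (k + 1)], below [eta]. *)
pose C := 2 * M / r ^+ 2 * (2 * rho) ^+ 2.
have C0 : 0 <= C by rewrite /C mulr_ge0 ?sqr_ge0// divr_ge0 ?sqr_ge0// mulr_ge0.
pose k := Num.truncn (C * n%:R / eta).
pose tau x := walk k.+1%:R^-1 (flatten (nseq k.+1 (enum 'I_n))) (t \o psi) 0 (p x).
exists tau.
  apply: polyfun_walk => i; apply: polyfun_add; last exact: polyfun_cst.
  apply: polyfun_mul; first exact: polyfun_cst.
  by apply: polyfun_add; [exact: polyfun_coord|exact: polyfun_cst].
move=> x xB.
have p01 i : 0 <= p x i <= 1.
  have : `|x 0 i - x1 0 i| <= rho.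
    rewrite -(@ler_pXn2r _ 2)// ?nnegrE ?(ltW rho0)// real_normK ?num_real//.
    by apply: le_trans xB; have := sqn_coord (x - x1) i; rewrite !mxE.
  rewrite ler_norml => /andP[h1 h2]; rewrite /p.
  have hr : (2 * rho)^-1 * rho = 2^-1 by field; exact: lt0r_neq0.
  have i0 : 0 < (2 * rho)^-1 by rewrite invr_gt0 mulr_gt0.
  have h3 : (2 * rho)^-1 * (x 0 i - x1 0 i) <= (2 * rho)^-1 * rho by rewrite ler_pM2l.
  have h4 : (2 * rho)^-1 * (- rho) <= (2 * rho)^-1 * (x 0 i - x1 0 i) by rewrite ler_pM2l.
  by move: h3 h4; rewrite mulrN hr; lra.
have small : C * walk k.+1%:R^-1 (flatten (nseq k.+1 (enum 'I_n)))
    (fun w => sqn (w - \row_i p x i)) 0 (p x) <= eta.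
  apply: (@le_trans _ _ (C * (n%:R / k.+1%:R))).
    by rewrite ler_wpM2l// walk_rounds_sqn.
  rewrite mulrA ler_pdivrMr// [leRHS]mulrC -ler_pdivrMr//.
  by apply: ltW; exact: truncnS_gt.
have far y : r ^+ 2 <= sqn (psi y - x) -> 2 * M <= C * sqn (y - \row_i p x i).
  rewrite psiE; set S := sqn _ => h.
  have -> : C * S = 2 * M * ((2 * rho) ^+ 2 * S / r ^+ 2).
    by rewrite /C; field; exact: lt0r_neq0.
  by rewrite -[leLHS]mulr1 ler_wpM2l ?mulr_ge0// ler_pdivlMr ?exprn_gt0// mul1r.
have nonneg y : 0 <= C * sqn (y - \row_i p x i) by rewrite mulr_ge0// sqn_ge0.
have near0 : sqn (x - x) < r ^+ 2.
  have -> : sqn (x - x) = 0.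
    by rewrite /sqn big1// => i _; rewrite !mxE subrr expr0n.
  by rewrite exprn_gt0.
split=> a ha.
- rewrite /tau; apply: (@le_trans _ _ (walk k.+1%:R^-1 (flatten (nseq k.+1 (enum 'I_n)))
    (fun w => a + C * sqn (w - \row_i p x i)) 0 (p x))); last first.
    by rewrite walk_affine lerD2l.
  apply: walk_le => // y /=; have [yx|yx] := ltP (sqn (psi y - x)) (r ^+ 2).
    by rewrite (le_trans (ha _ yx))// lerDl.
  have := far _ yx; have := ha _ near0; have := tM x; have := tM (psi y).
  by rewrite !ler_norml => /andP[? ?] /andP[? ?]; lra.
- rewrite /tau; apply: (@le_trans _ _ (walk k.+1%:R^-1 (flatten (nseq k.+1 (enum 'I_n)))
    (fun w => a + (- C) * sqn (w - \row_i p x i)) 0 (p x))).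
    by rewrite walk_affine lerD2l mulNr lerN2.
  apply: walk_le => // y /=; have [yx|yx] := ltP (sqn (psi y - x)) (r ^+ 2).
    by rewrite (le_trans _ (ha _ yx))// gerDl mulNr oppr_le0.
  have := far _ yx; have := ha _ near0; have := tM x; have := tM (psi y).
  by rewrite !ler_norml mulNr => /andP[? ?] /andP[? ?]; lra.
Qed.

End RandomWalk.

(** * Semicontinuous functions on cylinders *)

Section Semicontinuity.
Variables (R : realType) (m : nat).
Implicit Types (U K : set 'rV[R]_m) (u : 'rV[R]_m -> \bar R).

Lemma usc_near U u x (a : R) : USC U u -> U x -> (u x < a%:E)%E ->
  \forall y \near x, U y -> (u y < a%:E)%E.
Proof. by move=> uU Ux uxa; have [_ /(_ _ uxa)] := uU x Ux; rewrite near_withinE. Qed.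

Lemma ltey_ex_fin (y z : \bar R) : (y < z)%E -> exists2 a : R, (y < a%:E)%E & (a%:E <= z)%E.
Proof.
case: y => [y| |]; case: z => [z| |] //= yz.
- by exists z.
- by exists (y + 1); rewrite ?lte_fin ?ltrDl ?leey.
- by exists z; rewrite ?ltNyr.
- by exists 0; rewrite ?ltNyr ?leey.
Qed.

Lemma lte_between (y : \bar R) (b : R) : (y < b%:E)%E ->
  exists2 a : R, (y < a%:E)%E & a < b.
Proof.
case: y => [y| |]// yb; last by exists (b - 1); rewrite ?ltNyr// ltrBlDr ltrDl.
by move: yb; rewrite lte_fin => yb; exists ((y + b) / 2); rewrite ?lte_fin; lra.
Qed.

Lemma usc_add U u (r : 'rV[R]_m -> R) : USC U u ->
  (forall x, U x -> {for x, continuous r}) -> USC U (fun x => (u x + (r x)%:E)%E).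
Proof.
move=> uU rc x Ux; split.
  by have [ux _] := uU x Ux; rewrite lte_add_pinfty ?ltry.
move=> a; rewrite near_withinE -lteBrDr// => /lte_between[b ub ba].
have rb : r x < a - b by move: ba; rewrite ltrBrDl ltrBrDr.
have /cvgr_lt/(_ _ rb) h1 := rc x Ux; have h2 := usc_near uU Ux ub.
apply: filterS2 h1 h2 => y ry uy Uy; have := uy Uy.
case: (u y) => [c| |]//; rewrite ?addNye ?ltNyr// -EFinD !lte_fin; lra.
Qed.

Lemma usc_bounded U u K : USC U u -> compact K -> K `<=` U ->
  exists M : R, forall x, K x -> (u x <= M%:E)%E.
Proof.
move=> uU /compact_near_coveringP cK KU.
have /(cK R +oo (fun (M : R) x => U x -> (u x <= M%:E)%E)) : forall x, K x ->
    \forall x' \near x & M \near +oo, U x' -> (u x' <= M%:E)%E.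
  move=> x Kx; have Ux := KU _ Kx; have [uy _] := uU x Ux.
  have [a uxa _] := ltey_ex_fin uy.
  exists ([set y | U y -> (u y < a%:E)%E], [set M | a <= M]) => /=.
    by split; [exact: usc_near uxa|exact: nbhs_pinfty_ge (num_real a)].
  by move=> [y M] /= [h aM] Uy; rewrite (le_trans (ltW (h Uy)))// lee_fin.
move=> [M [_ hM]]; exists (M + 1) => x Kx.
by apply: (hM (M + 1)) => //; [rewrite ltrDl|exact: KU].
Qed.

(** Without a maximum every point of [K] is strictly beaten by some value, and by semicontinuity so
    are its neighbours. Along the filter of superlevel sets, compactness yields one point that beats
    all of [K], itself included. *)
Lemma usc_max U u K : USC U u -> compact K -> K `<=` U -> K !=set0 ->
  exists2 x, K x & forall y, K y -> (u y <= u x)%E.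
Proof.
move=> uU /compact_near_coveringP cK KU [k0 Kk0]; apply: contrapT => nmax.
pose F := filter_from K (fun y0 => [set y | K y /\ (u y0 <= u y)%E]).
have FF : Filter F.
  apply: filter_from_filter; first by exists k0.
  move=> i j Ki Kj; have [ij|ji] := leP (u i) (u j).
    by exists j => // y [Ky h]; split; split=> //; exact: le_trans h.
  by exists i => // y [Ky h]; split; split=> //; exact: le_trans (ltW ji) h.
have [|y0 Ky0 /(_ y0)] := cK _ F (fun y x => U x -> (u x < u y)%E) FF.
  move=> x Kx; have [y Ky xy] : exists2 y, K y & (u x < u y)%E.
    apply: contrapT => h; apply: nmax; exists x => // y Ky.
    by rewrite leNgt; apply/negP => xy; apply: h; exists y.
  have [a xa ay] := ltey_ex_fin xy.
  exists ([set x' | U x' -> (u x' < a%:E)%E], [set y' | K y' /\ (u y <= u y')%E]) => /=.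
    by split; [exact: (usc_near uU (KU _ Kx) xa)|exists y].
  move=> [x' y'] /= [h [Ky' yy']] Ux'.
  exact: lt_le_trans (h Ux') (le_trans ay yy').
by move=> /(_ (conj Ky0 (lexx _)) _ Ky0 (KU _ Ky0)); rewrite ltxx.
Qed.

Lemma boundary_sublevel2 (f g : 'rV[R]_m -> R) z : continuous f -> continuous g ->
  topo_boundary [set z | f z <= 0 /\ g z <= 0] z ->
  (f z <= 0 /\ g z <= 0) /\ (f z = 0 \/ g z = 0).
Proof.
move=> fc gc [clz intz].
have cl : closed [set z | f z <= 0 /\ g z <= 0].
  apply: (@closedI _ [set z | f z <= 0] [set z | g z <= 0]).
    apply: (@closed_comp _ _ f [set t | t <= 0]); last exact: closed_le.
    by move=> x _; exact: fc.
  apply: (@closed_comp _ _ g [set t | t <= 0]); last exact: closed_le.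
  by move=> x _; exact: gc.
have [f0 g0] : [set z | f z <= 0 /\ g z <= 0] z by rewrite (proj1 (closure_id _) cl).
split=> //; apply: contrapT => /not_orP[fn gn]; apply: intz.
have fl : f z < 0 by rewrite lt_neqAle f0 andbT; apply/eqP.
have gl : g z < 0 by rewrite lt_neqAle g0 andbT; apply/eqP.
have /cvgr_lt/(_ _ fl) h1 := fc z; have /cvgr_lt/(_ _ gl) h2 := gc z.
by apply: filterS2 h1 h2 => y fy gy; split; exact: ltW.
Qed.

Lemma compact_sublevel2 (f g : 'rV[R]_m -> R) (M : R) : continuous f -> continuous g ->
  (forall z, f z <= 0 -> g z <= 0 -> `|z| <= M) ->
  compact [set z | f z <= 0 /\ g z <= 0].
Proof.
move=> fc gc bM; apply: bounded_closed_compact.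
  exists M; split; first exact: num_real.
  by move=> N MN z [fz gz]; exact: le_trans (bM _ fz gz) (ltW MN).
apply: (@closedI _ [set z | f z <= 0] [set z | g z <= 0]).
  apply: (@closed_comp _ _ f [set t | t <= 0]); last exact: closed_le.
  by move=> x _; exact: fc.
apply: (@closed_comp _ _ g [set t | t <= 0]); last exact: closed_le.
by move=> x _; exact: gc.
Qed.

End Semicontinuity.

Section Cylinder.
Variables (R : realType) (n : nat).
Implicit Types (J : set R) (D : set 'rV[R]_n) (x : 'rV[R]_n) (z : 'rV[R]_(1 + n)).

Definition tcoord z : R := z 0 (lshift n 0).

Lemma coord_txK z : coord_tx (tcoord z) (rsubmx z) = z.
Proof.
rewrite /coord_tx -[RHS]hsubmxK; congr row_mx.
by apply/rowP => i; rewrite !mxE !ord1 eqxx.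
Qed.

Lemma tcoord_tx t x : tcoord (coord_tx t x) = t.
Proof. by rewrite /tcoord /coord_tx row_mxEl mxE eqxx. Qed.

Lemma rsubmx_tx t x : rsubmx (coord_tx t x) = x.
Proof. exact: row_mxKr. Qed.

Lemma cylinderE J D z : cylinder J D z <-> J (tcoord z) /\ D (rsubmx z).
Proof.
split; last by move=> [Jt Dx]; exists (tcoord z) => //; exists (rsubmx z) => //; rewrite coord_txK.
by move=> [t Jt [x Dx <-]]; rewrite tcoord_tx rsubmx_tx.
Qed.

Lemma coord_tx_norm t x (M : R) : `|t| <= M -> `|x| <= M -> `|coord_tx t x| <= M.
Proof.
move=> tM; rewrite /Num.norm/= !mx_normrE => /bigmax_leP[M0 xM].
apply/bigmax_leP; split=> // -[i j] _ /=; rewrite ord1 /coord_tx.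
rewrite -(splitK j); case: (fintype.split j) => k /=.
  by rewrite row_mxEl !ord1 mxE eqxx.
by rewrite row_mxEr; exact: (xM (0, k)).
Qed.

Lemma near_coord_tx t x (P : set 'rV[R]_(1 + n)) : (\forall z \near coord_tx t x, P z) ->
  exists2 e : R, 0 < e & forall s y, `|s - t| < e -> `|y - x| < e -> P (coord_tx s y).
Proof.
move=> /nbhs_ballP[e /= e0 he]; exists (e / 2); first by rewrite divr_gt0.
move=> s y st yx; apply: he; rewrite -ball_normE /ball_/=.
have -> : coord_tx t x - coord_tx s y = coord_tx (t - s) (x - y).
  by rewrite /coord_tx opp_row_mx add_row_mx rmorphB.
apply: (@le_lt_trans _ _ (e / 2)).
  by apply: coord_tx_norm; rewrite distrC ltW.
by rewrite ltr_pdivrMr// mulr2n mulrDr mulr1 ltrDl.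
Qed.

Lemma polyfun_tcoord : polyfun tcoord.
Proof. exact: polyfun_coord. Qed.

(** By compactness one margin [r] serves all of [S]: the time chosen at [y] is good at every nearby
    [x]. [T] is obtained by choice, without any regularity, and the uniform margin makes up for
    it. *)
Lemma uniform_choice J D (S : set 'rV[R]_n) (u : 'rV[R]_(1 + n) -> \bar R)
    (phi : 'rV[R]_n -> R) :
  open J -> open D -> compact S -> S `<=` D -> USC (cylinder J D) u ->
  continuous phi -> (forall x, S x -> exists2 t, J t & (u (coord_tx t x) < (phi x)%:E)%E) ->
  exists (T : 'rV[R]_n -> R) (r M : R), [/\ 0 < r, forall y, `|T y| <= M &
    forall x y s, S x -> sqn (y - x) < r ^+ 2 -> `|s - T y| <= r ->
      J s /\ (u (coord_tx s x) < (phi x)%:E)%E].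
Proof.
move=> oJ oD /compact_near_coveringP cS SD uU phic uphi.
(* One parameter controls the size of the time, by [1 / e], and all radii. [P] weakens as [e]
   decreases, which suits a covering of [S] along the filter of small positive numbers. *)
pose P (e : R) x := exists2 t, `|t| <= e^-1 & forall y s, `|y - x| < e -> `|s - t| < e ->
  J s /\ (D y -> (u (coord_tx s y) < (phi y)%:E)%E).
have : \forall e \near (0:R)^'+, S `<=` P e.
  apply: cS => x Sx; have Dx := SD _ Sx; have [t Jt ut] := uphi x Sx.
  have [a uta aphi] : exists2 a, (u (coord_tx t x) < a%:E)%E & a < phi x by exact: lte_between.
  have Utx : cylinder J D (coord_tx t x) by apply/cylinderE; rewrite tcoord_tx rsubmx_tx.
  have [e1 e10 he1] := near_coord_tx (usc_near uU Utx uta).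
  have /cvgr_gt/(_ _ aphi)/nbhs_ballP[e2 /= e20 he2] := phic x.
  have /nbhs_ballP[e3 /= e30 he3] : nbhs t J by exact: open_nbhs_nbhs.
  pose e := Num.min e1 (Num.min e2 e3).
  have e0 : 0 < e by rewrite !lt_min e10 e20.
  exists (ball x (e / 2), [set d | d < e / 2 /\ d < (`|t| + 1)^-1 /\ 0 < d]) => /=.
    split; first by apply: nbhsx_ballx; rewrite divr_gt0.
    near=> d; split; first by near: d; apply: nbhs_right_lt; rewrite divr_gt0.
    split; last by near: d; exact: nbhs_right_gt.
    by near: d; apply: nbhs_right_lt; rewrite invr_gt0 ltr_wpDl.
  move=> [x' d] /= [xx' [de [dt d0]]]; exists t.
    rewrite -[leRHS]mul1r ler_pdivlMr//; move: dt.
    rewrite -[ltRHS]mul1r ltr_pdivlMr ?ltr_wpDl// => dt; nra.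
  move=> y s yx' st.
  have yx : `|y - x| < e.
    rewrite -(subrKA x') (le_lt_trans (ler_normD _ _))//.
    move: xx'; rewrite -ball_normE /ball_/= distrC => xx'; lra.
  have ste : `|s - t| < e by lra.
  have [ye1 ye2] : `|y - x| < e1 /\ `|y - x| < e2.
    by move: yx; rewrite /e !lt_min => /and3P[].
  have [se1 se3] : `|s - t| < e1 /\ `|s - t| < e3.
    by move: ste; rewrite /e !lt_min => /and3P[].
  have Js : J s by apply: he3; rewrite -ball_normE /ball_/= distrC.
  split=> // Dy; have Usy : cylinder J D (coord_tx s y).
    by apply/cylinderE; rewrite tcoord_tx rsubmx_tx.
  rewrite (lt_trans (he1 _ _ se1 ye1 Usy))// lte_fin.
  by apply: he2; rewrite -ball_normE /ball_/= distrC.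
move=> nearP.
have [e [e0 eP]] : exists e, 0 < e /\ S `<=` P e.
  near (0:R)^'+ => e; exists e; split; near: e => //; exact: nbhs_right_gt.
have r0 : 0 < e / 3 by rewrite divr_gt0.
have re : e / 3 + e / 3 < e by lra.
suff /choice[T hT] : forall y, exists t, `|t| <= e^-1 /\ forall x s, S x ->
    sqn (y - x) < (e / 3) ^+ 2 -> `|s - t| <= e / 3 ->
    J s /\ (u (coord_tx s x) < (phi x)%:E)%E.
  exists T, (e / 3), e^-1; split=> // [y|x y s]; first by have [] := hT y.
  by have [_] := hT y; exact.
move=> y; have [[x0 Sx0 yx0]|nx0] := pselect (exists2 x0, S x0 & sqn (y - x0) < (e / 3) ^+ 2).
  have [t te tP] := eP _ Sx0; exists t; split=> // x s Sx yx st.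
  have [||Js /(_ (SD _ Sx))] := tP x s => //.
    have -> : x - x0 = (y - x0) - (y - x) by rewrite opprB [RHS]addrC addrA subrK.
    rewrite (le_lt_trans (ler_normB _ _))// (le_lt_trans _ re)// lerD//;
      by apply: sqn_norm; exact: ltW.
  by rewrite (le_lt_trans st)//; lra.
(* Away from [S] the condition is vacuous, and 0 is a default value. *)
exists 0; split=> [|x s Sx yx _]; first by rewrite normr0 invr_ge0 ltW.
by exfalso; apply: nx0; exists x.
Unshelve. all: by end_near.
Qed.

End Cylinder.

(** * Comparison with polynomial test functions *)

Section TestFunctions.
Variable R : realType.

Lemma partial_comm n (f : 'rV[R]_n -> R) i j : polyfun f ->
  partial i (partial j f) = partial j (partial i f).
Proof.
case=> k; elim: k f => [|k IH] f /=.
  by move=> [c ->]; rewrite !partial_cst.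
move=> [c [g [gP ->]]].
have gp l : polyfun (g l) by exists k.
have xgp l : polyfun (fun x => x 0 l * g l x) by apply: polyfun_mul => //; exact: polyfun_coord.
have p1 a : partial a (fun x => c + \sum_l x 0 l * g l x) =
    fun x => g a x + \sum_l x 0 l * partial a (g l) x.
  rewrite partial_add; [|exact: polyfun_cst|exact: polyfun_sum].
  rewrite partial_cst (partial_sum a xgp); apply/funext => x; rewrite add0r.
  under eq_bigr do rewrite (partial_mul a (@polyfun_coord _ _ _) (gp _)) partial_coord.
  rewrite big_split/= addrC; congr (_ + _).
  rewrite (bigD1 a)//= eqxx mulr1 big1 ?addr0// => l.
  by rewrite eq_sym => /negbTE ->; rewrite mulr0.
have p2 a b : partial b (fun x => g a x + \sum_l x 0 l * partial a (g l) x) =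
    fun x => (partial b (g a) x + partial a (g b) x) + \sum_l x 0 l * partial b (partial a (g l)) x.
  have xgp' l : polyfun (fun x => x 0 l * partial a (g l) x).
    by apply: polyfun_mul; [exact: polyfun_coord|exact: polyfun_partial].
  rewrite (partial_add b (gp a) (polyfun_sum xgp')) (partial_sum b xgp').
  apply/funext => x; rewrite -addrA; congr (_ + _).
  under eq_bigr do rewrite (partial_mul b (@polyfun_coord _ _ _) (polyfun_partial a (gp _))) partial_coord.
  rewrite big_split/= addrC; congr (_ + _).
  rewrite (bigD1 b)//= eqxx mulr1 big1 ?addr0// => l.
  by rewrite eq_sym => /negbTE ->; rewrite mulr0.
rewrite (p1 j) (p1 i) (p2 j i) (p2 i j); apply/funext => x.
have swap (A B S S' : R) : S = S' -> A + B + S = B + A + S' by move=> ->; rewrite (addrC A).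
apply: swap; apply: eq_bigr => l _.
by rewrite (IH _ (gP l)).
Qed.

Lemma hessian_sym n (f : 'rV[R]_n -> R) x : polyfun f -> (hessian f x)^T = hessian f x.
Proof.
by move=> fP; apply/matrixP => i j; rewrite mxE !hessianE partial_comm.
Qed.

Lemma theta_SL_le n (B : 'M[R]_n) : B^T = B -> theta_SL B <= n%:R * pi / 2.
Proof.
move=> Bs; have [U [s [UV VU BE]]] := sym_spectral Bs.
rewrite (theta_SL_spectrum VU BE).
apply: (@le_trans _ _ (\sum_(i < n) (pi / 2))).
  by apply: ler_sum => i _; apply: ltW; exact: atan_ltpi2.
by rewrite sumr_const card_ord -[leLHS]mulr_natl mulrA.
Qed.

Lemma partial2_add_square n (f w : 'rV[R]_n -> R) a x i j : polyfun f -> polyfun w ->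
  partial i (partial j (fun y => f y + a * (w y * w y))) x =
  partial i (partial j f) x +
  a * (2 * (partial i w x * partial j w x + w x * partial i (partial j w) x)).
Proof.
move=> fP wP.
have wwP := polyfun_mul wP wP.
have wpP l : polyfun (partial l w) by exact: polyfun_partial.
have awP : polyfun (fun y => a * (w y * w y)) by apply: polyfun_mul => //; exact: polyfun_cst.
have wjP : polyfun (fun y => w y * partial j w y) by exact: polyfun_mul.
rewrite (partial_add j fP awP) (partial_scale a j wwP) (partial_mul j wP wP).
have -> : (fun y => partial j f y + a * (w y * partial j w y + w y * partial j w y)) =
  (fun y => partial j f y + (a * 2) * (w y * partial j w y)).
  by apply/funext => y; congr (_ + _); ring.
have a2P : polyfun (fun y => (a * 2) * (w y * partial j w y)).
  by apply: polyfun_mul => //; exact: polyfun_cst.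
rewrite (partial_add i (polyfun_partial j fP) a2P) (partial_scale (a * 2) i wjP).
rewrite (partial_mul i wP (wpP j)); congr (_ + _); ring.
Qed.

Definition grad n (f : 'rV[R]_n -> R) x : 'rV[R]_n := \row_i partial i f x.

Definition tilt n (tau : 'rV[R]_n -> R) (z : 'rV[R]_(1 + n)) : R :=
  tcoord z + - tau (rsubmx z).

Lemma polyfun_tilt n (tau : 'rV[R]_n -> R) : polyfun tau -> polyfun (tilt tau).
Proof.
move=> tP; apply: polyfun_add; first exact: polyfun_tcoord.
exact/polyfun_opp/polyfun_lift.
Qed.

Lemma partial_tiltl n (tau : 'rV[R]_n -> R) i : polyfun tau ->
  partial (lshift n i) (tilt tau) = fun=> 1.
Proof.
move=> tP; rewrite /tilt (partial_add _ (polyfun_tcoord _ _) (polyfun_opp (polyfun_lift tP))).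
rewrite /tcoord partial_coord (partial_liftl (fun x => - tau x)).
by apply/funext => z; rewrite ord1 eqxx addr0.
Qed.

Lemma partial_tiltr n (tau : 'rV[R]_n -> R) i : polyfun tau ->
  partial (rshift 1 i) (tilt tau) = fun z => - partial i tau (rsubmx z).
Proof.
move=> tP; rewrite /tilt (partial_add _ (polyfun_tcoord _ _) (polyfun_opp (polyfun_lift tP))).
rewrite /tcoord partial_coord (partial_liftr (fun x => - tau x)).
apply/funext => z; rewrite eq_rlshift add0r.
have -> : (fun x => - tau x) = (fun x => -1 * tau x) by apply/funext => x; rewrite mulN1r.
by rewrite partial_scale// mulN1r.
Qed.

(** The gradient of [tau] enters only through the shear, which [Theta_DSL] ignores for [a != 0]; the
    second derivatives of [tau] enter only through the Schur complement. *)
Lemma hessian_test n (phi tau : 'rV[R]_n -> R) a z : polyfun phi -> polyfun tau ->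
  hessian (fun z => phi (rsubmx z) + a * (tilt tau z * tilt tau z)) z =
  sheared (2 * a) (grad tau (rsubmx z))
    (hessian phi (rsubmx z) - (2 * a * tilt tau z) *: hessian tau (rsubmx z)).
Proof.
move=> pP tP; have wP := polyfun_tilt tP; have liftP := polyfun_lift pP.
apply/matrixP => i j; apply: etrans (hessianE _ _ _ _) _.
rewrite (partial2_add_square a z i j liftP wP).
rewrite /sheared -(splitK i) -(splitK j); case: (fintype.split i) => i';
  case: (fintype.split j) => j' /=.
- rewrite block_mxEul partial_liftl partial_cst !partial_tiltl// partial_cst.
  by rewrite !ord1 mxE eqxx mulr1n; ring.
- rewrite block_mxEur partial_liftr (partial_liftl (partial j' phi)) partial_tiltl//.
  rewrite partial_tiltr// (partial_liftl (fun x => - partial j' tau x)).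
  by rewrite !mxE; ring.
- rewrite block_mxEdl partial_liftl partial_cst partial_tiltl// partial_cst.
  by rewrite partial_tiltr// !mxE; ring.
- rewrite block_mxEdr partial_liftr (partial_liftr (partial j' phi)) !partial_tiltr//.
  rewrite (partial_liftr (fun x => - partial j' tau x)).
  have -> : (fun x => - partial j' tau x) = (fun x => -1 * partial j' tau x).
    by apply/funext => x; rewrite mulN1r.
  rewrite (partial_scale _ _ (polyfun_partial j' tP)) !mxE big_ord1 !mxE.
  move: (partial i' (partial j' phi) (rsubmx z)) (partial i' (partial j' tau) (rsubmx z)).
  move: (partial i' tau (rsubmx z)) (partial j' tau (rsubmx z)) (tilt tau z) => *; ring.
Qed.

Lemma between_roots (a b t : R) : a <= b -> (t - a) * (t - b) <= 0 -> a <= t <= b.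
Proof.
move=> ab h; apply/andP; split; rewrite leNgt; apply/negP => h2; nra.
Qed.

Section Comparison.
Variables (n : nat) (D : set 'rV[R]_n) (J : set R) (c : R) (u : 'rV[R]_(1 + n) -> \bar R).
Hypothesis u_type : of_type (@DSL_subeq R n c) (cylinder J D) u.

(** Since the interior of a set lies in the set, [Theta < c] puts the Hessian of [- Phi] in the dual
    subequation. Hence [u - Phi] is subaffine, and it is compared with the affine function 0. *)
Lemma comparison (Phi : 'rV[R]_(1 + n) -> R) (K : set 'rV[R]_(1 + n)) :
  polyfun Phi -> (forall z, Theta_DSL (hessian Phi z) < c) ->
  compact K -> K `<=` cylinder J D ->
  (forall z, topo_boundary K z -> (u z <= (Phi z)%:E)%E) ->
  forall z, K z -> (u z <= (Phi z)%:E)%E.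
Proof.
move=> PP Pc cK KU bK z Kz.
have ereal_le (x : \bar R) (r : R) : (x + (- r)%:E <= 0%:E)%E = (x <= r%:E)%E.
  case: x => [x| |].
  - by rewrite -EFinD !lee_fin subr_le0.
  - by [].
  - by rewrite /= !leNye.
have NP : polyfun (fun z => - Phi z) by exact: polyfun_opp.
have NE y : hessian (fun z => - Phi z) y = - hessian Phi y.
  have -> : (fun z => - Phi z) = (fun z => (- 1) * Phi z).
    by apply/funext => z'; rewrite mulN1r.
  by rewrite hessian_scale// scaleN1r.
have [_ /(_ _ (polyfun_C2 _ NP))] := u_type.
case=> [y _|_ sa].
  rewrite NE; split.
    by rewrite /Sym2/= linearN/= hessian_sym.
  rewrite opprK => -[Sy]; rewrite /within/= => /nbhs_singleton/(_ Sy) [_].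
  by rewrite leNgt Pc.
rewrite -ereal_le; apply: (sa (fun=> 0) K) => //.
  by exists 0, 0 => x; rewrite add0r big1// => i _; rewrite mxE mul0r.
by move=> y yK; rewrite ereal_le; exact: bK.
Qed.

Hypotheses (n_gt0 : (0 < n)%N) (D_open : open D) (J_open : open J) (J_itv : is_interval J).
Hypothesis c_ge : n%:R * pi / 2 <= c.

(* Compare [u] with [s + N |x - x0|^2 + eta (t - t1) (t2 - t)], whose Hessian
   is not in [DSL_subeq c] because it is negative in the direction [t]. *)
Lemma quasiconvex (x0 : 'rV[R]_n) (t1 t t2 s : R) : D x0 -> J t1 -> J t2 ->
  (u (coord_tx t1 x0) < s%:E)%E -> (u (coord_tx t2 x0) < s%:E)%E ->
  t1 <= t <= t2 -> (u (coord_tx t x0) <= s%:E)%E.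
Proof.
move=> Dx0 Jt1 Jt2 u1 u2 t12; have [uU _] := u_type.
have cyl a x : J a -> D x -> cylinder J D (coord_tx a x).
  by move=> Ja Dx; apply/cylinderE; rewrite tcoord_tx rsubmx_tx.
have [e1 e10 he1] := near_coord_tx (usc_near uU (cyl _ _ Jt1 Dx0) u1).
have [e2 e20 he2] := near_coord_tx (usc_near uU (cyl _ _ Jt2 Dx0) u2).
have /nbhs_ballP[e3 /= e30 he3] : nbhs x0 D by exact: open_nbhs_nbhs.
pose rho := Num.min e1 (Num.min e2 e3) / 2.
have m0 : 0 < Num.min e1 (Num.min e2 e3) by rewrite !lt_min e10 e20.
have rho0 : 0 < rho by rewrite divr_gt0.
have rhom : rho < Num.min e1 (Num.min e2 e3).
  by rewrite ltr_pdivrMr// mulr2n mulrDr mulr1 ltrDl.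
move: rhom; rewrite !lt_min => /and3P[r1 r2 r3].
have ballD x : rball x0 rho x -> D x.
  move=> xB; apply: he3; rewrite -ball_normE /ball_/= distrC.
  by rewrite (le_lt_trans _ r3)// sqn_norm// ltW.
have ball1 x : rball x0 rho x -> (u (coord_tx t1 x) < s%:E)%E.
  move=> xB; apply: he1; last exact: cyl (ballD _ xB).
    by rewrite subrr normr0.
  by rewrite (le_lt_trans _ r1)// sqn_norm// ltW.
have ball2 x : rball x0 rho x -> (u (coord_tx t2 x) < s%:E)%E.
  move=> xB; apply: he2; last exact: cyl (ballD _ xB).
    by rewrite subrr normr0.
  by rewrite (le_lt_trans _ r2)// sqn_norm// ltW.
pose tm := (t1 + t2) / 2; pose d := (t2 - t1) / 2.
pose w := tilt (fun _ : 'rV[R]_n => tm).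
have wP : polyfun w by apply: polyfun_tilt; exact: polyfun_cst.
pose f z := w z * w z + - (d ^+ 2).
pose g (z : 'rV[R]_(1 + n)) := sqn (rsubmx z - x0) + - (rho ^+ 2).
have fP : polyfun f by apply: polyfun_add; [exact: polyfun_mul|exact: polyfun_cst].
have gP : polyfun g.
  by apply: polyfun_add; [exact: (polyfun_lift (polyfun_sqn x0))|exact: polyfun_cst].
have fT z : f z = (tcoord z - t1) * (tcoord z - t2).
  by rewrite /f /w /tilt /tm /d; field.
have fE z : f z <= 0 -> t1 <= tcoord z <= t2.
  by rewrite fT; apply: between_roots; case/andP: t12; exact: le_trans.
have gE z : g z <= 0 -> rball x0 rho (rsubmx z) by rewrite /g /rball/= subr_le0.
pose K := [set z : 'rV[R]_(1 + n) | f z <= 0 /\ g z <= 0].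
have cK : compact K.
  apply: (@compact_sublevel2 _ _ f g ((`|t1| + `|t2|) + (`|x0| + rho)));
    [exact: polyfun_continuous|exact: polyfun_continuous|].
  move=> z /fE/andP[h1 h2] /gE hB; rewrite -[z]coord_txK; apply: coord_tx_norm.
    have := ler_norm t2; have := ler_norm (- t1); rewrite normrN.
    have := normr_ge0 x0; have := normr_ge0 t1; have := normr_ge0 t2.
    by rewrite ler_norml => *; lra.
  rewrite (@le_trans _ _ (`|x0| + rho))//; last by rewrite lerDr addr_ge0.
  rewrite -[rsubmx z](subrK x0) addrC (le_trans (ler_normD _ _))// lerD2l.
  by apply: sqn_norm => //; exact: ltW.
have KU : K `<=` cylinder J D.
  move=> z [/fE tz /gE zB]; apply/cylinderE; split; last exact: ballD.
  exact: J_itv tz.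
have [M hM] := usc_bounded uU cK KU.
(* On the lateral side, where [|x - x0| = rho], the test function then exceeds the bound [M] of [u];
   on the two lids [u < s] by the choice of [rho]. *)
pose N := (`|M| + `|s|) / rho ^+ 2.
have NE : N * rho ^+ 2 = `|M| + `|s| by rewrite divfK// gt_eqF// exprn_gt0.
have N0 : 0 <= N by rewrite divr_ge0 ?addr_ge0// exprn_ge0// ltW.
(* Every [eta > 0] gives an admissible Hessian, so [eta] can tend to 0 at the end. *)
suff main eta : 0 < eta -> (u (coord_tx t x0) <= (s + eta * ((t - t1) * (t2 - t)))%:E)%E.
  case: (u (coord_tx t x0)) main => [b|/(_ 1 ltr01)|]; rewrite ?leye_eq ?leNye//.
  move=> main; rewrite lee_fin; apply/ler_addgt0Pr => e e0.
  have p0 : 0 <= (t - t1) * (t2 - t).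
    by case/andP: t12 => h1 h2; rewrite mulr_ge0 ?subr_ge0.
  have := main (e / ((t - t1) * (t2 - t) + 1)).
  rewrite divr_gt0 ?ltr_wpDl// => /(_ isT); rewrite lee_fin => /le_trans; apply.
  rewrite lerD2l -mulrA ler_piMr ?(ltW e0)// mulrC ler_pdivrMr ?ltr_wpDl//.
  by rewrite mul1r lerDl.
move=> eta0.
pose phi (x : 'rV[R]_n) := (s + eta * d ^+ 2) + N * sqn (x - x0).
have phiP : polyfun phi.
  apply: polyfun_add; first exact: polyfun_cst.
  by apply: polyfun_mul; [exact: polyfun_cst|exact: polyfun_sqn].
pose Phi z := phi (rsubmx z) + (- eta) * (w z * w z).
have PP : polyfun Phi.
  apply: polyfun_add; first exact: polyfun_lift.
  by apply: polyfun_mul; [exact: polyfun_cst|exact: polyfun_mul].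
have PhiE z : Phi z = s + N * sqn (rsubmx z - x0) - eta * f z by rewrite /Phi /phi /f; ring.
have Pc z : Theta_DSL (hessian Phi z) < c.
  rewrite /Phi hessian_test//; last exact: polyfun_cst.
  have -> : hessian (fun _ : 'rV[R]_n => tm) (rsubmx z) = 0.
    by apply/matrixP => i j; rewrite hessianE !partial_cst mxE.
  rewrite scaler0 subr0 Theta_sheared; first last.
  - exact: hessian_sym.
  - by rewrite mulrN oppr_eq0 mulf_neq0// gt_eqF.
  (* The negative corner contributes [- pi / 2], so [Theta] is at most [(n - 1) pi / 2], below
     [c]. *)
  have -> : Num.sg (2 * - eta) = -1 by rewrite ltr0_sg// mulrN oppr_lt0 mulr_gt0.
  have := theta_SL_le (hessian_sym (rsubmx z) phiP); have := @pi_gt0 R.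
  by move: c_ge; lra.
have bK z : topo_boundary K z -> (u z <= (Phi z)%:E)%E.
  move=> /(boundary_sublevel2 (polyfun_continuous fP) (polyfun_continuous gP))[[fz gz]].
  have tz := fE _ fz; have zB := gE _ gz.
  rewrite PhiE => -[f0|g0].
    rewrite f0 mulr0 subr0; apply: (@le_trans _ _ s%:E); last first.
      by rewrite lee_fin lerDl mulr_ge0// sqn_ge0.
    move: f0; rewrite fT => /eqP; rewrite mulf_eq0 !subr_eq0 => /orP[] /eqP tE.
      by rewrite -[z]coord_txK tE ltW// ball1.
    by rewrite -[z]coord_txK tE ltW// ball2.
  have -> : sqn (rsubmx z - x0) = rho ^+ 2 by apply/eqP; rewrite -subr_eq0 -/(g z) g0.
  rewrite NE; apply: le_trans (hM z (conj fz gz)) _.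
  rewrite lee_fin; have := ler_norm M; have := ler_norm (- s); rewrite normrN.
  have : 0 <= - (eta * f z) by rewrite -mulrN; apply: mulr_ge0; rewrite ?oppr_ge0// ltW.
  by lra.
have sqn0 : sqn (0 : 'rV[R]_n) = 0.
  by rewrite /sqn big1// => i _; rewrite mxE expr0n.
have Kt : K (coord_tx t x0).
  split.
    rewrite fT tcoord_tx; case/andP: t12 => h1 h2.
    by rewrite mulr_ge0_le0 ?subr_ge0 ?subr_le0.
  by rewrite /g rsubmx_tx subrr sqn0 add0r oppr_le0 exprn_ge0// ltW.
have := comparison PP Pc cK KU bK Kt.
rewrite PhiE fT tcoord_tx rsubmx_tx subrr sqn0.
by have -> : s + N * 0 - eta * ((t - t1) * (t - t2)) = s + eta * ((t - t1) * (t2 - t)) by ring.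
Qed.

End Comparison.
End TestFunctions.

(** * Comparison in a tube around a harmonic graph *)

Section MinimumComparison.
Variables (R : realType) (n : nat) (D : set 'rV[R]_n) (J : set R) (c : R).
Variable (u : 'rV[R]_(1 + n) -> \bar R).
Hypothesis u_type : of_type (@DSL_subeq R n c) (cylinder J D) u.
Hypotheses (n_gt0 : (0 < n)%N) (D_open : open D) (J_open : open J) (J_itv : is_interval J).
Hypothesis c_ge : n%:R * pi / 2 <= c.

(** Up to [r / 2], [tau x] lies between values of [T] at points near [x]. So [s] lies between two
    good times [T y1 - r] and [T y2 + r], and quasiconvexity covers the interval. *)
Lemma graph_selection (x1 : 'rV[R]_n) (rho : R) (phi : 'rV[R]_n -> R) :
  0 < rho -> rball x1 rho `<=` D -> continuous phi ->
  (forall x, rsphere x1 rho x -> exists2 t, J t & (u (coord_tx t x) < (phi x)%:E)%E) ->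
  exists (tau : 'rV[R]_n -> R) (d : R), [/\ polyfun tau, 0 < d &
    forall x s, rsphere x1 rho x -> `|s - tau x| <= d ->
      J s /\ (u (coord_tx s x) < (phi x)%:E)%E].
Proof.
move=> rho0 BD phic uphi; have [uU _] := u_type.
have SB : rsphere x1 rho `<=` rball x1 rho by move=> x; rewrite /rsphere/rball/= => ->.
have SD : rsphere x1 rho `<=` D by move=> x /SB /BD.
have [T [r [M [r0 TM TP]]]] := uniform_choice J_open D_open
  (@compact_rsphere _ _ x1 rho (ltW rho0)) SD uU phic uphi.
have r2 : 0 < r / 2 by rewrite divr_gt0.
have [tau tauP tauB] := polynomial_selection x1 rho0 r0 r2 TM.
(* The selection error [r / 2] plus the tube radius [r / 4] stays within the margin [r]. *)
exists tau, (r / 4); split=> //; first by rewrite divr_gt0.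
move=> x s xS sx; have [up lo] := tauB x (SB _ xS).
have convex s1 s2 : J s1 -> (u (coord_tx s1 x) < (phi x)%:E)%E ->
    J s2 -> (u (coord_tx s2 x) < (phi x)%:E)%E -> s1 <= s <= s2 ->
    J s /\ (u (coord_tx s x) < (phi x)%:E)%E.
  move=> Js1 us1 Js2 us2 s12; split; first exact: J_itv s12.
  (* [quasiconvex] concludes with a weak inequality, so it is applied at a level [a] strictly below
     [phi x]. *)
  have umax : (Order.max (u (coord_tx s1 x)) (u (coord_tx s2 x)) < (phi x)%:E)%E.
    by rewrite gt_max us1.
  have [a a1 a2] := lte_between umax.
  move: a1; rewrite gt_max => /andP[a11 a12].
  apply: (@le_lt_trans _ _ a%:E); last by rewrite lte_fin.
  exact: (quasiconvex u_type D_open J_itv c_ge (SD _ xS) Js1 Js2 a11 a12 s12).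
have [y1 [yx1 ys1]] : exists y, sqn (y - x) < r ^+ 2 /\ T y - r <= s.
  apply: contrapT => h; have := lo (s + r).
  have hlo y : sqn (y - x) < r ^+ 2 -> s + r <= T y.
    move=> yx; rewrite leNgt; apply/negP => yT; apply: h; exists y; split=> //; lra.
  by move=> /(_ hlo); move: sx; rewrite ler_norml => /andP[? ?]; lra.
have [y2 [yx2 ys2]] : exists y, sqn (y - x) < r ^+ 2 /\ s <= T y + r.
  apply: contrapT => h; have := up (s - r).
  have hup y : sqn (y - x) < r ^+ 2 -> T y <= s - r.
    move=> yx; rewrite leNgt; apply/negP => yT; apply: h; exists y; split=> //; lra.
  by move=> /(_ hup); move: sx; rewrite ler_norml => /andP[? ?]; lra.
have [|J1 u1] := TP x y1 (T y1 - r) xS yx1.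
  by rewrite addrAC subrr sub0r normrN ger0_norm// ltW.
have [|J2 u2] := TP x y2 (T y2 + r) xS yx2.
  by rewrite addrAC subrr add0r ger0_norm// ltW.
by apply: (convex _ _ J1 u1 J2 u2); rewrite ys1 ys2.
Qed.

(* Compare [u] with [phi + N (t - tau)^2] near the graph of the harmonic
   extension [tau] of a selection of the sets [u < phi] over the sphere: the
   Schur complement of its Hessian is [B - 2 N (t - tau) hessian tau], on which
   the trace form of [G] takes the same value as on [B]. *)
Lemma minimum_comparison m (G : 'M[R]_(m, n)) (k : R) (B : 'M[R]_n)
    (phi : 'rV[R]_n -> R) (x1 : 'rV[R]_n) (rho : R) :
  0 < trform G 1%:M -> (forall A, SL_subeq (c - pi / 2) A -> k <= trform G A) ->
  trform G B < k -> polyfun phi -> (forall x, hessian phi x = B) ->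
  0 < rho -> rball x1 rho `<=` D ->
  (forall x, rsphere x1 rho x -> exists2 t, J t & (u (coord_tx t x) < (phi x)%:E)%E) ->
  exists2 t, J t & (u (coord_tx t x1) <= (phi x1)%:E)%E.
Proof.
move=> G0 Gk Bk phiP phiB rho0 BD uphi; have [uU _] := u_type.
have [tau0 [d [tau0P d0 good]]] := graph_selection rho0 BD (polyfun_continuous phiP) uphi.
have [tau [tauP tauH tauS]] := harmonic_extension x1 n_gt0 rho0 G0 tau0P.
have [ntauP ntauL] : polyfun (fun x => -1 * tau x) /\ forall x, 0 <= Lap G (fun x => -1 * tau x) x.
  split; first by apply: polyfun_mul => //; exact: polyfun_cst.
  by move=> x; rewrite Lap_scale// tauH mulr0.
have tauL x : 0 <= Lap G tau x by rewrite tauH.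
(* The maximum principle for [tau] and [- tau] traps [tau x] between boundary values; as [J] is an
   interval, the tube over the whole ball stays in the cylinder. *)
have Jtau x s : rball x1 rho x -> `|s - tau x| <= d -> J s.
  move=> xB sx.
  have [y yS xy] := max_principle n_gt0 rho0 G0 tauP tauL xB.
  have [y' yS' xy'] := max_principle n_gt0 rho0 G0 ntauP ntauL xB.
  have [Jy _] : J (tau y + d) /\ (u (coord_tx (tau y + d) y) < (phi y)%:E)%E.
    by apply: good => //; rewrite -tauS// addrAC subrr add0r ger0_norm// ltW.
  have [Jy' _] : J (tau y' - d) /\ (u (coord_tx (tau y' - d) y') < (phi y')%:E)%E.
    by apply: good => //; rewrite -tauS// addrAC subrr add0r normrN ger0_norm// ltW.
  apply: (J_itv Jy' Jy); move: sx; rewrite ler_norml => /andP[? ?].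
  by apply/andP; split; lra.
have B0 : rball x1 rho !=set0.
  exists x1; rewrite /rball/= subrr /sqn big1 ?exprn_ge0 ?(ltW rho0)// => i _.
  by rewrite mxE expr0n.
have cB := @compact_rball _ _ x1 rho (ltW rho0).
have [p1 _ tmax] := EVT_max_rV B0 cB (polyfun_within (A := rball x1 rho) tauP).
have [p2 _ tmin] := EVT_min_rV B0 cB (polyfun_within (A := rball x1 rho) tauP).
have [p3 _ phimin] := EVT_min_rV B0 cB (polyfun_within (A := rball x1 rho) phiP).
pose w := tilt tau.
have wP : polyfun w by exact: polyfun_tilt.
pose f z := w z * w z + - (d ^+ 2).
pose g (z : 'rV[R]_(1 + n)) := sqn (rsubmx z - x1) + - (rho ^+ 2).
have fP : polyfun f by apply: polyfun_add; [exact: polyfun_mul|exact: polyfun_cst].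
have gP : polyfun g.
  by apply: polyfun_add; [exact: (polyfun_lift (polyfun_sqn x1))|exact: polyfun_cst].
have fE z : f z <= 0 -> `|tcoord z - tau (rsubmx z)| <= d.
  rewrite /f subr_le0 -expr2 -[X in X <= _]real_normK ?num_real//.
  by rewrite ler_pXn2r// ?nnegrE// ltW.
have gE z : g z <= 0 -> rball x1 rho (rsubmx z) by rewrite /g /rball/= subr_le0.
pose K := [set z : 'rV[R]_(1 + n) | f z <= 0 /\ g z <= 0].
have cK : compact K.
  apply: (@compact_sublevel2 _ _ f g ((`|tau p1| + `|tau p2| + d) + (`|x1| + rho)));
    [exact: polyfun_continuous|exact: polyfun_continuous|].
  move=> z /fE hz /gE hB; rewrite -[z]coord_txK; apply: coord_tx_norm.
    have h1 := tmax (rsubmx z); have h2 := tmin (rsubmx z).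
    move: h1 h2; rewrite !inE => /(_ hB) h1 /(_ hB) h2; move: hz h1 h2.
    move: (tau (rsubmx z)) (tau p1) (tau p2) (tcoord z) (normr_ge0 x1) => a a1 a2 b.
    move: `|x1| => X X0; have := ler_norm a1; have := ler_norm (- a2).
    have := normr_ge0 a1; have := normr_ge0 a2; rewrite normrN.
    move: `|a1| `|a2| => A1 A2; rewrite !ler_norml.
    by move: d0 rho0 X0; clear => ? ? ? ? ? ? ? /andP[? ?] ? ?; apply/andP; split; lra.
  apply: (@le_trans _ _ (`|x1| + rho)); last by rewrite lerDr !addr_ge0// ltW.
  rewrite -[rsubmx z](subrK x1) addrC (le_trans (ler_normD _ _))// lerD2l.
  by apply: sqn_norm => //; exact: ltW.
have KU : K `<=` cylinder J D.
  move=> z [/fE tz /gE zB]; apply/cylinderE; split; last exact: BD.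
  exact: Jtau tz.
have [M hM] := usc_bounded uU cK KU.
(* On the wall [|t - tau| = d] this lifts even the minimum [phi p3] above the bound [M] of [u]; the
   added 1 makes [N] positive. *)
pose N := (`|M| + `|phi p3|) / d ^+ 2 + 1.
have NE : N * d ^+ 2 = `|M| + `|phi p3| + d ^+ 2.
  by rewrite mulrDl mul1r divfK// gt_eqF// exprn_gt0.
have N0 : 0 < N by rewrite ltr_wpDl// divr_ge0 ?addr_ge0// exprn_ge0// ltW.
pose Phi z := phi (rsubmx z) + N * (w z * w z).
have PP : polyfun Phi.
  apply: polyfun_add; first exact: polyfun_lift.
  by apply: polyfun_mul; [exact: polyfun_cst|exact: polyfun_mul].
have Pc z : Theta_DSL (hessian Phi z) < c.
  rewrite /Phi (hessian_test N z phiP tauP) phiB.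
  set S := B - _.
  have Ss : S^T = S.
    by rewrite /S linearB/= linearZ/= (hessian_sym _ tauP) -(phiB x1) (hessian_sym _ phiP).
  rewrite Theta_sheared//; last by rewrite mulf_neq0// gt_eqF.
  rewrite gtr0_sg ?mul1r ?mulr_gt0// -ltrBrDl ltNge; apply/negP => Sc.
  have := Gk S (conj Ss Sc).
  rewrite /S -scaleNr trformD trformZ -[trform G (hessian _ _)]/(Lap G tau _) tauH mulr0 addr0.
  by rewrite leNgt Bk.
have bK z : topo_boundary K z -> (u z <= (Phi z)%:E)%E.
  move=> /(boundary_sublevel2 (polyfun_continuous fP) (polyfun_continuous gP))[[fz gz]].
  have tz := fE _ fz; have zB := gE _ gz => -[f0|g0].
    have w2 : w z * w z = d ^+ 2 by apply/eqP; rewrite -subr_eq0 -/(f z) f0.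
    rewrite /Phi w2 NE; apply: le_trans (hM z (conj fz gz)) _.
    rewrite lee_fin; have := phimin (rsubmx z); rewrite inE => /(_ zB).
    have := ler_norm M; have := ler_norm (- phi p3); rewrite normrN.
    have : 0 < d ^+ 2 by rewrite exprn_gt0.
    by lra.
  have zS : rsphere x1 rho (rsubmx z).
    by apply/eqP; rewrite -subr_eq0 -/(g z) g0.
  have [_ uz] : J (tcoord z) /\ (u (coord_tx (tcoord z) (rsubmx z)) < (phi (rsubmx z))%:E)%E.
    by apply: good => //; rewrite -tauS.
  rewrite coord_txK in uz; apply: (le_trans (ltW uz)); rewrite lee_fin lerDl.
  by rewrite mulr_ge0 ?(ltW N0)// -expr2 sqr_ge0.
have w0 : w (coord_tx (tau x1) x1) = 0 by rewrite /w /tilt tcoord_tx rsubmx_tx subrr.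
have x1B : rball x1 rho x1.
  rewrite /rball/= subrr /sqn big1 ?exprn_ge0 ?(ltW rho0)// => i _.
  by rewrite mxE expr0n.
have Kt : K (coord_tx (tau x1) x1).
  split; first by rewrite /f w0 mulr0 add0r oppr_le0 exprn_ge0// ltW.
  by rewrite /g rsubmx_tx subr_le0.
exists (tau x1); first by apply: (Jtau x1) => //; rewrite subrr normr0 ltW.
by have := comparison u_type PP Pc cK KU bK Kt; rewrite /Phi w0 !mulr0 addr0 rsubmx_tx.
Qed.

End MinimumComparison.

(** * Second order Taylor expansion and the minimum principle *)

Section Taylor.
Variables (R : realType) (n : nat).
Implicit Types (f : 'rV[R]_n -> R) (x y e : 'rV[R]_n).

Lemma is_derive_line f y e (s d : R) : is_derive (y + s *: e) e f d ->
  is_derive s 1 (fun t : R => f (y + t *: e)) d.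
Proof.
have E : (fun h : R => h^-1 *: (((fun t : R => f (y + t *: e)) \o shift s) (h *: 1)
      - f (y + s *: e))) =
    (fun h : R => h^-1 *: ((f \o shift (y + s *: e)) (h *: e) - f (y + s *: e))).
  apply/funext => h /=; congr (_ *: (f _ - _)).
  by rewrite [h%:A]mulr1 scalerDl addrCA.
move=> [df dE]; apply: DeriveDef; first by rewrite /derivable E.
by rewrite -dE /derive E.
Qed.

Lemma line_bound f y e (df : R -> R) (h C : R) :
  (forall s, `|s| <= `|h| -> is_derive (y + s *: e) e f (df s)) ->
  (forall s, `|s| <= `|h| -> `|df s| <= C) ->
  `|f (y + h *: e) - f y| <= C * `|h|.
Proof.
move=> fd dC; pose F (t : R) := f (y + t *: e).
have Fd (s : R) : `|s| <= `|h| -> is_derive s 1 F (df s).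
  by move=> /fd; exact: is_derive_line.
have F0 : F 0 = f y by rewrite /F scale0r addr0.
rewrite -F0 -/(F h).
have mvt (a b : R) : a < b -> (forall s, a <= s <= b -> `|s| <= `|h|) ->
    `|F b - F a| <= C * (b - a).
  move=> ab abh; have Fab (s : R) : s \in `]a, b[ -> is_derive s 1 F (df s).
    by rewrite in_itv/= => /andP[h1 h2]; apply/Fd/abh; rewrite !ltW.
  have Fc : {within `[a, b], continuous F}.
    apply: derivable_within_continuous => s; rewrite in_itv/= => sab.
    by have [] := Fd s (abh _ sab).
  have [s sab ->] := MVT ab Fab Fc.
  rewrite normrM (ger0_norm (x := b - a)) ?subr_ge0 ?(ltW ab)//.
  rewrite ler_wpM2r ?subr_ge0 ?(ltW ab)//; apply/dC/abh.
  by move: sab; rewrite in_itv/= => /andP[? ?]; rewrite !ltW.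
have [h0|h0|->] := ltgtP h 0.
- rewrite distrC (ltr0_norm h0) -[X in C * X]add0r; apply: mvt => // s /andP[h1 h2].
  by rewrite (ltr0_norm h0) ler0_norm// lerN2.
- rewrite (gtr0_norm h0) -[X in C * X]subr0; apply: mvt => // s /andP[h1 h2].
  by rewrite (gtr0_norm h0) ger0_norm.
- by rewrite subrr !normr0 mulr0.
Qed.

(** The path from [x1] to [x] changes one coordinate at a time and stays in a ball of the maximum
    norm; each of its [n] legs obeys the mean value bound. *)
Lemma box_bound f x1 x (df : 'I_n -> 'rV[R]_n -> R) (C : R) :
  (forall i z, `|z - x1| <= `|x - x1| -> is_derive z (delta_mx 0 i) f (df i z)) ->
  (forall i z, `|z - x1| <= `|x - x1| -> `|df i z| <= C) ->
  `|f x - f x1| <= n%:R * (C * `|x - x1|).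
Proof.
move=> fd dC.
pose y (k : nat) : 'rV[R]_n := \row_j (if (j < k)%N then x 0 j else x1 0 j).
have entry (v : 'rV[R]_n) j : `|v 0 j| <= `|v|.
  by rewrite [leRHS]/Num.norm/= mx_normrE; apply/bigmax_geP; right; exists (0, j).
have normle (v : 'rV[R]_n) (M : R) : 0 <= M -> (forall j, `|v 0 j| <= M) -> `|v| <= M.
  move=> M0 vM; rewrite /Num.norm/= mx_normrE; apply/bigmax_leP; split=> // -[a j] _ /=.
  by rewrite ord1.
have yn : y n = x by apply/rowP => j; rewrite mxE ltn_ord.
have main k : (k <= n)%N -> `|f (y k) - f x1| <= k%:R * (C * `|x - x1|).
  elim: k => [_|k IH kn].
    have -> : y 0%N = x1 by apply/rowP => j; rewrite mxE.
    by rewrite subrr normr0 mul0r.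
  pose i := Ordinal kn; pose h := x 0 i - x1 0 i.
  have hle : `|h| <= `|x - x1| by have := entry (x - x1) i; rewrite !mxE.
  have yS : y k.+1 = y k + h *: delta_mx 0 i.
    apply/rowP => j; rewrite !mxE eqxx /= ltnS leq_eqVlt -val_eqE/=.
    have [jk|jk] := eqVneq (j : nat) k => /=.
      have -> : j = i by apply: val_inj.
      by rewrite ltnn /h mulr1 addrC subrK.
    by rewrite mulr0 addr0.
  have inbox s : `|s| <= `|h| -> `|y k + s *: delta_mx 0 i - x1| <= `|x - x1|.
    move=> sh; apply: normle => // j; rewrite !mxE eqxx /= -val_eqE/=.
    have [jk|jk] := eqVneq (j : nat) k => /=.
      by rewrite jk ltnn mulr1 addrAC subrr add0r (le_trans sh).
    rewrite mulr0 addr0; case: ifP => _; last by rewrite subrr normr0.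
    by have := entry (x - x1) j; rewrite !mxE.
  have step : `|f (y k.+1) - f (y k)| <= C * `|h|.
    rewrite yS; apply: (@line_bound f (y k) (delta_mx 0 i)
      (fun s => df i (y k + s *: delta_mx 0 i))) => s sh.
      exact: fd (inbox _ sh).
    exact: dC (inbox _ sh).
  have C0 : 0 <= C.
    apply: le_trans (dC i x1 _); first exact: normr_ge0.
    by rewrite subrr normr0.
  have -> : f (y k.+1) - f x1 = (f (y k.+1) - f (y k)) + (f (y k) - f x1).
    by rewrite addrA subrK.
  rewrite (le_trans (ler_normD _ _))// -natr1 mulrDl mul1r addrC lerD//.
    exact: IH (ltnW kn).
  by rewrite (le_trans step)// ler_wpM2l.
by have := main n (leqnn n); rewrite yn.
Qed.

Definition quad (a : R) (l : 'rV[R]_n) (H : 'M[R]_n) x1 x : R :=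
  a + \sum_i l 0 i * (x 0 i + - x1 0 i) +
  2^-1 * \sum_i \sum_j H i j * ((x 0 i + - x1 0 i) * (x 0 j + - x1 0 j)).

Lemma polyfun_quad a l H x1 : polyfun (quad a l H x1).
Proof.
have yP i : polyfun (fun x : 'rV[R]_n => x 0 i + - x1 0 i).
  by apply: polyfun_add; [exact: polyfun_coord|exact: polyfun_cst].
apply: polyfun_add.
  apply: polyfun_add; first exact: polyfun_cst.
  by apply: polyfun_sum => i; apply: polyfun_mul => //; exact: polyfun_cst.
apply: polyfun_mul; first exact: polyfun_cst.
apply: polyfun_sum => i; apply: polyfun_sum => j.
by apply: polyfun_mul; [exact: polyfun_cst|exact: polyfun_mul].
Qed.

Lemma partial_quad a l H x1 k : H^T = H ->
  partial k (quad a l H x1) = fun x => l 0 k + \sum_j H k j * (x 0 j + - x1 0 j).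
Proof.
move=> Hs.
have yP i : polyfun (fun x : 'rV[R]_n => x 0 i + - x1 0 i).
  by apply: polyfun_add; [exact: polyfun_coord|exact: polyfun_cst].
have dy i : partial k (fun x : 'rV[R]_n => x 0 i + - x1 0 i) = fun=> (k == i)%:R.
  rewrite (partial_add k (@polyfun_coord _ _ i) (@polyfun_cst _ _ _)).
  by rewrite partial_coord partial_cst; apply/funext => x; rewrite addr0.
have lP i : polyfun (fun x : 'rV[R]_n => l 0 i * (x 0 i + - x1 0 i)).
  by apply: polyfun_mul => //; exact: polyfun_cst.
have yyP i j : polyfun (fun x : 'rV[R]_n => (x 0 i + - x1 0 i) * (x 0 j + - x1 0 j)).
  exact: polyfun_mul.
have HP i j : polyfun (fun x : 'rV[R]_n => H i j * ((x 0 i + - x1 0 i) * (x 0 j + - x1 0 j))).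
  by apply: polyfun_mul => //; exact: polyfun_cst.
have SP i := polyfun_sum (HP i).
have P1 := polyfun_add (@polyfun_cst _ _ a) (polyfun_sum lP).
have P2 := polyfun_mul (@polyfun_cst _ _ 2^-1) (polyfun_sum SP).
rewrite /quad (partial_add k P1 P2) (partial_add k (@polyfun_cst _ _ a) (polyfun_sum lP)).
rewrite partial_cst (partial_sum k lP) (partial_scale _ k (polyfun_sum SP)) (partial_sum k SP).
apply/funext => x; rewrite add0r; congr (_ + _).
  under eq_bigr do rewrite (partial_scale _ k (yP _)) dy.
  rewrite (bigD1 k)//= eqxx mulr1 big1 ?addr0// => i.
  by rewrite eq_sym => /negbTE ->; rewrite mulr0.
have E i : partial k (fun x : 'rV[R]_n => \sum_j H i j * ((x 0 i + - x1 0 i) * (x 0 j + - x1 0 j))) x =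
    \sum_j H i j * ((x 0 i + - x1 0 i) * (k == j)%:R) +
    \sum_j H i j * ((x 0 j + - x1 0 j) * (k == i)%:R).
  rewrite (partial_sum k (HP i)) -big_split/=; apply: eq_bigr => j _.
  by rewrite (partial_scale _ k (yyP i j)) (partial_mul k (yP i) (yP j)) !dy mulrDr.
under eq_bigr do rewrite E.
rewrite big_split/=.
have -> : \sum_i \sum_j H i j * ((x 0 i + - x1 0 i) * (k == j)%:R) =
    \sum_j H k j * (x 0 j + - x1 0 j).
  apply: eq_bigr => i _; rewrite (bigD1 k)//= eqxx mulr1 big1 ?addr0 => [|j].
    by rewrite -[in LHS]Hs mxE.
  by rewrite eq_sym => /negbTE ->; rewrite !mulr0.
have -> : \sum_i \sum_j H i j * ((x 0 j + - x1 0 j) * (k == i)%:R) =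
    \sum_j H k j * (x 0 j + - x1 0 j).
  rewrite (bigD1 k)//= eqxx [X in _ + X]big1 ?addr0 => [|i].
    by apply: eq_bigr => j _; rewrite mulr1.
  by rewrite eq_sym => /negbTE ->; rewrite big1// => j _; rewrite !mulr0.
by move: (\sum_j _) => S; field.
Qed.

Lemma partial2_quad a l H x1 i k : H^T = H ->
  partial i (partial k (quad a l H x1)) = fun=> H k i.
Proof.
move=> Hs; rewrite (partial_quad a l x1 k Hs).
(* A first partial derivative is again a [quad], with zero quadratic part, so [partial_quad] applies
   a second time. *)
have -> : (fun x : 'rV[R]_n => l 0 k + \sum_j H k j * (x 0 j + - x1 0 j)) =
    quad (l 0 k) (\row_j H k j) 0 x1.
  apply/funext => x; rewrite /quad (_ : \sum_i \sum_j _ = 0) ?mulr0 ?addr0.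
    by congr (_ + _); apply: eq_bigr => j _; rewrite mxE.
  by rewrite big1// => a' _; rewrite big1// => j _; rewrite mxE mul0r.
rewrite partial_quad ?trmx0//; apply/funext => x.
by rewrite mxE big1 ?addr0// => j _; rewrite mxE mul0r.
Qed.

Lemma hessian_quad a l H x1 x : H^T = H -> hessian (quad a l H x1) x = H.
Proof.
move=> Hs; apply/matrixP => i j; rewrite hessianE partial2_quad//.
by rewrite -[in RHS]Hs mxE.
Qed.

Lemma quad_center a l H x1 : quad a l H x1 x1 = a.
Proof.
rewrite /quad big1 => [|i _]; last by rewrite subrr mulr0.
rewrite big1 ?mulr0 ?addr0// => i _; rewrite big1// => j _.
by rewrite subrr mul0r mulr0.
Qed.

(** [f - P] and its first partial derivatives vanish at [x1], and the second ones are small nearby: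
    [box_bound] is applied to the first derivatives, then to [f - P]. The symmetry assumed of the
    Hessian will come from membership in the dual subequation. *)
Lemma taylor2 (U : set 'rV[R]_n) f x1 (e : R) : open U -> C2_on U f -> U x1 ->
  (hessian f x1)^T = hessian f x1 -> 0 < e ->
  \forall x \near x1, `|f x - quad (f x1) (grad f x1) (hessian f x1) x1 x| <= e * `|x - x1| ^+ 2.
Proof.
move=> oU [fC1 fC2] Ux1 Hs e0.
set P := quad _ _ _ _.
have PP : polyfun P by exact: polyfun_quad.
(* The two uses of [box_bound] cost a factor [n^2]; [n + 1] keeps the denominator positive. *)
pose C := e / (n%:R + 1) ^+ 2.
have n1 : 0 < n%:R + 1 :> R by rewrite ltr_wpDl.
have C0 : 0 < C by rewrite divr_gt0// exprn_gt0.
pose F x := f x - P x.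
pose dF i x := partial i f x - partial i P x.
pose ddF j i x := partial j (partial i f) x - partial j (partial i P) x.
have HE a b : hessian f x1 a b = hessian f x1 b a by rewrite -[in LHS]Hs mxE.
have [r r0 rP] : exists2 r : R, 0 < r & forall z, `|z - x1| < r ->
    U z /\ forall i j, `|ddF j i z| <= C.
  have ddnear : \forall z \near x1, forall ij : 'I_n * 'I_n, `|ddF ij.2 ij.1 z| < C.
    suff h (ij : 'I_n * 'I_n) : \forall z \near x1, `|ddF ij.2 ij.1 z| < C.
      exact: (@filter_forall _ _ _ (nbhs x1) _ h).
    case: ij => i j /=.
    have ddc : {for x1, continuous (ddF j i)}.
      have [_ /(_ j)[_ h]] := fC2 i x1 Ux1.
      apply: (continuousB h).
      exact/polyfun_continuous/polyfun_partial/polyfun_partial.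
    have dd0 : `|ddF j i x1| < C.
      by rewrite /ddF partial2_quad// HE hessianE subrr normr0.
    have nc : {for x1, continuous (fun z => `|ddF j i z|)}.
      by apply: continuous_comp; [exact: ddc|exact: norm_continuous].
    exact: (cvgr_lt _ nc _ dd0).
  have Unear : \forall z \near x1, U z by exact: open_nbhs_nbhs.
  have bothnear : \forall z \near x1,
      (forall ij : 'I_n * 'I_n, `|ddF ij.2 ij.1 z| < C) /\ U z.
    by apply: filterS2 ddnear Unear => z.
  move: bothnear => /nbhs_ballP[r /= r0 hr].
  exists r => // z zr; have [|h1 h2] := hr z.
    by rewrite -ball_normE /ball_/= distrC.
  by split=> // i j; apply: ltW; exact: (h1 (i, j)).
have Pd g z v : polyfun g -> is_derive z v g ('D_v g z).
  by move=> gP; apply/derivableP/diff_derivable/polyfun_differentiable.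
have dF0 i : dF i x1 = 0.
  rewrite /dF partial_quad// big1 ?addr0 ?mxE ?subrr// => j _.
  by rewrite subrr mulr0.
have dFle i z : `|z - x1| < r -> `|dF i z| <= n%:R * (C * `|z - x1|).
  move=> zr; rewrite -[dF i z]subr0 -(dF0 i).
  apply: (@box_bound _ _ _ (fun j => ddF j i)) => j y yz;
    have [Uy hy] := rP y (le_lt_trans yz zr); last exact: hy.
  apply: is_deriveB; first by apply: derivableP; have [_ /(_ j)[h _]] := fC2 i y Uy; exact: h.
  by apply: Pd; exact: polyfun_partial.
have F0 : F x1 = 0 by rewrite /F /P quad_center subrr.
apply/nbhs_ballP; exists r => //= x; rewrite -ball_normE /ball_/= distrC => xr.
rewrite -/(F x) -[F x]subr0 -F0.
apply: (@le_trans _ _ (n%:R * ((n%:R * (C * `|x - x1|)) * `|x - x1|))).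
  apply: (@box_bound _ _ _ dF) => i z zx; have zr := le_lt_trans zx xr.
    have [Uz _] := rP z zr; apply: is_deriveB; last exact: Pd.
    by apply: derivableP; have [_ /(_ i)[h _]] := fC1 z Uz; exact: h.
  by rewrite (le_trans (dFle i z zr))// ler_wpM2l// ler_wpM2l// ltW.
have -> : n%:R * ((n%:R * (C * `|x - x1|)) * `|x - x1|) = (n%:R ^+ 2 * C) * `|x - x1| ^+ 2.
  by ring.
rewrite ler_wpM2r ?sqr_ge0// /C mulrA ler_pdivrMr ?exprn_gt0// mulrC ler_pM2l//.
by rewrite ler_pXn2r ?nnegrE ?(ltW n1)// lerDl.
Qed.

End Taylor.

(** * Reduction to quadratic test functions and conclusion *)

Section MinimumPrinciple.
Variable R : realType.

Lemma usc_inf n (D : set 'rV[R]_n) (J : set R) (u : 'rV[R]_(1 + n) -> \bar R) :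
  J !=set0 -> USC (cylinder J D) u ->
  USC D (fun x => ereal_inf [set u (coord_tx t x) | t in J]).
Proof.
move=> [t0 Jt0] uU x Dx.
have cyl t y : J t -> D y -> cylinder J D (coord_tx t y).
  by move=> Jt Dy; apply/cylinderE; rewrite tcoord_tx rsubmx_tx.
split.
  have [ut _] := uU _ (cyl _ _ Jt0 Dx); apply: le_lt_trans ut.
  by apply: ereal_inf_lbound; exists t0.
move=> a /ereal_inf_lt[_ [t Jt <-] ua].
rewrite near_withinE.
have [e e0 he] := near_coord_tx (usc_near uU (cyl _ _ Jt Dx) ua).
apply/nbhs_ballP; exists e => //= y; rewrite -ball_normE /ball_/= distrC => yx Dy.
apply: le_lt_trans (he t y _ yx (cyl _ _ Jt Dy)).
  by apply: ereal_inf_lbound; exists t.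
by rewrite subrr normr0.
Qed.

(** [- H] may lie on the boundary of [F], but not in its interior, so symmetric matrices strictly
    outside [F] are arbitrarily close. Separation requires such a strict witness. *)
Lemma dual_witness m (F : set 'M[R]_m) (H : 'M[R]_m) (e : R) : dual_subeq F H -> 0 < e ->
  exists B : 'M[R]_m, [/\ B^T = B, ~ F B & forall i j, `|B i j + H i j| <= e].
Proof.
move=> [Hs Hn] e0; apply: contrapT => nB; apply: Hn; split.
  by rewrite /Sym2/= linearN/= Hs.
rewrite /within/=; apply/nbhs_ballP; exists e => //= B HB Bs.
apply: contrapT => FB; apply: nB; exists B; split=> // i j.
move: HB; rewrite -ball_normE /ball_/= => HB; apply: le_trans (ltW HB).
have -> : `|B i j + H i j| = `|(- H - B) i j| by rewrite !mxE -opprD normrN addrC.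
by rewrite [leRHS]/Num.norm/= mx_normrE; apply/bigmax_geP; right; exists (i, j).
Qed.

Lemma qform_le n (E : 'M[R]_n) (y : 'I_n -> R) (e : R) : (forall i j, `|E i j| <= e) ->
  `|\sum_i \sum_j E i j * (y i * y j)| <= n%:R * e * \sum_i y i ^+ 2.
Proof.
move=> Ee.
apply: (@le_trans _ _ (\sum_i \sum_j e * (2^-1 * (y i ^+ 2 + y j ^+ 2)))).
  rewrite (le_trans (ler_norm_sum _ _ _))//; apply: ler_sum => i _.
  rewrite (le_trans (ler_norm_sum _ _ _))//; apply: ler_sum => j _.
  rewrite normrM ler_pM// normrM -[y i ^+ 2]real_normK ?num_real//.
  rewrite -[y j ^+ 2]real_normK ?num_real//.
  have := sqr_ge0 (`|y i| - `|y j|); rewrite sqrrB; lra.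
have -> : \sum_i \sum_j e * (2^-1 * (y i ^+ 2 + y j ^+ 2)) =
    e * (2^-1 * (\sum_i \sum_(j < n) y i ^+ 2 + \sum_(i < n) \sum_j y j ^+ 2)).
  rewrite -big_split/= !mulr_sumr; apply: eq_bigr => i _.
  by rewrite -big_split/= !mulr_sumr.
have -> : \sum_i \sum_(j < n) y i ^+ 2 = n%:R * \sum_i y i ^+ 2.
  by rewrite mulr_sumr; apply: eq_bigr => i _; rewrite sumr_const card_ord mulr_natl.
have -> : \sum_(i < n) \sum_j y j ^+ 2 = n%:R * \sum_i y i ^+ 2.
  by rewrite sumr_const card_ord mulr_natl.
by rewrite le_eqVlt; apply/orP; left; apply/eqP; field.
Qed.

Lemma sqn_shift n (x x0 x1 : 'rV[R]_n) :
  sqn (x - x0) = sqn (x1 - x0) + 2 * \sum_i (x1 - x0) 0 i * (x 0 i + - x1 0 i) + sqn (x - x1).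
Proof.
rewrite mulr_sumr /sqn -!big_split/=; apply: eq_bigr => i _; rewrite !mxE; ring.
Qed.

(* The argument is local at a maximum point [x1] of [v + w - a + e |x - x0|^2]:
   by Taylor expansion [v] is dominated near [x1] by a quadratic polynomial
   touching it at [x1], whose Hessian is some [B] near [- hessian w x1] outside
   the subequation. *)
Lemma quadratic_touching n (D K : set 'rV[R]_n) (v : 'rV[R]_n -> \bar R)
    (w a : 'rV[R]_n -> R) (F : set 'M[R]_n) (x0 : 'rV[R]_n) :
  (0 < n)%N -> open D -> USC D v -> C2_on D w ->
  (forall x, D x -> dual_subeq F (hessian w x)) ->
  affine_fun a -> compact K -> K `<=` D ->
  (forall x, topo_boundary K x -> (v x + (w x)%:E <= (a x)%:E)%E) -> K x0 ->
  ((a x0)%:E < v x0 + (w x0)%:E)%E ->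
  exists (x1 : 'rV[R]_n) (V rho sigma : R) (l : 'rV[R]_n) (B : 'M[R]_n),
    [/\ v x1 = V%:E, 0 < rho /\ 0 < sigma, rball x1 rho `<=` D, B^T = B /\ ~ F B &
      forall x, rsphere x1 rho x -> (v x < (quad (V - sigma) l B x1 x)%:E)%E].
Proof.
move=> n0 oD vU wC2 wF [b [p aE]] cK KD bK Kx0 x0a.
have [V0 vV0] : exists V0 : R, v x0 = V0%:E.
  have [+ _] := vU x0 (KD _ Kx0).
  by case: (v x0) x0a => [V0| |]//; exists V0.
have m0 : 0 < V0 + w x0 - a x0.
  by move: x0a; rewrite vV0 -EFinD lte_fin subr_gt0.
have sP : polyfun (fun x => sqn (x - x0)) by exact: polyfun_sqn.
have [xs _ xmax] := EVT_max_rV (ex_intro _ x0 Kx0) cK (polyfun_within (A := K) sP).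
pose S := sqn (xs - x0).
have SK x : K x -> sqn (x - x0) <= S by move=> Kx; apply: xmax; rewrite inE.
have S0 : 0 <= S by exact: sqn_ge0.
(* With [e S] below the gap at [x0], the penalized maximum exceeds every boundary value and is
   attained in the interior of [K]. *)
pose e := (V0 + w x0 - a x0) / (S + 1).
have e0 : 0 < e by rewrite divr_gt0// ltr_wpDl.
have eS : e * S < V0 + w x0 - a x0.
  by rewrite /e mulrAC ltr_pdivrMr ?ltr_wpDl// ltr_pM2l// ltrDl.
have aP : polyfun a.
  have -> : a = fun x => b + \sum_i p 0 i * x 0 i by apply/funext.
  apply: polyfun_add; first exact: polyfun_cst.
  by apply: polyfun_sum => i; apply: polyfun_mul; [exact: polyfun_cst|exact: polyfun_coord].
pose q x := - a x + e * sqn (x - x0).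
have qP : polyfun q.
  apply: polyfun_add; first exact: polyfun_opp.
  by apply: polyfun_mul => //; exact: polyfun_cst.
pose r x := w x + q x.
have rc x : D x -> {for x, continuous r}.
  move=> Dx; have [wC1 _] := wC2; have [wc _] := wC1 x Dx.
  exact: (continuousD wc (polyfun_continuous qP (x := x))).
have [x1 Kx1 x1max] := usc_max (usc_add vU rc) cK KD (ex_intro _ x0 Kx0).
have Dx1 := KD _ Kx1.
have r0E : r x0 = w x0 - a x0.
  rewrite /r /q subrr /sqn big1 ?mulr0 ?addr0// => i _; by rewrite mxE expr0n.
have x1gt : ((e * S)%:E < v x1 + (r x1)%:E)%E.
  apply: lt_le_trans (x1max _ Kx0); rewrite vV0 -EFinD lte_fin r0E; lra.
have [V vV] : exists V : R, v x1 = V%:E.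
  have [+ _] := vU x1 Dx1.
  by case: (v x1) x1gt => [V| |]//; exists V.
have vle x : K x -> (v x <= (V + r x1 - r x)%:E)%E.
  move=> /x1max; rewrite vV; case: (v x) => [c| |].
  - by rewrite -!EFinD !lee_fin; lra.
  - by rewrite addye// -EFinD leye_eq.
  - by move=> _; rewrite leNye.
have Kint : interior K x1.
  apply: contrapT => nint.
  have /bK : topo_boundary K x1 by split=> //; exact: subset_closure.
  rewrite vV -EFinD lee_fin => h; move: x1gt; rewrite vV -EFinD lte_fin /r /q.
  have := SK _ Kx1; rewrite -(ler_pM2l e0); lra.
have Hs : (hessian w x1)^T = hessian w x1 by have [] := wF _ Dx1.
set H := hessian w x1 in Hs *.
(* The budget of the penalty [e |x - x1|^2]: the Taylor remainder takes [e / 2], trading [- H] for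
   [B] takes [e / 4], and [sigma] takes half of what is left on the sphere. *)
pose eta := e / (2 * (n%:R + 1)).
have n1 : 0 < n%:R + 1 :> R by rewrite ltr_wpDl.
have eta0 : 0 < eta by rewrite divr_gt0// mulr_gt0.
have etan : n%:R * eta <= e / 2.
  have -> : e / 2 = (n%:R + 1) * eta by rewrite /eta; field; exact: lt0r_neq0.
  by rewrite ler_pM2r// lerDl.
have [B [Bs FB BH]] := dual_witness (wF _ Dx1) eta0.
have e2 : 0 < e / 2 by rewrite divr_gt0.
have wT := taylor2 oD wC2 Dx1 Hs e2; rewrite -/H in wT.
have /nbhs_ballP[r0 /= r00 hr0] : \forall x \near x1, K x /\
    `|w x - quad (w x1) (grad w x1) H x1 x| <= e / 2 * `|x - x1| ^+ 2.
  by apply: filterS2 Kint wT => x.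
pose rho := r0 / 2.
have rho0 : 0 < rho by rewrite divr_gt0.
have near_ball x : rball x1 rho x -> K x /\
    `|w x - quad (w x1) (grad w x1) H x1 x| <= e / 2 * sqn (x - x1).
  move=> xB; have xr : `|x - x1| <= rho by apply: sqn_norm => //; exact: ltW.
  have [|Kx h] := hr0 x.
    rewrite -ball_normE /ball_/= distrC (le_lt_trans xr)//.
    by rewrite ltr_pdivrMr// mulr2n mulrDr mulr1 ltrDl.
  split=> //; apply: (le_trans h); rewrite ler_pM2l//.
  have -> : sqn (x - x1) = Num.sqrt (sqn (x - x1)) ^+ 2 by rewrite sqr_sqrtr// sqn_ge0.
  rewrite ler_pXn2r// ?nnegrE ?sqrtr_ge0//; apply: sqn_norm; first exact: sqrtr_ge0.
  by rewrite sqr_sqrtr// sqn_ge0.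
pose sigma := e * rho ^+ 2 / 8.
have er0 : 0 < e * rho ^+ 2 by rewrite mulr_gt0// exprn_gt0.
(* The slopes at [x1] of [a], of [- w] and of the penalty [- e |x - x0|^2]. *)
pose l := \row_i (p 0 i - grad w x1 0 i - 2 * e * (x1 - x0) 0 i).
exists x1, V, rho, sigma, l, B; split=> //.
- by split=> //; rewrite divr_gt0.
- by move=> x /near_ball[/KD].
move=> x xS; have xB : rball x1 rho x by move: xS; rewrite /rsphere/rball/= => ->.
have [Kx wx] := near_ball _ xB.
apply: (le_lt_trans (vle _ Kx)); rewrite lte_fin.
have aD : a x = a x1 + \sum_i p 0 i * (x 0 i + - x1 0 i).
  rewrite !aE -addrA -big_split/=; congr (_ + _); apply: eq_bigr => i _; ring.
have sx := sqn_shift x x0 x1.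
have lE : \sum_i l 0 i * (x 0 i + - x1 0 i) =
    \sum_i p 0 i * (x 0 i + - x1 0 i) - \sum_i grad w x1 0 i * (x 0 i + - x1 0 i) -
    2 * e * \sum_i (x1 - x0) 0 i * (x 0 i + - x1 0 i).
  rewrite mulr_sumr -!sumrB; apply: eq_bigr => i _; rewrite [l 0 i]mxE; ring.
have BHle i j : `|(B + H) i j| <= eta by rewrite [(B + H) i j]mxE.
have qE := qform_le (fun i => x 0 i + - x1 0 i) BHle.
have {qE} : `|\sum_i \sum_j (B + H) i j * ((x 0 i + - x1 0 i) * (x 0 j + - x1 0 j))| <=
    e / 2 * sqn (x - x1).
  apply: (le_trans qE).
  have -> : \sum_i (x 0 i + - x1 0 i) ^+ 2 = sqn (x - x1).
    by apply: eq_bigr => i _; rewrite !mxE.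
  by rewrite ler_wpM2r ?sqn_ge0.
have -> : \sum_i \sum_j (B + H) i j * ((x 0 i + - x1 0 i) * (x 0 j + - x1 0 j)) =
    \sum_i \sum_j B i j * ((x 0 i + - x1 0 i) * (x 0 j + - x1 0 j)) +
    \sum_i \sum_j H i j * ((x 0 i + - x1 0 i) * (x 0 j + - x1 0 j)).
  rewrite -big_split/=; apply: eq_bigr => i _; rewrite -big_split/=; apply: eq_bigr => j _.
  by rewrite [(B + H) i j]mxE mulrDl.
have xE : sqn (x - x1) = rho ^+ 2 by exact: xS.
move: wx; rewrite xE /quad lE /r /q sx aD xE /sigma.
move: (\sum_i p 0 i * _) (\sum_i grad w x1 0 i * _) (\sum_i (x1 - x0) 0 i * _) => p' g' d'.
move: (\sum_i \sum_j B i j * _) (\sum_i \sum_j H i j * _) => QB QH.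
move: (sqn (x1 - x0)) (w x) (w x1) (a x1) => s' wx wx1 ax1.
move: er0; rewrite !mulrDr; move: (rho ^+ 2) => R2.
rewrite !ler_norml; clear => er0 /andP[h1 h2] /andP[h3 h4].
have E : e * (2 * d') = 2 * e * d' by ring.
lra.
Qed.

End MinimumPrinciple.

Theorem theorem3p1 (R : realType) (n : nat) (n_ge1 : (1 <= n)%N)
    (D : set 'rV[R]_n) (D_dom : bounded_domain D)
    (J : set R) (J_itv : open_interval J)
    (c : R) (c_ge : n%:R * pi / 2 <= c) (c_lt : c < (n.+1)%:R * pi / 2)
    (u : 'rV[R]_(1 + n) -> \bar R)
    (u_type : of_type (@DSL_subeq R n c) (cylinder J D) u) :
  of_type (@SL_subeq R n (c - pi / 2)) D
    (fun x : 'rV[R]_n => ereal_inf [set u (coord_tx t x) | t in J]).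
Proof.
have [oD _ _ _] := D_dom; have [oJ iJ J0] := J_itv; have [uU _] := u_type.
have vU := usc_inf J0 uU.
split=> // w wC2 wF; split.
  apply: usc_add => // x Dx; have [wC1 _] := wC2; by have [] := wC1 x Dx.
move=> a K aA cK KD bK x0 Kx0; rewrite leNgt; apply/negP => x0a.
have [x1 [V [rho [sigma [l [B [vV [rho0 sigma0] BD [Bs FB] vS]]]]]]] :=
  quadratic_touching n_ge1 oD vU wC2 wF aA cK KD bK Kx0 x0a.
have Bc : theta_SL B < c - pi / 2 by rewrite ltNge; apply/negP => h; apply: FB.
have cn : n%:R * pi / 2 - pi / 2 <= c - pi / 2 by rewrite lerD2r.
have [G [k [G0 Gk GB]]] := separation n_ge1 cn Bs Bc.
have [||t Jt] := minimum_comparison u_type n_ge1 oD oJ iJ c_ge G0 GB Gk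
  (polyfun_quad (V - sigma) l B x1) _ rho0 BD.
- by move=> x; exact: hessian_quad.
- by move=> x /vS /ereal_inf_lt[_ [t Jt <-] ut]; exists t.
rewrite quad_center => ut.
(* At [x1] the polynomial equals [V - sigma], strictly below the infimum [V], yet the comparison
   provides a time at which [u] does not exceed it. *)
have : (V%:E <= (V - sigma)%:E)%E.
  by rewrite -vV; apply: le_trans ut; apply: ereal_inf_lbound; exists t.
by rewrite lee_fin; lra.
Qed.
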